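(* Let $(X,\mu)$, $(X_1,\mu_1)$, $(Y,\nu)$, $(Y_1,\nu_1)$ be standard measure spaces and let $\varphi:X\to X_1$ and $\psi:Y\to Y_1$ be measurable functions such that $\varphi(X)$ and $\psi(Y)$ are measurable, $\varphi_*\mu$ is absolutely continuous with respect to $\mu_1$ and $\psi_*\nu$ is absolutely continuous with respect to $\nu_1$. Let $r:X_1\to[0,\infty)$ and $s:Y_1\to[0,\infty)$ be the Radon–Nikodym derivatives of $\varphi_*\mu$ with respect to $\mu_1$ and of $\psi_*\nu$ with respect to $\nu_1$, and put $Z_X=\{x_1\in X_1:r(x_1)=0\}$, $Z_Y=\{y_1\in Y_1:s(y_1)=0\}$. Let $\kappa_1\subseteq X_1\times Y_1$ be an $\omega$-closed set and $\kappa=\{(x,y)\in X\times Y:(\varphi(x),\psi(y))\in\kappa_1\}$. (i) Suppose that $\varphi$ and $\psi$ are injective up to a null set and have measurable inverses. If $\kappa_1$ is an operator $U$-set (resp. an operator $U_1$-set) then $\kappa$ is an operator $U$-set (resp. an operator $U_1$-set). (ii) Suppose that $\kappa_1\subseteq Z_X^c\times Z_Y^c$. If $\kappa_1$ is an operator $M$-set (resp. an operator $M_1$-set) then $\kappa$ is an operator $M$-set (resp. an operator $M_1$-set). (iii) Suppose that $\mu_1$ (resp. $\nu_1$) is equivalent to $\varphi_*\mu$ (resp. $\psi_*\nu$) and that $\varphi$ and $\psi$ are injective up to a null set and have measurable inverses. Then $\kappa_1$ is an operator $M$-set (resp. an operator $M_1$-set) if and only if $\kappa$ is an operator $M$-set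 (resp. an operator $M_1$-set).
   Context: Standard measure space: a ($\sigma$-finite) regular Borel measure with respect to some complete (separable) metrisable topology. $\varphi_*\mu(\alpha_1)=\mu(\varphi^{-1}(\alpha_1))$, similarly $\psi_*\nu$. The map $\varphi:X\to X_1$ is injective up to a null set and has measurable inverse if there is $\Lambda\subseteq X$ with $\mu(\Lambda)=0$ such that $\varphi|_{\Lambda^c}$ is injective, $\varphi(\Lambda^c)$ is $\mu_1$-measurable and the inverse $\varphi^{-1}:\varphi(\Lambda^c)\to\Lambda^c$ is measurable; similarly for $\psi$. For standard measure spaces $(X,\mu),(Y,\nu)$: a rectangle is $\alpha\times\beta$ with measurable sides; a subset of $X\times Y$ is marginally null if contained in $(X_0\times Y)\cup(X\times Y_0)$ with $\mu(X_0)=\nu(Y_0)=0$; a set is $\omega$-open if it differs by a marginally null set from a countable union of rectangles; $\omega$-closed means complement $\omega$-open. $\Gamma(X,Y)=L^2(X,\mu)\hat\otimes L^2(Y,\nu)$ (projective tensor product) is viewed as functions $h(x,y)=\sum_if_i(x)g_i(y)$, $\sum\|f_i\|_2^2,\sum\|g_i\|_2^2<\infty$, modulo marginally null sets; its dual is $\mathcal B(L^2(X,\mu),L^2(Y,\nu))$ via $\langle T,f\otimes g\rangle=(Tf,\bar g)$. For $\omega$-closed $\kappa\subseteq X\times Y$, $\Phi(\kappa)$ is the set of $h\in\Gamma(X,Y)$ vanishing marginally almost everywhere on $\kappa$, $\Psi(\kappa)$ is the norm closure of the set of $h\in\Gamma(X,Y)$ vanishing on an $\omega$-open neighbourhood of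 $\kappa$, $\mathfrak M_{\min}(\kappa)=\Phi(\kappa)^\perp$, $\mathfrak M_{\max}(\kappa)=\Psi(\kappa)^\perp$. $\kappa$ is an operator $M$-set (resp. operator $M_1$-set) if $\mathfrak M_{\max}(\kappa)$ (resp. $\mathfrak M_{\min}(\kappa)$) contains a non-zero compact operator; otherwise it is an operator $U$-set (resp. operator $U_1$-set). *)

(* Defs.v *)
From HB Require Import structures.
From mathcomp Require Import all_boot all_order all_algebra.
From mathcomp Require Export complex.
From mathcomp Require Export all_classical all_reals all_analysis.
From mathcomp Require Export measurable_realfun.

Set Implicit Arguments.
Unset Strict Implicit.
Unset Printing Implicit Defensive.

Import Order.TTheory GRing.Theory Num.Theory.
Import numFieldNormedType.Exports.
Import ComplexField.Normc.

Local Open Scope classical_set_scope.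
Local Open Scope ring_scope.
Local Open Scope complex_scope.

Section standard_measure_spaces.
Context {R : realType} {d : measure_display} {X : measurableType d}.
Implicit Type mu : {measure set X -> \bar R}.

(* The Polish topology on X is the pullback of that of a complete separable
   metric space P along a bijection j. *)
Definition standard_measure mu : Prop :=
  sigma_finite [set: X] mu /\
  exists (P : metricType R) (j : X -> P),
    [/\ bijective j,
        forall F : set_system P, ProperFilter F -> cauchy F ->
          exists p : P, F --> p,
        exists2 D : set P, countable D & dense D,
        (@measurable d X) = <<s [set j @^-1` U | U in @open P] >> &
        forall A, measurable A ->
          mu A = ereal_inf [set mu (j @^-1` U) |
                   U in [set U | open U /\ A `<=` j @^-1` U]] /\
          mu A = ereal_sup [set mu (j @^-1` K) |
                   K in [set K | compact K /\ j @^-1` K `<=` A]]].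

(* Measurability with respect to the completion of mu; [measurable] itself
   means Borel on a standard space. *)
Definition mu_measurable mu (A : set X) : Prop := completed_algebra_gen mu A.

Definition square_integrable mu (f : X -> R[i]) : Prop :=
  [/\ measurable_fun [set: X] (fun x => complex.Re (f x)),
      measurable_fun [set: X] (fun x => complex.Im (f x)) &
      finite_norm mu 2%:E (fun x => normc (f x))].

Definition L2norm mu (f : X -> R[i]) : \bar R :=
  Lnorm mu 2%:E (fun x => (normc (f x))%:E).

Definition cintegral mu (f : X -> R[i]) : R[i] :=
  Complex (\int[mu]_x complex.Re (f x)) (\int[mu]_x complex.Im (f x)).

Definition L2inner mu (f g : X -> R[i]) : R[i] :=
  cintegral mu (fun x => f x * (g x)^*%C).

Definition square_summable mu (f : nat -> X -> R[i]) : Prop :=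
  (forall i, square_integrable mu (f i)) /\
  (\sum_(0 <= i <oo) L2norm mu (f i) ^+ 2 < +oo)%E.

End standard_measure_spaces.

(* The topology on R[i] is found through its numFieldType structure. *)
Definition ccvg {R : realType} (u : nat -> R[i]) (l : R[i]) : Prop :=
  (u : nat -> (R[i] : numFieldType)) @ \oo --> (l : (R[i] : numFieldType)).

Section maps.
Context {R : realType} {d d1 : measure_display}.
Context {X : measurableType d} {X1 : measurableType d1}.
Variables (mu : {measure set X -> \bar R}) (mu1 : {measure set X1 -> \bar R}).

(* phi @` (B `&` ~` L) is the preimage of B under the inverse of the
   restriction of phi to ~` L. *)
Definition ae_injective_measurable_inverse (phi : X -> X1) : Prop :=
  exists L : set X,
    [/\ mu.-negligible L,
        set_inj (~` L) phi,
        mu_measurable mu1 (phi @` (~` L)) &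
        forall B, measurable B -> mu_measurable mu1 (phi @` (B `&` ~` L))].

Definition Radon_Nikodym_derivative_of
    (nu : set X1 -> \bar R) (r : X1 -> R) : Prop :=
  [/\ forall x, 0 <= r x, measurable_fun [set: X1] r &
      forall A, measurable A -> nu A = (\int[mu1]_(x in A) (r x)%:E)%E].

End maps.

Section operators.
Context {R : realType} {dX dY : measure_display}.
Context {X : measurableType dX} {Y : measurableType dY}.
Variables (mu : {measure set X -> \bar R}) (nu : {measure set Y -> \bar R}).
Implicit Types (kappa E N : set (X * Y)) (h : X * Y -> R[i]).
Implicit Types T : (X -> R[i]) -> (Y -> R[i]).

(* Elements of B(L^2(X,mu), L^2(Y,nu)) are represented by maps on functions,
   of which only the values at square-integrable functions, up to a.e.
   equality, matter.  Linearity and boundedness imply that such a map respects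
   a.e. equality. *)
Record bounded_operator T : Prop := BoundedOperator {
  bounded_operator_L2 : forall f,
    square_integrable mu f -> square_integrable nu (T f);
  bounded_operator_linear : forall (a : R[i]) f g,
    square_integrable mu f -> square_integrable mu g ->
    {ae nu, forall y, T (fun x => a * f x + g x) y = a * T f y + T g y};
  bounded_operator_bounded : exists M : R, forall f,
    square_integrable mu f -> (L2norm nu (T f) <= M%:E * L2norm mu f)%E }.

Definition compact_operator T : Prop :=
  forall f : nat -> X -> R[i],
    (forall n, square_integrable mu (f n) /\ (L2norm mu (f n) <= 1)%E) ->
    exists (k : nat -> nat) (g : Y -> R[i]),
      [/\ {homo k : m n / (m < n)%N},
          square_integrable nu g &
          L2norm nu (fun y => T (f (k n)) y - g y) @[n --> \oo] --> 0%E].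

Definition nonzero_operator T : Prop :=
  exists2 f, square_integrable mu f & ~ {ae nu, forall y, T f y = 0}.

Definition marginally_null N : Prop :=
  exists (X0 : set X) (Y0 : set Y),
    [/\ measurable X0, mu X0 = 0%E, measurable Y0, nu Y0 = 0%E &
        N `<=` (X0 `*` setT) `|` (setT `*` Y0)].

Definition omega_open E : Prop :=
  exists (A : nat -> set X) (B : nat -> set Y),
    [/\ forall n, measurable (A n), forall n, measurable (B n) &
        marginally_null (E `+` \bigcup_n (A n `*` B n))].

Definition omega_closed E : Prop := omega_open (~` E).

Definition vanishes_mae_on h E : Prop :=
  marginally_null [set p | E p /\ h p <> 0].

(* h is the function \sum_i f_i (x) g_i , with the series converging
   marginally almost everywhere. *)
Definition represents (f : nat -> X -> R[i]) (g : nat -> Y -> R[i]) h : Prop :=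
  [/\ square_summable mu f, square_summable nu g &
      marginally_null
        [set p | ~ ccvg (fun n => \sum_(i < n) f i p.1 * g i p.2) (h p)]].

Definition Gamma : set (X * Y -> R[i]) :=
  [set h | exists f g, represents f g h].

(* The projective norm. *)
Definition Gamma_norm h : \bar R :=
  ereal_inf [set s | exists f g, represents f g h /\
    s = (\sum_(0 <= i <oo) (L2norm mu (f i) * L2norm nu (g i)))%E].

Definition Phi kappa : set (X * Y -> R[i]) :=
  [set h | Gamma h /\ vanishes_mae_on h kappa].

Definition Psi kappa : set (X * Y -> R[i]) :=
  [set h | Gamma h /\ forall e : R, 0 < e ->
     exists k, [/\ Gamma k,
       exists E, [/\ omega_open E, kappa `<=` E & vanishes_mae_on k E] &
       (Gamma_norm (fun p => h p - k p)%R < e%:E)%E]].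

(* <T, f (x) g> = (T f, conj g). *)
Definition pairing T (f : X -> R[i]) (g : Y -> R[i]) : R[i] :=
  L2inner nu (T f) (fun y => (g y)^*%C).

(* The value of <T, h> = \sum_i <T, f_i (x) g_i> does not depend on the
   representation of h. *)
Definition annihilator (S : set (X * Y -> R[i])) :
    set ((X -> R[i]) -> (Y -> R[i])) :=
  [set T | bounded_operator T /\
     forall h f g, S h -> represents f g h ->
       ccvg (fun n => \sum_(i < n) pairing T (f i) (g i)) 0].

Definition Mmin kappa := annihilator (Phi kappa).
Definition Mmax kappa := annihilator (Psi kappa).

Definition operator_M_set kappa : Prop :=
  exists T, [/\ Mmax kappa T, compact_operator T & nonzero_operator T].
Definition operator_M1_set kappa : Prop :=
  exists T, [/\ Mmin kappa T, compact_operator T & nonzero_operator T].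
Definition operator_U_set kappa : Prop := ~ operator_M_set kappa.
Definition operator_U1_set kappa : Prop := ~ operator_M1_set kappa.

End operators.

(* Main.v *)
Require Import Defs.
From mathcomp Require Import all_boot all_order all_algebra.
From mathcomp Require Import all_classical all_reals all_analysis.
From HB Require Import structures.
From mathcomp Require Import ring lra.

(* A disintegration along phi of a finite measure equivalent to mu consists of a
   density r on X1 and a map G with G (x1, _) in the fibre of phi over x1.  It
   gives transposed contractions pull : L^2(mu1) -> L^2(mu), a weighted
   composition with phi, and push : L^2(mu) -> L^2(mu1), integration along the
   fibres, with push (pull f) = f where r <> 0.  Hence T = pull T1 push and
   T1 = push T pull turn compact operators into compact operators, and pairing
   them with a tensor amounts to pairing the given operator with the pushed,
   respectively pulled, tensor.

   Pulling tensors back contracts the projective norm and respects omega-open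
   sets, so T1 = push T pull annihilates what it should; it is nonzero since pull
   is onto when phi is injective with measurable inverse.  Pushing forward a tensor
   vanishing on kappa gives a tensor vanishing on kappa1, by dominated convergence
   on the fibres; this settles M_1-sets for T = pull T1 push.  For M-sets, let h
   vanish on an omega-open neighbourhood E of kappa.  Countably many rectangles in
   E and preimages of rectangles in the complement of kappa1 cover X x Y, so by
   Lusin's theorem and compactness finitely many do after removing sets of small
   measure.  The truncation of h therefore vanishes off the preimage of a finite
   union of rectangles disjoint from kappa1, and its push vanishes on an omega-open
   neighbourhood of kappa1.  Finally T is nonzero because T1 is carried by the
   points where the densities do not vanish. *)

Set Implicit Arguments.
Unset Strict Implicit.
Unset Printing Implicit Defensive.

Import Order.TTheory GRing.Theory Num.Theory.
Import numFieldNormedType.Exports.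
Import ComplexField.Normc.

Local Open Scope classical_set_scope.
Local Open Scope ring_scope.
Local Open Scope complex_scope.

(** * Coding points by real numbers *)

(** The conditional laws along [phi] are realised by one measurable map [G] on X1 x R under one
    fixed law [P], so statements about fibres reduce to Tonelli and dominated convergence on
    products. The weight [w] only makes [mu] finite: the square roots in [pull] and [push] absorb
    it, so both act between the original L2 spaces. The density in a disintegration is that of the
    image of [w mu], not the derivative named in the theorem; what matters is its zero set, on which
    that derivative vanishes too, up to a null set. A direct push fails for M-sets because a
    neighbourhood E of kappa need not be a preimage: the push of a function vanishing on E need not
    vanish near kappa1. Moreover the complement of a countable union of rectangles need not be
    omega-open, while that of a finite union is; this is what the reduction to finitely many
    rectangles buys. Its price, a truncation error, is controlled by ab <= a^2/t + t b^2 with t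
    matched to the allowed error. *)

Section ternary_code.
Context {R : realType}.
Implicit Types b : nat -> bool.

(** Base 3 with digits 0 and 1, as for the Cantor set: the places after N add up to at most 3^-N /
    2, less than one digit at place N. In base 2 distinct sequences could share a code. *)
Let term b : R^nat := fun n => (b n)%:R * 3^-1 ^+ n.
Let code b : R := limn (series (term b)).

Let pow3_gt0 n : 0 < 3^-1 ^+ n :> R.
Proof. by rewrite exprn_gt0// invr_gt0. Qed.

Lemma sum_pow3 N k :
  \sum_(N <= n < N + k) 3^-1 ^+ n = 3 / 2 * (3^-1 ^+ N - 3^-1 ^+ (N + k)) :> R.
Proof.
elim: k => [|k IH]; first by rewrite addn0 big_geq// subrr mulr0.
by rewrite addnS big_nat_recr ?leq_addr//= IH exprS; field.
Qed.

Lemma sum_pow3_le N m : (N <= m)%N ->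
  \sum_(N <= n < m) 3^-1 ^+ n <= 3 / 2 * 3^-1 ^+ N :> R.
Proof.
move=> /subnKC <-; rewrite sum_pow3.
by have := pow3_gt0 (N + (m - N)); lra.
Qed.

Let term_ge0 b n : 0 <= term b n.
Proof. by rewrite /term; case: (b n); rewrite ?mul0r// mul1r ltW. Qed.

Let term_le b n : term b n <= 3^-1 ^+ n.
Proof. by rewrite /term; case: (b n); [rewrite mul1r|rewrite mul0r ltW]. Qed.

Lemma cvg_code b : cvgn (series (term b)).
Proof.
apply: nondecreasing_is_cvgn.
  by apply/nondecreasing_seqP => n; rewrite seriesSr lerDl term_ge0.
exists (3 / 2) => _ [n _ <-].
rewrite (le_trans (y := \sum_(0 <= k < n) 3^-1 ^+ k))//.
  by rewrite /series/=; apply: ler_sum => i _; exact: term_le.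
by rewrite (le_trans (sum_pow3_le (leq0n n)))// expr0 mulr1.
Qed.

Lemma code_ge0 b : 0 <= code b.
Proof.
apply: limr_ge; first exact: cvg_code.
near=> n.
by rewrite /series/= sumr_ge0.
Unshelve. all: end_near. Qed.

Lemma code_lt2 b : code b < 2.
Proof.
apply: (@le_lt_trans _ _ (3 / 2)); last lra.
apply: limr_le; [exact: cvg_code|near=> n].
rewrite (le_trans (y := \sum_(0 <= k < n) 3^-1 ^+ k))//.
  by rewrite /series/=; apply: ler_sum => i _; exact: term_le.
by rewrite (le_trans (sum_pow3_le (leq0n n)))// expr0 mulr1.
Unshelve. all: end_near. Qed.

Let series_sub b b' N m : (N <= m)%N -> (forall n, (n < N)%N -> b n = b' n) ->
  series (term b) m - series (term b') m =
  \sum_(N <= n < m) (term b n - term b' n).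
Proof.
move=> Nm bb'; rewrite /series/= -sumrB (big_cat_nat _ (n := N))//=.
rewrite big_nat_cond big1 ?add0r// => i /andP[/andP[_ iN] _].
by rewrite /term bb'// subrr.
Qed.

Lemma code_close b b' N : (forall n, (n < N)%N -> b n = b' n) ->
  `|code b - code b'| <= 3 / 2 * 3^-1 ^+ N.
Proof.
move=> bb'; rewrite /code -limB; [|exact: cvg_code..].
rewrite -lim_norm; last by apply: is_cvgB; exact: cvg_code.
apply: limr_le; first by apply: is_cvg_norm; apply: is_cvgB; exact: cvg_code.
near=> m.
have Nm : (N <= m)%N by near: m; exact: nbhs_infty_ge.
rewrite [X in `|X|](_ : _ = series (term b) m - series (term b') m)//.
rewrite (series_sub Nm bb') (le_trans (ler_norm_sum _ _ _))//.
apply: le_trans (sum_pow3_le Nm); apply: ler_sum => i _.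
rewrite -/(term b i) ler_norml; have := term_ge0 b i; have := term_ge0 b' i.
by have := term_le b i; have := term_le b' i; lra.
Unshelve. all: end_near. Qed.

Let code_lt b b' N : (forall n, (n < N)%N -> b n = b' n) -> b N -> ~~ b' N ->
  code b' < code b.
Proof.
move=> bb' bN b'N; rewrite -subr_gt0 /code -limB; [|exact: cvg_code..].
apply: (@lt_le_trans _ _ (3^-1 ^+ N / 2)); first by rewrite divr_gt0.
apply: limr_ge; first by apply: is_cvgB; exact: cvg_code.
near=> m.
have Nm : (N < m)%N by near: m; exact: nbhs_infty_gt.
rewrite [leRHS](_ : _ = series (term b) m - series (term b') m)//.
rewrite (series_sub (ltnW Nm) bb') big_ltn//.
have -> : term b N - term b' N = 3^-1 ^+ N.
  by rewrite /term bN (negbTE b'N) mul0r subr0 mul1r.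
(* The worst case is that all later digits of [b] are 0 and all those of [b'] are 1. *)
have : - (\sum_(N.+1 <= n < m) 3^-1 ^+ n)
    <= \sum_(N.+1 <= n < m) (term b n - term b' n).
  rewrite -sumrN; apply: ler_sum => i _; have := term_ge0 b i.
  by have := term_le b' i; lra.
by have := sum_pow3_le Nm; rewrite exprS; lra.
Unshelve. all: end_near. Qed.

Lemma code_inj b b' : code b = code b' -> b =1 b'.
Proof.
move=> bb' n; apply/eqP/negPn/negP => ne.
have ex : exists n, b n != b' n by exists n.
case: (ex_minnP ex) => N bN min.
have agree k : (k < N)%N -> b k = b' k.
  by move=> kN; apply/eqP/negPn/negP => /min; rewrite leqNgt kN.
have := bN; case bNE : (b N); case b'NE : (b' N) => // _.
- by have := code_lt agree bNE (negbT b'NE); rewrite bb' ltxx.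
- have agree' k : (k < N)%N -> b' k = b k by move=> /agree.
  by have := code_lt agree' b'NE (negbT bNE); rewrite bb' ltxx.
Qed.

End ternary_code.

(* [ternary U x] encodes the sequence of the truth values of [x \in U n]. *)
Definition ternary {R : realType} {T : Type} (U : nat -> set T) (x : T) : R :=
  limn (series (fun n => (x \in U n)%:R * 3^-1 ^+ n : R)).

Section ternary.
Context {R : realType} {T : Type}.
Implicit Types U : nat -> set T.
Let tern U x : R := ternary U x.

Lemma ternary_ge0 U x : 0 <= tern U x.
Proof. exact: (@code_ge0 _ (fun n => x \in U n)). Qed.

Lemma ternary_lt2 U x : tern U x < 2.
Proof. exact: (@code_lt2 _ (fun n => x \in U n)). Qed.

(** Through this bound, relative openness of the sets [U n] and of their complements turns into
    continuity of the code. *)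
Lemma ternary_close U x y N : (forall n, (n < N)%N -> (U n x <-> U n y)) ->
  `|tern U x - tern U y| <= 3 / 2 * 3^-1 ^+ N.
Proof.
move=> xy; apply: (@code_close _ (fun n => x \in U n) (fun n => y \in U n)).
by move=> n /xy nxy; apply/idP/idP; rewrite !inE => /nxy.
Qed.

Lemma ternary_inj U x y : tern U x = tern U y -> forall n, U n x <-> U n y.
Proof.
move=> /(@code_inj _ (fun n => x \in U n) (fun n => y \in U n)) xy n.
by have := xy n => /= {}xy; split => Un; apply/set_mem; [rewrite -xy|rewrite xy];
  exact: mem_set.
Qed.

End ternary.

Lemma measurable_ternary {R : realType} d (T : measurableType d)
    (U : nat -> set T) : (forall n, measurable (U n)) ->
  measurable_fun [set: T] (ternary U : T -> R).
Proof.
move=> mU.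
apply: (measurable_fun_cvg (h := fun m x =>
  \sum_(0 <= n < m) ((x \in U n)%:R * 3^-1 ^+ n))).
- move=> m; apply: measurable_sum => n.
  apply: measurable_funM => //.
  by apply: (eq_measurable_fun (\1_(U n) : T -> R)).
- by move=> x _; exact: (@cvg_code R (fun n => x \in U n)).
Qed.

(** * Disintegration of measures *)

(** A pushforward is a measure only together with a proof that the map is measurable. The bundled
    witness equals it as a set function, so later rewriting never meets that proof. *)
Lemma pushforward_pack {R : realType} d1 d2 (T1 : measurableType d1)
    (T2 : measurableType d2) (m : {measure set T1 -> \bar R}) (f : T1 -> T2) :
  measurable_fun setT f ->
  exists m' : {measure set T2 -> \bar R}, m' = pushforward m f :> (set T2 -> \bar R).
Proof.
move=> mf; unshelve eexists (pushforward m f : {measure set T2 -> \bar R}); first exact: mf.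
by [].
Qed.

Section pack_measure.
Context {R : realType} d (T : measurableType d).

Lemma sigma_finite_measure_pack (m : {measure set T -> \bar R}) :
  sigma_finite [set: T] m ->
  exists m' : {sigma_finite_measure set T -> \bar R}, m = m'.
Proof.
move=> mT.
pose H2 := isSFinite.Build _ _ _ _ (sfinite_measure_sigma_finite mT).
pose H3 := isSigmaFinite.Build _ _ _ _ mT.
pose m' := HB.pack_for (SigmaFiniteMeasure.type T R) (Measure.sort m) H2 H3.
by exists m'; exact: eq_measure.
Qed.

Lemma finite_measure_pack (m : {measure set T -> \bar R}) :
  (m setT < +oo)%E -> exists m' : {finite_measure set T -> \bar R}, m = m'.
Proof.
move=> mT.
have fm : fin_num_fun m.
  move=> A mA; rewrite ge0_fin_numE//; apply: le_lt_trans mT.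
  by apply: le_measure; rewrite ?inE.
have sf : sigma_finite setT m.
  by apply: fin_num_fun_sigma_finite; rewrite ?measure0.
pose H1 := isFinite.Build _ _ _ _ fm.
pose H2 := isSFinite.Build _ _ _ _ (sfinite_measure_sigma_finite sf).
pose H3 := isSigmaFinite.Build _ _ _ _ sf.
pose m' := HB.pack_for (FiniteMeasure.type T R) (Measure.sort m) H1 H2 H3.
by exists m'; exact: eq_measure.
Qed.

Lemma finite_density (nu mu : {measure set T -> \bar R}) :
  (nu setT < +oo)%E -> sigma_finite [set: T] mu -> nu `<< mu ->
  exists f : T -> R, [/\ forall x, 0 <= f x, measurable_fun setT f,
    mu.-integrable setT (EFin \o f) &
    forall A, measurable A -> nu A = (\int[mu]_(x in A) (f x)%:E)%E].
Proof.
move=> /finite_measure_pack[nu' ->] /sigma_finite_measure_pack[mu' ->] numu'.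
have [f [f0 ffin fint fE]] := radon_nikodym_sigma_finite numu'.
have fEF x : (fine (f x))%:E = f x by rewrite fineK.
have fEF' : EFin \o (fine \o f) = f by apply/funext => x /=.
exists (fine \o f); split.
- by move=> x; rewrite fine_ge0.
- apply/measurable_EFinP; rewrite fEF'.
  exact: measurable_int fint.
- by rewrite fEF'.
- move=> A mA; apply: etrans (fE A mA) _.
  by apply: eq_integral => x _ /=; rewrite fEF.
Qed.

(** On the set where f exceeds g the integral of f - g is nonnegative by construction and
    nonpositive by hypothesis, so it is 0 and the set is null. *)
Lemma ae_le_of_integral (mu : {measure set T -> \bar R}) (f g : T -> R) :
  mu.-integrable setT (EFin \o f) -> mu.-integrable setT (EFin \o g) ->
  (forall A, measurable A -> (\int[mu]_(x in A) (f x)%:E <= \int[mu]_(x in A) (g x)%:E)%E) ->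
  {ae mu, forall x, f x <= g x}.
Proof.
move=> fi gi fg.
have mf : measurable_fun setT f by apply/measurable_EFinP; exact: measurable_int fi.
have mg : measurable_fun setT g by apply/measurable_EFinP; exact: measurable_int gi.
pose D := [set x | g x < f x].
have mD : measurable D.
  by have := measurable_fun_ltr mg mf => /(_ measurableT [set true]); rewrite setTI; exact.
have fiD := integrableS measurableT mD (@subsetT _ _) fi.
have giD := integrableS measurableT mD (@subsetT _ _) gi.
have int0 : (\int[mu]_(x in D) `|(f x - g x)%:E| = 0)%E.
  under eq_integral => x /[!inE] Dx.
    rewrite gee0_abs; last by rewrite lee_fin subr_ge0 ltW.
    over.
  apply/eqP; rewrite eq_le; apply/andP; split; last first.
    by apply: integral_ge0 => x Dx; rewrite lee_fin subr_ge0 ltW.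
  rewrite (_ : (\int[mu]_(x in D) (f x - g x)%:E)%E =
    (\int[mu]_(x in D) (f x)%:E - \int[mu]_(x in D) (g x)%:E)%E); last first.
    by rewrite -integralB.
  rewrite lee_subel_addr ?add0e ?fg//.
have mfg : measurable_fun D (fun x => (f x - g x)%:E).
  by apply/measurable_EFinP; apply: measurable_funTS; exact: measurable_funB.
have /(_ int0)[N [mN N0 DN]] := (ae_eq_integral_abs mu mD mfg).1.
exists N; split => //; apply: subset_trans DN => x /= /negP; rewrite -ltNge => Dx.
by apply/not_implyP; split => //; apply/eqP; rewrite eqe gt_eqF// subr_gt0.
Qed.

End pack_measure.

(** * Conditional laws of a finite measure on T x R *)

Section conditional_quantile.
Context {R : realType} d (T : measurableType d).

Lemma ae_forall_rat (m : {measure set T -> \bar R}) (P : rat -> T -> Prop) :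
  (forall q, \forall x \ae m, P q x) -> \forall x \ae m, forall q, P q x.
Proof.
move=> aeP; have := @ae_foralln _ _ _ m (fun n => P (odflt 0 (unpickle n))).
move=> /(_ (fun n => aeP _)); apply: filterS => x Px q.
by have := Px (pickle q); rewrite pickleK.
Qed.

Variables (m : {measure set (T * R) -> \bar R}) (m1 : {measure set T -> \bar R}).
Hypothesis m_fin : (m setT < +oo)%E.
Hypothesis m1E : forall B, measurable B -> m1 B = m (B `*` setT).

Let m_lty A : measurable A -> (m A < +oo)%E.
Proof. by move=> mA; apply: le_lt_trans m_fin; apply: le_measure; rewrite ?inE. Qed.

Let m1_fin : (m1 setT < +oo)%E.
Proof. by rewrite m1E// setXTT. Qed.

Let m1_sigma_finite : sigma_finite [set: T] m1.
Proof. by case: (finite_measure_pack m1_fin) => m1' ->; exact: sigma_finiteT. Qed.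

(** For fixed rational q the mass of B x ]-oo, q] is dominated by the marginal [m1], and [F q] is
    the density. With q rational, the exceptional sets for the order and for the bounds are
    countably many, so one null set contains them all. *)
Lemma conditional_cdf : exists F : rat -> T -> R,
  [/\ forall q, measurable_fun setT (F q),
      forall q x, 0 <= F q x <= 1,
      forall q q' x, q <= q' -> F q x <= F q' x &
      forall q B, measurable B ->
        m (B `*` `]-oo, ratr q]) = (\int[m1]_(x in B) (F q x)%:E)%E].
Proof.
have dens (q : rat) : exists f : T -> R, [/\ forall x, 0 <= f x,
    measurable_fun setT f, m1.-integrable setT (EFin \o f) &
    forall B, measurable B ->
      m (B `*` `]-oo, ratr q]) = (\int[m1]_(x in B) (f x)%:E)%E].
  have mq : measurable ([set: T] `*` `]-oo, (ratr q : R)]).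
    by apply: measurableX.
  have [nu nuE'] := pushforward_pack (mrestr m mq) (@measurable_fst _ _ T R).
  have nuE B : measurable B -> nu B = m (B `*` `]-oo, ratr q]).
    move=> mB; rewrite nuE' /pushforward /mrestr; congr (m _).
    by apply/seteqP; split => [[x y]/= [? []]|[x y]/= []].
  have [|||f [f0 mf fi fE]] := @finite_density R _ T nu m1.
  - by rewrite nuE// m_lty//; exact: measurableX.
  - exact: m1_sigma_finite.
  - apply/null_content_dominatesP => B mB m1B.
    rewrite nuE//; apply/eqP; rewrite eq_le measure_ge0 andbT.
    have {}m1B : m1 B = 0%E := m1B.
    rewrite -m1B m1E//; apply: le_measure; rewrite ?inE; try exact: measurableX.
    by move=> [x y] [].
  - by exists f; split => // B mB; rewrite -nuE// -fE.
have /choice[f fP] := dens.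
have fint q : m1.-integrable setT (EFin \o f q) by case: (fP q).
have mono : \forall x \ae m1, forall q q', q <= q' -> f q x <= f q' x.
  apply: ae_forall_rat => q; apply: ae_forall_rat => q'.
  have [qq'|qq'] := boolP (q <= q'); last exact: aeW.
  have := ae_le_of_integral (fint q) (fint q').
  move=> H; suff : \forall x \ae m1, f q x <= f q' x by apply: filterS => x.
  apply: H => B mB; have [_ _ _ <-//] := fP q; have [_ _ _ <-//] := fP q'.
  apply: le_measure; rewrite ?inE; try exact: measurableX.
  move=> [x y]/= []; rewrite !in_itv/= => Bx yq; split => //.
  by rewrite (le_trans yq)// ler_rat.
have bnd : \forall x \ae m1, forall q, f q x <= 1.
  apply: ae_forall_rat => q; apply: ae_le_of_integral => //.
    case: (finite_measure_pack m1_fin) => m1' ->.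
    exact: finite_measure_integrable_cst.
  move=> B mB; have [_ _ _ <-//] := fP q; rewrite integral_cst// mul1e m1E//.
  apply: le_measure; rewrite ?inE; try exact: measurableX.
  by move=> [x y] [].
have [N [mN N0 sN]] : \forall x \ae m1, (forall q q', q <= q' -> f q x <= f q' x)
    /\ forall q, f q x <= 1 by exact: filterI.
pose F q x := f q x * \1_(~` N) x.
have good x : ~ N x -> (forall q q', q <= q' -> f q x <= f q' x)
    /\ forall q, f q x <= 1.
  by move=> Nx; apply: contrapT => bad; apply: Nx; exact: sN.
have FE x q : ~ N x -> F q x = f q x.
  by move=> Nx; rewrite /F indicE mem_set// mulr1.
have F0 x q : N x -> F q x = 0.
  by move=> Nx; rewrite /F indicE memNset ?mulr0// => /(_ Nx).
exists F; split.
- move=> q; have [_ mf _ _] := fP q; apply: measurable_funM => //.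
  by apply: measurable_indic; exact: measurableC.
- move=> q x; have [Nx|Nx] := pselect (N x); first by rewrite F0// lexx ler01.
  by rewrite FE//; have [-> _ _ _] := fP q; have [_ ->] := good x Nx.
- move=> q q' x qq'; have [Nx|Nx] := pselect (N x); first by rewrite !F0.
  by rewrite !FE//; have [->] := good x Nx.
- move=> q B mB; have [_ mf _ ->//] := fP q.
  apply: ge0_ae_eq_integral => //.
  + by apply/measurable_EFinP; exact: measurable_funTS.
  + apply/measurable_EFinP; apply: measurable_funM; first exact: measurable_funTS.
    by apply: measurable_indic; exact: measurableC.
  + by move=> x _; rewrite lee_fin; have [] := fP q.
  + move=> x _; rewrite lee_fin; have [Nx|Nx] := pselect (N x); first by rewrite F0.
    by rewrite FE//; have [] := fP q.
  + exists N; split => // x /= /not_implyP[_]; apply: contra_notP => Nx.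
    by rewrite FE.
Qed.

End conditional_quantile.

Section conditional_quantile_function.
Context {R : realType} d (T : measurableType d).
Variables (m : {measure set (T * R) -> \bar R}) (m1 : {measure set T -> \bar R}).
Variable P : probability R R.
Hypothesis m_fin : (m setT < +oo)%E.
Hypothesis m1E : forall B, measurable B -> m1 B = m (B `*` setT).
Hypothesis m_supp : m (~` ([set: T] `*` `[0, 2[)) = 0%E.
Hypothesis PE : forall c : R, 0 <= c <= 1 -> P `]-oo, c]%classic = c%:E.

Let m_lty A : measurable A -> (m A < +oo)%E.
Proof. by move=> mA; apply: le_lt_trans m_fin; apply: le_measure; rewrite ?inE. Qed.

(** Two pi-system arguments: with B fixed, open half-lines generate the Borel sets of R; then
    rectangles generate the product. *)
Let rectangles_eq (m' : {measure set (T * R) -> \bar R}) :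
  (forall B t, measurable B -> m (B `*` `]-oo, t[) = m' (B `*` `]-oo, t[)) ->
  forall A, measurable A -> m A = m' A.
Proof.
move=> mm'.
have rect B S : measurable B -> measurable S -> m (B `*` S) = m' (B `*` S).
  move=> mB mS.
  have mBT : measurable (B `*` [set: R]) by exact: measurableX.
  have [n nE] := pushforward_pack (mrestr m mBT) (@measurable_snd _ _ T R).
  have [n' n'E] := pushforward_pack (mrestr m' mBT) (@measurable_snd _ _ T R).
  have EQ U : snd @^-1` U `&` B `*` setT = B `*` U :> set (T * R).
    by apply/seteqP; split => [[x y]/= [? []]|[x y]/= []].
  have nS U : n U = m (B `*` U) by rewrite nE; congr (m _); exact: EQ.
  have n'S U : n' U = m' (B `*` U) by rewrite n'E; congr (m' _); exact: EQ.
  rewrite -nS -n'S.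
  apply: (@measure_unique _ R R (@RGenInftyO.G R) (fun k => `]-oo, k%:R[%classic)) => //.
  - exact: RGenInftyO.measurableE.
  - move=> _ _ [x ->] [y ->]; exists (Num.min x y).
    by apply/seteqP; split => z /=; rewrite !in_itv/= lt_min => /andP.
  - by move=> i; exists i%:R.
  - apply/seteqP; split => // x _.
    exists (Num.truncn `|x|).+1 => //=; rewrite in_itv/=.
    by rewrite (le_lt_trans (ler_norm x))// truncnS_gt.
  - by move=> _ [t ->]; rewrite nS n'S mm'.
  - by move=> k; rewrite nS m_lty//; exact: measurableX.
move=> A mA.
apply: (@measure_unique _ _ _ [set A `*` B | A in measurable & B in measurable]
   (fun=> setT)) => //.
- exact: measurable_prod_measurableType.
- move=> _ _ [B1 mB1 [S1 mS1 <-]] [B2 mB2 [S2 mS2 <-]].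
  exists (B1 `&` B2); first exact: measurableI.
  by exists (S1 `&` S2); [exact: measurableI|rewrite setXI].
- by move=> _; exists setT => //; exists setT => //; rewrite setXTT.
- by rewrite bigcup_const.
- by move=> _ [B mB [S mS <-]]; exact: rect.
Qed.

Let q (k : nat) : rat := odflt 0 (unpickle k).

Let rat_approx (t : R) : 0 < t -> exists a : nat -> rat,
  [/\ {homo a : i j / (i <= j)%N >-> i <= j},
      forall n, 0 <= a n /\ ratr (a n) < t &
      forall p : rat, ratr p < t -> exists n, p <= a n].
Proof.
move=> t0.
(* Running maximum of the enumerated rationals below t, started at 0, which is where 0 < t enters.
   It turns a union over rationals into an increasing one. *)
pose a := fix a n : rat := if n is n'.+1 then
  if (a n' <= q n') && (ratr (q n') < t) then q n' else a n' else 0.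
have aS n : a n <= a n.+1 by rewrite /=; case: ifP => // /andP[].
exists a; split.
- by apply/nondecreasing_seqP.
- elim => [|n [a0 IH]]; first by rewrite /= rmorph0.
  by rewrite /=; case: ifP => // /andP[aq qt]; rewrite (le_trans a0).
- move=> p pt; exists (pickle p).+1; rewrite /= /q pickleK/= pt andbT.
  by case: ifP => // /negbT; rewrite -ltNge => /ltW.
Qed.

(* The quantile transform of the conditional distribution functions. *)
Lemma conditional_quantile : exists g : T * R -> R,
  measurable_fun setT g /\ forall A, measurable A ->
    m A = (m1 \x P)%E ((fun z => (z.1, g z)) @^-1` A).
Proof.
have [F [mF F01 Fmono FE]] := conditional_cdf m_fin m1E.
pose E p : set (T * R) := [set z | z.2 <= F p z.1].
have mE p : measurable (E p).
  have /(_ measurableT [set true]) := measurable_fun_ler (@measurable_snd _ _ T R)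
    (measurableT_comp (mF p) (@measurable_fst _ _ T R)).
  by rewrite setTI; exact.
(* The value 2 plays the role of +oo, because almost all second coordinates lie in [0, 2[; for the
   same reason negative rationals are discarded. The infimum over k is then the generalised inverse
   of the conditional distribution function. *)
pose h k z : R := if (0 <= q k) && (z.2 <= F (q k) z.1) then ratr (q k) else 2.
have h0 k z : 0 <= h k z.
  by rewrite /h; case: ifP => // /andP[q0 _]; rewrite ler0q.
have mh k : measurable_fun setT (h k).
  rewrite /h; have [q0|q0]/= := boolP (0 <= q k); last exact: measurable_cst.
  apply: measurable_fun_ifT => //.
  exact: measurable_fun_ler (@measurable_snd _ _ T R)
    (measurableT_comp (mF (q k)) (@measurable_fst _ _ T R)).
pose g z : R := infs (h^~ z) 0%N.
have lbh z : has_lbound (range (h^~ z)) by exists 0 => _ [k _ <-].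
have mg : measurable_fun setT g by exact: measurable_fun_infs.
have sd z : sdrop (h^~ z) 0 = range (h^~ z).
  by rewrite /sdrop; congr (image _ _); apply/seteqP; split.
have g_lt z t : g z < t <-> exists k, h k z < t.
  rewrite /g /infs/= sd; split.
    by move=> /inf_lt[|_ [k _ <-] kt]; [by exists (h 0%N z), 0%N|by exists k].
  by move=> [k]; apply: le_lt_trans; apply: ge_inf => //; exists k.
have g0 z : 0 <= g z.
  by rewrite leNgt; apply/negP => /g_lt[k]; rewrite ltNge h0.
exists g; split => //.
have mg' : measurable_fun setT (fun z : T * R => (z.1, g z)).
  by apply/measurable_fun_pairP; split => //; exact: measurable_fst.
have [m' m'E] := pushforward_pack (m1 \x P)%E mg'.
suff eqm : forall A, measurable A -> m A = m' A.
  by move=> A mA; rewrite eqm// m'E.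
apply: rectangles_eq => B t mB; rewrite m'E /pushforward.
(* The section of [E p] at x is ]-oo, F p x], whose [P]-measure is F p x because [P] is uniform on
   [0, 1]. *)
have EB p : (m1 \x P)%E (B `*` setT `&` E p) = m (B `*` `]-oo, ratr p]).
  rewrite FE// /product_measure1 [RHS]integral_mkcond; apply: eq_integral => x _ /=.
  rewrite patchE; case: ifPn => xB.
    rewrite -PE//; congr (P _); apply/seteqP; split => u.
      by rewrite /xsection/= inE /E/= in_itv/= => -[].
    rewrite /= in_itv/= => uF; rewrite /xsection/=; apply/mem_set.
    by split => //=; split => //=; exact/set_mem.
  rewrite (_ : xsection _ _ = set0) ?measure0//.
  apply/seteqP; split => // u; rewrite /xsection/= inE => -[[Bx _] _].
  by move/negP : xB; apply; exact/mem_set.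
have [t0|t0] := leP t 0.
  rewrite [X in _ = (_ \x _)%E X](_ : _ = set0) ?measure0; last first.
    apply/seteqP; split => // z [_ /=]; rewrite in_itv/= => gt.
    by have := g0 z; rewrite leNgt (lt_le_trans gt t0).
  apply/eqP; rewrite eq_le measure_ge0 andbT -m_supp.
  apply: le_measure; rewrite ?inE; first exact: measurableX.
    by apply: measurableC; exact: measurableX.
  move=> [x y] [_ /=]; rewrite /= !in_itv/= => yt [_ /andP[y0 _]].
  by have := lt_le_trans yt t0; rewrite ltNge y0.
(* Beyond 2 the default value of [h] is already below t, so both sides are the marginal mass of B;
   the rational -1 gives an index at which [h] takes the default. *)
have [t2|t2] := ltP 2 t.
  have -> : (fun z => (z.1, g z)) @^-1` (B `*` `]-oo, t[) = B `*` setT.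
    apply/seteqP; split => -[x u]/= []; first by [].
    move=> Bx _; split => //=; rewrite in_itv/=; apply/g_lt; exists (pickle (-1 : rat)).
    by rewrite /h /q pickleK/=.
  apply: etrans (esym (product_measure1E m1 P mB measurableT)).
  transitivity (m1 B * 1)%E; last first.
    by congr (_ * _)%E; exact/esym/(probability_setT P).
  rewrite mule1 m1E//.
  apply/eqP; rewrite eq_le; apply/andP; split.
    apply: le_measure; rewrite ?inE; try exact: measurableX.
    by move=> [x y] [].
  rewrite -[leRHS]adde0 -m_supp.
  apply: (@le_trans _ _ (m ((B `*` `]-oo, t[) `|` ~` ([set: T] `*` `[0, 2[)))); last first.
    by apply: measureU2; [|apply: measurableC]; exact: measurableX.
  apply: le_measure; rewrite ?inE; first exact: measurableX.
    apply: measurableU; first exact: measurableX.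
    by apply: measurableC; exact: measurableX.
  move=> [x y] [/= Bx _]; have [yt|yt] := ltP y t; first by left; split; rewrite //= in_itv.
  by right => -[_ /=]; rewrite in_itv/= => /andP[_ y2]; have := lt_le_trans (lt_trans y2 t2) yt; rewrite ltxx.
(* For 0 < t <= 2 only genuine rationals below t matter, and both sides are increasing limits along
   the same sequence [a]. *)
have [a [ahomo abnd acof]] := rat_approx t0.
have cvgl : (m \o (fun n => B `*` `]-oo, ratr (a n)])) n @[n --> \oo] --> m (B `*` `]-oo, t[).
  have -> : B `*` `]-oo, t[ = \bigcup_n (B `*` `]-oo, ratr (a n)]).
    apply/seteqP; split => [[x y] [/= Bx]|[x y] [n _ [/= Bx]]];
      rewrite /= !in_itv/=.
      move=> /rat_in_itvoo[p]; rewrite inE/= ?in_itv/= => /andP[yp /acof[n pa]].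
      exists n => //; split => //=; apply: le_trans (ltW yp) _.
      by rewrite ler_rat.
    by move=> yn; split => //=; apply: (le_lt_trans yn); case: (abnd n).
  apply: nondecreasing_cvg_mu.
  - by move=> n; exact: measurableX.
  - by apply: bigcupT_measurable => n; exact: measurableX.
  - move=> i j ij; apply/subsetPset => -[x y] [/= Bx]; rewrite /= !in_itv/= => yi.
    by split => //=; apply: (le_trans yi); rewrite ler_rat ahomo.
have -> : (fun z => (z.1, g z)) @^-1` (B `*` `]-oo, t[) =
    \bigcup_n (B `*` setT `&` E (a n)).
  apply/seteqP; split => [z [/= Bx]|z [n _ [/= [Bx _] Ez]]].
    rewrite in_itv/= => /g_lt[k]; rewrite /h; case: ifP => [/andP[q0 zF] qt|_ ].
      have [n pa] := acof _ qt; exists n => //; split => //.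
      by apply: le_trans zF _; exact: Fmono.
    by rewrite ltNge t2.
  split => //=; rewrite in_itv/=; apply/g_lt; exists (pickle (a n)).
  by rewrite /h /q pickleK/= Ez; case: (abnd n) => ->.
apply: (@cvg_unique _ _ _ _ _ _ cvgl) => //.
rewrite (_ : m \o _ = (m1 \x P)%E \o (fun n => B `*` setT `&` E (a n))); last first.
  by apply/funext => n /=; rewrite EB.
apply: nondecreasing_cvg_mu.
- by move=> n; apply: measurableI => //; exact: measurableX.
- by apply: bigcupT_measurable => n; apply: measurableI => //; exact: measurableX.
- move=> i j ij; apply/subsetPset => z [Bz Ez]; split => //.
  by apply: le_trans Ez _; apply: Fmono; exact: ahomo.
Qed.

End conditional_quantile_function.

Lemma probability_pack {R : realType} d (T : measurableType d)
    (m : {measure set T -> \bar R}) :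
  m setT = 1%E -> exists P : probability T R, m = P.
Proof.
move=> mT; have mT' : (m setT < +oo)%E by rewrite mT ltry.
have fm : fin_num_fun m.
  move=> A mA; rewrite ge0_fin_numE//; apply: le_lt_trans mT'.
  by apply: le_measure; rewrite ?inE.
have sf : sigma_finite setT m by apply: fin_num_fun_sigma_finite; rewrite ?measure0.
have m1 : (m setT <= 1)%E by rewrite mT.
pose H1 := isFinite.Build _ _ _ _ fm.
pose H2 := isSFinite.Build _ _ _ _ (sfinite_measure_sigma_finite sf).
pose H3 := isSigmaFinite.Build _ _ _ _ sf.
pose H4 := isSubProbability.Build _ _ _ _ m1.
pose H5 := isProbability.Build _ _ _ _ mT.
pose m' := HB.pack_for (probability T R) (Measure.sort m) H1 H2 H3 H4 H5.
by exists m'; exact: eq_measure.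
Qed.

Lemma uniform01 (R : realType) : exists P : probability R R,
  forall c : R, 0 <= c <= 1 -> P `]-oo, c]%classic = c%:E.
Proof.
pose U := uniform_prob (@ltr01 R).
have mid : measurable_fun setT (id : measurableTypeR R -> R).
  by move=> _ Y mY; rewrite setTI.
have [P PU] := pushforward_pack U mid.
have PT : P setT = 1%E by rewrite PU; exact: (probability_setT U).
have [P' PP'] := probability_pack PT.
exists P' => c /andP[c0 c1]; transitivity (P `]-oo, c]%classic); first by rewrite PP'.
rewrite PU; transitivity (uniform_prob (@ltr01 R) `]-oo, c]%classic) => //.
rewrite /uniform_prob; apply: etrans (integral_uniform_pdf _ _ _) _.
rewrite (_ : _ `&` _ = `[0, c]%classic); last first.
  apply/seteqP; split => x /=; rewrite !in_itv/=; first by move=> [-> /andP[-> _]].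
  by move=> /andP[-> xc]; split => //; exact: le_trans xc c1.
rewrite (eq_integral (cst 1%E)); last first.
  move=> x; rewrite inE/= in_itv/= => /andP[x0 xc].
  by rewrite /uniform_pdf x0 (le_trans xc c1)/= subr0 invr1.
rewrite integral_cst//= mul1e lebesgue_measure_itv/= lte_fin.
by case: ltgtP c0 => // [_|<-//] _; rewrite -EFinB subr0.
Qed.

Section density.
Context {R : realType} d (T : measurableType d).

(** The given density and the chosen Radon-Nikodym derivative have the same integrals, hence agree
    almost everywhere, and the change of variables for the latter applies. *)
Lemma finite_density_integral (nu mu : {measure set T -> \bar R}) (f : T -> R)
    (h : T -> \bar R) :
  (nu setT < +oo)%E -> sigma_finite [set: T] mu ->
  (forall x, 0 <= f x) -> measurable_fun setT f ->
  (forall A, measurable A -> nu A = (\int[mu]_(x in A) (f x)%:E)%E) ->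
  (forall x, 0 <= h x)%E -> measurable_fun setT h ->
  (\int[nu]_x h x = \int[mu]_x (h x * (f x)%:E))%E.
Proof.
move=> /finite_measure_pack[nu' ->] /sigma_finite_measure_pack[mu' ->] f0 mf nuE h0 mh.
have nufE A : measurable A -> nu' A = (\int[mu']_(x in A) (f x)%:E)%E by exact: nuE.
have mfE A : measurable_fun A (EFin \o f).
  by apply/measurable_EFinP; exact: measurable_funTS.
have numu : nu' `<< mu'.
  apply/null_content_dominatesP => A mA A0.
  by apply: etrans (nufE _ mA) _; apply: null_set_integral.
have gint := Radon_Nikodym_SigmaFinite.f_integrable numu.
rewrite -(Radon_Nikodym_SigmaFinite.change_of_variables numu)//.
have mg := measurable_int _ gint.
apply: ge0_ae_eq_integral => //.
- exact: emeasurable_funM.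
- exact: emeasurable_funM.
- by move=> x _; rewrite mule_ge0//; exact: Radon_Nikodym_SigmaFinite.f_ge0.
- by move=> x _; rewrite mule_ge0// lee_fin.
apply: ae_eqe_mul2l.
apply: integral_ae_eq => // E _ mE.
by rewrite -Radon_Nikodym_SigmaFinite.f_integral// nufE.
Qed.

Lemma density_measure (mu : {measure set T -> \bar R}) (f : T -> R) :
  (forall x, 0 <= f x) -> measurable_fun setT f ->
  exists nu : {measure set T -> \bar R},
    forall A, nu A = (\int[mu]_(x in A) (f x)%:E)%E.
Proof.
move=> f0 mf.
pose nu A := (\int[mu]_(x in A) (f x)%:E)%E.
have nu0 : nu set0 = 0%E by rewrite /nu integral_set0.
have nuge0 A : (0 <= nu A)%E by apply: integral_ge0 => x _; rewrite lee_fin.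
have nusa : semi_sigma_additive nu.
  move=> /= F mF tF mUF; apply: cvg_toP.
    apply: ereal_nondecreasing_is_cvgn => m n mn.
    by apply: lee_sum_nneg_natr => // k _ _.
  rewrite /nu ge0_integral_bigcup//=.
  - by apply/measurable_EFinP; exact: measurable_funTS.
  - by move=> x _; rewrite lee_fin.
pose H := isMeasure.Build _ _ _ nu nu0 nuge0 nusa.
by exists (HB.pack_for (Measure.type T R) nu H).
Qed.

Lemma sigma_finite_weight (mu : {measure set T -> \bar R}) :
  sigma_finite [set: T] mu -> exists w : T -> R,
  [/\ measurable_fun setT w, forall x, 0 < w x <= 1 &
      (\int[mu]_x (w x)%:E < +oo)%E].
Proof.
move=> [F TF /all_and2[mF muFoo]].
pose E := seqDU F.
have mE k : measurable (E k).
  by apply: measurableD => //; exact: bigsetU_measurable.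
have tE : trivIset setT E by exact: trivIset_seqDU.
have UE : \bigcup_k E k = setT by rewrite TF [RHS]seqDU_bigcup_eq.
have muEF k : (mu (E k) <= mu (F k))%E.
  by apply: le_measure; rewrite ?inE//; exact: subset_seqDU.
have muE k : mu (E k) \is a fin_num.
  by rewrite ge0_fin_numE// (le_lt_trans (muEF k)).
(* The weight is constant on each piece: the denominator bounds its integral over [E k] by 2^-(k+1),
   so the total is at most 1, and the added 1 keeps it meaningful on null pieces and gives c k <=
   1. *)
pose c k : R := 2^-1 ^+ k.+1 / (1 + fine (mu (E k))).
have den k : 0 < 1 + fine (mu (E k)) by rewrite ltr_pwDl// fine_ge0.
have c0 k : 0 < c k by rewrite divr_gt0// exprn_gt0.
have c1 k : c k <= 1.
  rewrite ler_pdivrMr// mul1r.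
  apply: (@le_trans _ _ 1); last by rewrite lerDl fine_ge0.
  by rewrite exprn_ile1//; lra.
have /choice[i iP] : forall x, exists k, E k x.
  by move=> x; have : [set: T] x by []; rewrite -UE => -[k _ Ekx]; exists k.
have iE k x : E k x -> i x = k.
  move=> Ekx; apply/eqP/negPn/negP => ne.
  have := trivIsetP.1 tE (i x) k Logic.I Logic.I ne.
  by move=> /seteqP[/(_ x)+ _]; apply; split.
have wE k x : E k x -> c (i x) = c k by move=> /iE ->.
have mw : measurable_fun setT (c \o i).
  move=> _ Y mY; rewrite setTI.
  rewrite (_ : _ @^-1` _ = \bigcup_(k in [set k | Y (c k)]) E k).
    by apply: bigcup_measurable => k _.
  apply/seteqP; split => [x /= Yx|x [k /= Yk /iE ixk]].
    by exists (i x).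
  by rewrite /= ixk.
exists (c \o i); split => //; first by move=> x; rewrite /= c0 c1.
rewrite -UE ge0_integral_bigcup//; last 2 first.
- by rewrite UE; apply/measurable_EFinP; exact: mw.
- by move=> x _; rewrite lee_fin ltW /=.
apply: (@le_lt_trans _ _ (\sum_(k <oo) (2^-1 ^+ k.+1 : R)%:E)%E).
  apply: lee_nneseries => k.
    by move=> _ _; apply: integral_ge0 => x _; rewrite lee_fin ltW /=.
  move=> _.
  rewrite (eq_integral (fun=> (c k)%:E)); last first.
    by move=> x /[!inE] Ex; rewrite /= (wE _ _ Ex).
  rewrite integral_cst// -[mu (E k)]fineK// -EFinM lee_fin.
  rewrite /c mulrAC ler_pdivrMr// ler_pM2l ?exprn_gt0//.
  by rewrite lerDr.
apply: (@le_lt_trans _ _ 1%:E); last exact: ltry.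
apply: lime_le; first by apply: is_cvg_nneseries => k _ _; rewrite lee_fin exprn_ge0.
apply: nearW => n; rewrite sumEFin lee_fin.
have -> : \sum_(0 <= k < n) 2^-1 ^+ k.+1 = 1 - 2^-1 ^+ n :> R.
  elim: n => [|n IH]; first by rewrite big_geq// expr0 subrr.
  by rewrite big_nat_recr//= IH exprS; field.
by rewrite gerBl exprn_ge0.
Qed.

End density.

Lemma nneseries_half {R : realType} (c : R) : 0 <= c ->
  (\sum_(k <oo) (c * 2^-1 ^+ k.+1)%:E <= c%:E)%E.
Proof.
move=> c0; have pos k : 0 <= c * 2^-1 ^+ k.+1 by rewrite mulr_ge0// exprn_ge0.
apply: lime_le; first by apply: is_cvg_nneseries => k _ _; rewrite lee_fin.
apply: nearW => n; rewrite sumEFin lee_fin -mulr_sumr.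
have -> : \sum_(0 <= k < n) 2^-1 ^+ k.+1 = 1 - 2^-1 ^+ n :> R.
  elim: n => [|n IH]; first by rewrite big_geq// expr0 subrr.
  by rewrite big_nat_recr//= IH exprS; field.
by rewrite mulrBr mulr1 gerBl mulr_ge0// exprn_ge0.
Qed.

(** If no [O n] contained K, the sets K minus O n would generate a proper filter. A cluster point in
    K lies in some [O n], an open neighbourhood that misses K minus O n. *)
Lemma compact_increasing_cover {T : topologicalType} (K : set T) (O : nat -> set T) :
  compact K -> (forall n, open (O n)) ->
  (forall i j, (i <= j)%N -> O i `<=` O j) ->
  K `<=` \bigcup_n O n -> exists n, K `<=` O n.
Proof.
move=> cK oO iO KO; apply: contrapT => /forallNP noN.
have ne n : (K `\` O n) !=set0.
  by apply/set0P/negP => /eqP e; apply: (noN n); rewrite setD_eq0 in e.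
pose F : set_system T := [set A | exists n, K `\` O n `<=` A].
have FF : ProperFilter F.
  apply: Build_ProperFilter_ex.
    by move=> A [n nA]; have [x Kx] := ne n; exists x; exact: nA.
  split.
  - by exists 0%N.
  - move=> A B [n nA] [k kB]; exists (maxn n k) => x [Kx Ox]; split.
      by apply: nA; split => // On; apply: Ox; apply: iO On; rewrite leq_maxl.
    by apply: kB; split => // Ok; apply: Ox; apply: iO Ok; rewrite leq_maxr.
  - by move=> A B AB [n nA]; exists n; exact: subset_trans AB.
have [p [Kp clp]] := cK F FF (ex_intro _ 0%N (@subDsetl _ _ _)).
have [n _ Onp] := KO _ Kp.
have [y [[_ nO] Oy]] : ((K `\` O n) `&` O n) !=set0.
  apply: clp; first by exists n.
  by apply: open_nbhs_nbhs; split => //; exact: oO.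
by [].
Qed.

(** * Inner regularity, Lusin's theorem and codes on a standard space *)

Section standard_space.
Context {R : realType} d (X : measurableType d) (P : metricType R) (j : X -> P).
Variables (mu m : {measure set X -> \bar R}).
Hypothesis bj : bijective j.
Hypothesis mX : (@measurable d X) = <<s [set j @^-1` U | U in @open P]>>.
Hypothesis inner_regular : forall A, measurable A ->
  mu A = ereal_sup [set mu (j @^-1` K) |
                   K in [set K | compact K /\ j @^-1` K `<=` A]].
Hypothesis sf_mu : sigma_finite [set: X] mu.
Hypothesis m_fin : (m setT < +oo)%E.
Hypothesis m_mu : m `<< mu.

Let m_lty A : measurable A -> (m A < +oo)%E.
Proof. by move=> mA; apply: le_lt_trans m_fin; apply: le_measure; rewrite ?inE. Qed.

Lemma measurable_preimage_open U : open U -> measurable (j @^-1` U).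
Proof. by move=> oU; rewrite mX; apply: sub_sigma_algebra; exists U. Qed.

Lemma measurable_preimage_closed U : closed U -> measurable (j @^-1` U).
Proof.
move=> cU; rewrite -(setCK U) preimage_setC; apply: measurableC.
by apply: (@measurable_preimage_open (~` U)); rewrite openC.
Qed.

Let compact_closed' (K : set P) : compact K -> closed K.
Proof. by move=> cK; exact: (compact_closed (@metric_hausdorff R P)). Qed.

Lemma measurable_preimage_compact K : compact K -> measurable (j @^-1` K).
Proof. by move=> /compact_closed'; exact: measurable_preimage_closed. Qed.

(** Regularity is given for [mu], which may be infinite, and is needed for a finite [m] dominated by
    it. After cutting A down to a piece of finite [mu]-measure, countably many compact sets exhaust
    it up to a [mu]-null set, hence up to an [m]-null set; continuity of [m] from above then makes
    finitely many of them enough. *)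
Lemma inner_regular_fin A (e : R) : measurable A -> 0 < e ->
  exists K, [/\ compact K, j @^-1` K `<=` A & (m (A `\` j @^-1` K) < e%:E)%E].
Proof.
move=> mA e0; have [F TF mF] := sf_mu.
pose S n := \big[setU/set0]_(i < n) F i.
have mS n : measurable (S n) by apply: bigsetU_measurable => i _; case: (mF i).
have US : \bigcup_n S n = setT.
  rewrite TF; apply/seteqP; split => [x [n _]|x [n _ Fx]].
    by rewrite /S -bigcup_mkord => -[i _ Fi]; exists i.
  by exists n.+1 => //; rewrite /S big_ord_recr/=; right.
have S_lty n : (mu (S n) < +oo)%E.
  apply: le_lt_trans (Boole_inequality mu _) _.
    by move=> i _; case: (mF i).
  by apply/lte_sum_pinfty => i _; case: (mF i).
have [n nE] : exists n, (m (A `\` S n) < (e / 2)%:E)%E.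
  have : (m \o (fun n => A `\` S n)) k @[k --> \oo] --> m (\bigcap_n (A `\` S n)).
    apply: nonincreasing_cvg_mu.
    - by apply: m_lty; exact: measurableD.
    - by move=> i; exact: measurableD.
    - by apply: bigcapT_measurable => i; exact: measurableD.
    - move=> a b ab; apply/subsetPset; apply: setDS.
      exact: subset_bigsetU.
  rewrite (_ : \bigcap_n _ = set0) ?measure0; last first.
    apply/seteqP; split => // x AS; have : [set: X] x by [].
    by rewrite -US => -[n _ Sx]; have [_] := AS n Logic.I.
  have e20 : (0 < (e / 2)%:E)%E by rewrite lte_fin divr_gt0.
  by move=> /(_ _ (open_ereal_lt' e20))[n _ /(_ n (leqnn n))]; exists n.
have mAS : measurable (A `&` S n) by exact: measurableI.
have muAS : (mu (A `&` S n) < +oo)%E.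
  apply: le_lt_trans (S_lty n).
  by apply: le_measure; rewrite ?inE//; exact: subIsetr.
have muAS_num : mu (A `&` S n) \is a fin_num by rewrite ge0_fin_numE.
have /choice[K KP] : forall i, exists K, [/\ compact K, j @^-1` K `<=` A `&` S n &
    (mu ((A `&` S n) `\` j @^-1` K) < (i.+1%:R^-1)%:E)%E].
  move=> i; have : (mu (A `&` S n) - (i.+1%:R^-1)%:E < mu (A `&` S n))%E.
    by rewrite lteBlDr// lteDl// lte_fin invr_gt0.
  rewrite {2}inner_regular// => /ereal_sup_gt[_ [K [cK KA] <-] Klt].
  have mK := measurable_preimage_compact cK.
  exists K; split => //.
  rewrite measureD// (setIidr KA) lteBlDr//; last first.
    rewrite ge0_fin_numE// (le_lt_trans _ muAS)//.
    by apply: le_measure; rewrite ?inE.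
  by rewrite addeC -lteBlDr.
have mK i : measurable (j @^-1` K i).
  by apply: measurable_preimage_compact; case: (KP i).
pose L k := \big[setU/set0]_(i < k) K i.
have LE k : j @^-1` L k = \big[setU/set0]_(i < k) (j @^-1` K i).
  rewrite /L; elim: k => [|k IH]; first by rewrite !big_ord0 preimage_set0.
  by rewrite !big_ord_recr/= preimage_setU IH.
have mL k : measurable (j @^-1` L k) by rewrite LE; exact: bigsetU_measurable.
have cL k : compact (L k).
  rewrite /L; elim: k => [|k IH]; first by rewrite big_ord0; exact: compact0.
  by rewrite big_ord_recr/=; apply: compactU => //; case: (KP k).
have LA k : j @^-1` L k `<=` A `&` S n.
  elim: k => [|k IH]; first by rewrite LE big_ord0.
  by rewrite LE big_ord_recr/= -LE => x [/IH//|Kx]; have [_ + _] := KP k; exact.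
have Lmono a b : (a <= b)%N -> j @^-1` L a `<=` j @^-1` L b.
  elim: b => [|b IH]; first by rewrite leqn0 => /eqP->.
  rewrite leq_eqVlt => /predU1P[->//|ab] x Lx.
  by rewrite LE big_ord_recr/= -LE; left; exact: IH.
have [k kE] : exists k, (m ((A `&` S n) `\` j @^-1` L k) < (e / 2)%:E)%E.
  have mAL k : measurable ((A `&` S n) `\` j @^-1` L k) by exact: measurableD.
  have mcap : measurable (\bigcap_k ((A `&` S n) `\` j @^-1` L k)).
    exact: bigcapT_measurable.
  have : (m \o (fun k => (A `&` S n) `\` j @^-1` L k)) k @[k --> \oo] -->
      m (\bigcap_k ((A `&` S n) `\` j @^-1` L k)).
    apply: nonincreasing_cvg_mu => //; first exact: m_lty.
    by move=> a b ab; apply/subsetPset; apply: setDS; exact: Lmono.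
  have -> : m (\bigcap_k ((A `&` S n) `\` j @^-1` L k)) = 0%E.
    have /null_content_dominatesP := m_mu; apply => //.
    apply/eqP; rewrite eq_le measure_ge0 andbT; apply/lee_addgt0Pr => eps eps0.
    rewrite add0e.
    have [i _ /(_ i (leqnn i)) iE] := near_infty_natSinv_lt (PosNum eps0).
    apply: (@le_trans _ _ (mu ((A `&` S n) `\` j @^-1` K i))).
      apply: le_measure; rewrite ?inE//; first exact: measurableD.
      move=> x /(_ i.+1 Logic.I)[ASx nL]; split => // Kx; apply: nL.
      by rewrite LE big_ord_recr/=; right.
    by have [_ _ /ltW h] := KP i; apply: le_trans h _; rewrite lee_fin ltW.
  have e20 : (0 < (e / 2)%:E)%E by rewrite lte_fin divr_gt0.
  by move=> /(_ _ (open_ereal_lt' e20))[k _ /(_ k (leqnn k))]; exists k.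
exists (L k); split => //; first by move=> x /LA[].
apply: (@le_lt_trans _ _ (m (A `\` S n) + m ((A `&` S n) `\` j @^-1` L k))%E).
  apply: le_trans (measureU2 _ _ _); [|exact: measurableD..].
  apply: le_measure; rewrite ?inE; first exact: measurableD.
    by apply: measurableU; exact: measurableD.
  move=> x [Ax Kx]; have [Sx|Sx] := pselect (S n x); [by right; split|by left; split].
by rewrite [e]splitr EFinD lteD.
Qed.

(** Take compact K n inside U n and L n inside its complement, and intersect all the unions of K n
    and L n. On the intersection, being in U n means avoiding L n, and being outside means avoiding
    K n: both are open conditions. *)
Lemma lusin_compact (U : nat -> set X) (e : R) : (forall n, measurable (U n)) -> 0 < e ->
  exists (K : set P) (O O' : nat -> set P),
  [/\ compact K, (m (~` (j @^-1` K)) < e%:E)%E,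
      forall n, open (O n), forall n, open (O' n) &
      forall n x, K (j x) -> (U n x <-> O n (j x)) /\ (~ U n x <-> O' n (j x))].
Proof.
move=> mU e0.
(* The two losses at place k together stay below e/2 * 2^-(k+1), so the total is at most e/2,
   strictly less than e. *)
pose c k : R := e / 4 * 2^-1 ^+ k.+1.
have c0 k : 0 < c k by rewrite mulr_gt0 ?exprn_gt0// divr_gt0.
have /choice[K KP] : forall n, exists K, [/\ compact K, j @^-1` K `<=` U n &
    (m (U n `\` j @^-1` K) < (c n)%:E)%E].
  by move=> n; exact: inner_regular_fin.
have /choice[L LP] : forall n, exists K, [/\ compact K, j @^-1` K `<=` ~` U n &
    (m (~` U n `\` j @^-1` K) < (c n)%:E)%E].
  by move=> n; apply: inner_regular_fin => //; exact: measurableC.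
have cK n : compact (K n) by case: (KP n).
have cL n : compact (L n) by case: (LP n).
pose M := \bigcap_n (K n `|` L n).
have cM : compact M.
  apply: (@subclosed_compact _ _ (K 0%N `|` L 0%N)).
  - by apply: closed_bigI => n _; apply: closedU; exact: compact_closed'.
  - exact: compactU.
  - by move=> x /(_ 0%N Logic.I).
exists M, (fun n => ~` L n), (fun n => ~` K n); split => //.
- have mN n : measurable (U n `\` j @^-1` K n `|` ~` U n `\` j @^-1` L n).
    apply: measurableU; apply: measurableD => //.
    + exact: measurable_preimage_compact.
    + exact: measurableC.
    + exact: measurable_preimage_compact.
  apply: (@le_lt_trans _ _ (\sum_(n <oo) (m (U n `\` j @^-1` K n `|` ~` U n `\` j @^-1` L n)))%E).
    apply: measure_sigma_subadditive => //.
      by apply: measurableC; exact: measurable_preimage_compact.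
    move=> x nMx; apply: contrapT => nx; apply: nMx => n _ /=.
    have /not_orP[h1 h2] : ~ (U n `\` j @^-1` K n `|` ~` U n `\` j @^-1` L n) x.
      by move=> h; apply: nx; exists n.
    have [Ux|Ux] := pselect (U n x).
      by left; apply: contrapT => h; apply: h1; split.
    by right; apply: contrapT => h; apply: h2; split.
  apply: (@le_lt_trans _ _ (\sum_(n <oo) (e / 2 * 2^-1 ^+ n.+1)%:E)%E).
    apply: lee_nneseries => // n _.
    apply: le_trans (measureU2 _ _ _) _.
    + by apply: measurableD => //; exact: measurable_preimage_compact.
    + by apply: measurableD; [exact: measurableC|exact: measurable_preimage_compact].
    rewrite [leRHS](_ : _ = ((c n)%:E + (c n)%:E)%E); last first.
      by rewrite -EFinD; congr EFin; rewrite /c; field.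
    by apply: leeD; apply: ltW; [case: (KP n)|case: (LP n)].
  apply: le_lt_trans (nneseries_half _) _; first by rewrite divr_ge0// ltW.
  by rewrite lte_fin; lra.
- by move=> n; rewrite openC; exact: compact_closed'.
- by move=> n; rewrite openC; exact: compact_closed'.
- move=> n x /(_ n Logic.I) KL; have [_ KU _] := KP n; have [_ LU _] := LP n.
  split; split.
  + by move=> Ux Lx; exact: (LU x).
  + by case: KL => // /KU.
  + by move=> Ux Kx; apply: Ux; exact: (KU x).
  + by case: KL => // /LU.
Qed.

Lemma separating_sequence (D : set P) : countable D -> dense D ->
  exists U : nat -> set X, (forall n, measurable (U n)) /\
    forall x y, (forall n, U n x <-> U n y) -> x = y.
Proof.
move=> /countable_injP[f finj] dD.
(* Countability of D is an injection f into nat, so this union is over at most one point: a ball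
   about it, or the empty set. *)
pose V (a k : nat) : set P :=
  \bigcup_(q in [set q | D q /\ f q = a]) (ball q (k.+1%:R^-1))°.
have oV a k : open (V a k) by apply: bigcup_open => q _; exact: open_interior.
pose c n : nat * nat := odflt (0, 0)%N (unpickle n).
pose U n := j @^-1` V (c n).1 (c n).2.
exists U; split=> [n|x y Uxy]; first exact: measurable_preimage_open.
apply: (bij_inj bj); apply: contrapT => /eqP jxy.
have := @metric_hausdorff R P; rewrite ball_hausdorff => /(_ _ _ jxy)[[r1 r2] /= /eqP r12].
have far : ~ ball (j x) r1%:num (j y).
  move=> b1; have : (ball (j x) r1%:num `&` ball (j y) r2%:num) (j y).
    by split => //; exact: ballxx.
  by rewrite r12.
have [k kr] : exists k, k.+1%:R^-1 < r1%:num / 2 :> R.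
  have r0 : 0 < r1%:num / 2 :> R by rewrite divr_gt0.
  by have [k _ /(_ k (leqnn k))] := near_infty_natSinv_lt (PosNum r0); exists k.
pose dl : R := k.+1%:R^-1.
have dl0 : 0 < dl by rewrite invr_gt0.
have dl20 : 0 < dl / 2 by rewrite divr_gt0.
(* With q within dl/2 of x, the ball of radius dl about q contains a neighbourhood of x. A point y
   in the same ball is within 3/2 dl of x, which is less than r1. *)
have [q [qb Dq]] : ((ball (j x) (dl / 2))° `&` D) !=set0.
  apply: dD; last exact: open_interior.
  by exists (j x); exact: (nbhsx_ballx (j x) (dl / 2) dl20).
have {}qb : ball (j x) (dl / 2) q by apply: interior_subset.
pose n := pickle (f q, k).
have cn : c n = (f q, k) by rewrite /c /n pickleK.
have Ux : U n x.
  rewrite /U cn /= /V; exists q => //.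
  have : nbhs (j x) (ball (j x) (dl / 2)) by exact: (nbhsx_ballx (j x) (dl / 2) dl20).
  apply: filterS => z zb; rewrite -/dl [dl]splitr.
  exact: ball_triangle (ball_sym qb) zb.
have /(Uxy n)[q' [Dq' fq']] : U n x by [].
move: fq'; rewrite cn /= => fq'.
have qq : q' = q by apply: finj; rewrite ?inE.
rewrite {}qq => /interior_subset; rewrite -/dl => yb.
apply: far; apply: (@le_ball _ _ _ (dl / 2 + dl)); last exact: ball_triangle qb yb.
by rewrite -/dl in kr; lra.
Qed.

(* On the compact sets given by Lusin's theorem the code is continuous and injective,
   hence maps Borel sets to Borel sets. *)
Lemma ternary_left_inverse (U : nat -> set X) :
  (forall n, measurable (U n)) ->
  (forall x y, (forall n, U n x <-> U n y) -> x = y) ->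
  exists g : R -> X, measurable_fun setT g /\ {ae m, forall x, g (ternary U x) = x}.
Proof.
move=> mU sepU.
pose e (x : X) : R := ternary U x.
have einj x y : e x = e y -> x = y by move=> exy; apply: sepU; exact: ternary_inj exy.
have [ji jK Kj] := bj.
have clinj A B : e @` (A `\` B) = e @` A `\` e @` B.
  apply/seteqP; split => [_ [x [Ax Bx] <-]|_ [[x Ax <-] nB]].
    by split; [exists x|move=> [y By /einj yx]; apply: Bx; rewrite -yx].
  by exists x => //; split => // Bx; apply: nB; exists x.
have /choice[K KP] : forall n, exists K : set P, [/\ compact K,
    (m (~` (j @^-1` K)) < (n.+1%:R^-1)%:E)%E &
    forall C, compact C -> C `<=` K -> measurable (e @` (j @^-1` C))].
  move=> n; have n0 : 0 < n.+1%:R^-1 :> R by rewrite invr_gt0.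
  have [K [V [V' [cK mK oV oV' VP]]]] := lusin_compact mU n0.
  exists K; split => // C cC CK.
  rewrite (_ : e @` _ = (e \o ji) @` C); last first.
    apply/seteqP; split => [_ [x Cx <-]|_ [p Cp <-]].
      by exists (j x) => //=; rewrite jK.
    by exists (ji p) => //=; rewrite Kj.
  apply: closed_measurable; apply: compact_closed; first exact: Rhausdorff.
  apply: continuous_compact cC; apply/subspace_continuousP => p Cp.
  apply/cvgrPdist_lt => eps eps0.
  have [N NE] : exists N, 3 / 2 * 3^-1 ^+ N < eps :> R.
    have := @cvg_geometric R (3 / 2) 3^-1.
    have -> : `|3^-1 : R| < 1 by rewrite ger0_norm// invf_lt1//; lra.
    move=> /(_ isT)/cvgrPdist_lt/(_ _ eps0)[N _ /(_ N (leqnn N))].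
    rewrite sub0r normrN /= => h; exists N; apply: le_lt_trans h.
    exact: ler_norm.
  rewrite near_withinE.
  (* On K each of the first N sets and its complement are relatively open, so near p the first N
     digits do not change, and the tail from N on is below eps. *)
  have : \forall q \near p, forall i : 'I_N, (U i (ji p) -> V i q) /\ (~ U i (ji p) -> V' i q).
    apply: filter_forall => i.
    have [] := VP i (ji p); rewrite ?Kj; first exact: CK.
    move=> UO UO'; have [Up|Up] := pselect (U i (ji p)).
      have : nbhs p (V i) by apply: open_nbhs_nbhs; split => //; exact/UO.
      by apply: filterS => q Oq; split.
    have : nbhs p (V' i) by apply: open_nbhs_nbhs; split => //; exact/UO'.
    by apply: filterS => q Oq; split.
  apply: filterS => q qO Cq; apply: le_lt_trans NE; apply: ternary_close => i iN.
  have [h1 h2] := qO (Ordinal iN).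
  have [] := VP i (ji q); rewrite ?Kj; first exact: CK.
  move=> UO UO'; split; first by move=> /h1 ?; exact/UO.
  by move=> Uq; apply: contrapT => /h2 ?; apply: (UO'.2 _).
have mK n : measurable (j @^-1` K n).
  by apply: measurable_preimage_compact; case: (KP n).
pose W := \bigcup_n (j @^-1` K n).
have mW : measurable W by exact: bigcupT_measurable.
have mimage B : measurable B -> forall n, measurable (e @` (B `&` j @^-1` K n)).
  move=> mB n; have [cK _ CK] := KP n.
  have eK : measurable (e @` (j @^-1` K n)) by exact: CK.
  pose S := [set B | measurable (e @` (B `&` j @^-1` K n))].
  (* Sets with Borel image form a sigma-algebra because the code is injective, so images commute
     with differences; an open set is reached inside [K n] as a difference of two compact sets. *)
  suff : (@measurable _ X) `<=` S by exact.
  rewrite mX; apply: smallest_sub; first split.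
  - by rewrite /S/= set0I image_set0.
  - move=> A SA; rewrite /S/= (_ : _ `&` _ = j @^-1` K n `\` (A `&` j @^-1` K n)).
      by rewrite clinj; exact: measurableD.
    by apply/seteqP; split => [x [[_ Ax] Kx]|x [Kx nAK]]; split => //; [move=> []|split => // Ax; exact: nAK].
  - move=> F SF; rewrite /S/= setI_bigcupl image_bigcup.
    by apply: bigcupT_measurable => i; exact: SF.
  - move=> _ [G oG <-]; rewrite /S/= (_ : _ `&` _ = j @^-1` K n `\` j @^-1` (K n `\` G)).
      rewrite clinj; apply: measurableD => //; apply: CK; last exact: subDsetl.
      apply: subclosed_compact (cK) (@subDsetl _ _ _).
      by rewrite setDE; apply: closedI; [exact: compact_closed' cK|rewrite closedC].
    apply/seteqP; split => [x [Gx Kx]|x [Kx nKG]]; split => //; first by move=> [].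
    by apply: contrapT => Gx; apply: nKG.
have mimW B : measurable B -> measurable (e @` (B `&` W)).
  move=> mB; rewrite /W setI_bigcupr image_bigcup.
  by apply: bigcupT_measurable => n; exact: mimage.
pose g (t : R) : X := xget point [set x | W x /\ e x = t].
have ge x : W x -> g (e x) = x.
  by move=> Wx; rewrite /g; case: xgetP => [y _ [_ /einj]//|/(_ x)[]].
exists g; split.
  move=> _ B mB; rewrite setTI.
  (* Off the code of [W], g takes the default value [point], so that part of the preimage is
     everything or nothing. *)
  rewrite (_ : g @^-1` B = e @` (B `&` W) `|`
      (if pselect (B point) then ~` (e @` W) else set0)); last first.
    apply/seteqP; split => [t /= gB|t].
      have [[x Wx xt]|nt] := pselect ((e @` W) t).
        by left; exists x => //; split => //; rewrite -xt ge in gB.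
      have gp : g t = point by rewrite /g; case: xgetP => // y _ [Wy yt]; case: nt; exists y.
      by right; case: pselect => // h; apply: h; rewrite -gp.
    case=> [[x [Bx Wx] <-]|]; first by rewrite /= ge.
    case: pselect => // Bp nt; rewrite /= /g; case: xgetP => // y _ [Wy yt].
    by case: nt; exists y.
  apply: measurableU; first exact: mimW.
  case: pselect => [Bp|nBp]; last exact: measurable0.
  apply: measurableC.
  by have := mimW setT measurableT; rewrite setTI.
exists (~` W); split.
- exact: measurableC.
- apply/eqP; rewrite eq_le measure_ge0 andbT; apply/lee_addgt0Pr => eps eps0.
  rewrite add0e.
  have [k _ /(_ k (leqnn k)) kE] := near_infty_natSinv_lt (PosNum eps0).
  apply: (@le_trans _ _ (m (~` (j @^-1` K k)))).
    apply: le_measure; rewrite ?inE; try exact: measurableC.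
    by move=> x nW Kx; apply: nW; exists k.
  by have [_ /ltW h _] := KP k; apply: le_trans h _; rewrite lee_fin ltW.
- by move=> x /= gx Wx; apply: gx; exact: ge.
Qed.

End standard_space.

Section standard_measure_facts.
Context {R : realType}.

Lemma standard_separating d (X : measurableType d) (mu : {measure set X -> \bar R}) :
  standard_measure mu ->
  exists U : nat -> set X, (forall n, measurable (U n)) /\
    forall x y, (forall n, U n x <-> U n y) -> x = y.
Proof.
move=> [_ [P [j [bj _ [D cD dD] mX _]]]].
by have := separating_sequence bj mX cD dD.
Qed.

Lemma standard_code d (X : measurableType d) (mu m : {measure set X -> \bar R}) :
  standard_measure mu -> (m setT < +oo)%E -> m `<< mu ->
  exists (U : nat -> set X) (g : R -> X), [/\ forall n, measurable (U n),
    measurable_fun setT g & {ae m, forall x, g (ternary U x) = x}].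
Proof.
move=> smu mfin m_mu; have [U [mU sepU]] := standard_separating smu.
case: smu => sf [P [j [bj _ _ mX reg]]].
have [g [mg gE]] := ternary_left_inverse bj mX (fun A mA => (reg A mA).2) sf mfin m_mu mU sepU.
by exists U, g.
Qed.

(** On Lusin's compact sets all the sides become relatively open, so the rectangles form an open
    cover of a compact product. The covering hypothesis is pointwise: marginally null exceptions
    have to be added to the rectangles beforehand. *)
Lemma omega_compactness dX dY (X : measurableType dX) (Y : measurableType dY)
    (mu m : {measure set X -> \bar R}) (nu n : {measure set Y -> \bar R})
    (C : nat -> set X) (D : nat -> set Y) (e : R) :
  standard_measure mu -> (m setT < +oo)%E -> m `<< mu ->
  standard_measure nu -> (n setT < +oo)%E -> n `<< nu ->
  (forall i, measurable (C i)) -> (forall i, measurable (D i)) ->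
  (forall x y, exists i, C i x /\ D i y) -> 0 < e ->
  exists (X' : set X) (Y' : set Y) (N : nat),
    [/\ measurable X' /\ measurable Y', (m (~` X') < e%:E)%E, (n (~` Y') < e%:E)%E &
      forall x y, X' x -> Y' y -> exists i, [/\ (i < N)%N, C i x & D i y]].
Proof.
move=> [sfmu [P [j [bj _ _ mX regmu]]]] mfin m_mu.
move=> [sfnu [Q [k [bk _ _ mY regnu]]]] nfin n_nu mC mD CD e0.
have [K [G [G' [cK mK oG _ GP]]]] :=
  lusin_compact mX (fun A mA => (regmu A mA).2) sfmu mfin m_mu mC e0.
have [L [H [H' [cL mL oH _ HP]]]] :=
  lusin_compact mY (fun A mA => (regnu A mA).2) sfnu nfin n_nu mD e0.
have [ji jK Kj] := bj; have [ki kK Kk] := bk.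
pose W n := \bigcup_(i in `I_n) (G i `*` H i).
have [N NW] : exists N, K `*` L `<=` W N.
  apply: (compact_increasing_cover (compact_setX cK cL)).
  - move=> a; apply: bigcup_open => i _; rewrite openE => -[p q] [/= Gp Hq].
    exists (G i, H i) => //=; split; apply: open_nbhs_nbhs; split => //.
  - by move=> a b ab p [i /= ia GHp]; exists i => //=; exact: leq_trans ia ab.
  - move=> [p q] [/= Kp Lq]; have [i [Ci Di]] := CD (ji p) (ki q).
    exists i.+1 => //; exists i => /=; first exact: ltnSn.
    split => /=.
      have [] := GP i (ji p); rewrite ?Kj// => h _; exact/h.
    have [] := HP i (ki q); rewrite ?Kk// => h _; exact/h.
exists (j @^-1` K), (k @^-1` L), N; split => //.
- split; first exact: (measurable_preimage_compact mX).
  exact: (measurable_preimage_compact mY).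
- move=> x y Kx Ly; have [i /= iN [/= Gx Hy]] := NW (j x, k y) (conj Kx Ly).
  exists i; split => //.
    by apply/(GP i x Kx).1.
  by apply/(HP i y Ly).1.
Qed.

End standard_measure_facts.

(* The measure w mu is carried by phi and the identity to the law of (x1, G (x1, u)),
   where x1 has density r and u has law P. *)
Definition disintegrates {R : realType} dX dX1 (X : measurableType dX)
    (X1 : measurableType dX1) (mu : {measure set X -> \bar R})
    (mu1 : {measure set X1 -> \bar R}) (phi : X -> X1)
    (w : X -> R) (r : X1 -> R) (P : probability R R) (G : X1 * R -> X) : Prop :=
  [/\ measurable_fun setT w, forall x, 0 < w x <= 1,
      measurable_fun setT r, forall x, 0 <= r x &
      measurable_fun setT G /\
      forall F : X1 * X -> \bar R, measurable_fun setT F -> (forall z, 0 <= F z)%E ->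
      (\int[mu]_x (F (phi x, x) * (w x)%:E) =
       \int[mu1]_x (\int[P]_u F (x, G (x, u)) * (r x)%:E))%E].

Section disintegration.
Context {R : realType} dX dX1 (X : measurableType dX) (X1 : measurableType dX1).
Variables (mu : {measure set X -> \bar R}) (mu1 : {measure set X1 -> \bar R}).
Variable phi : X -> X1.

Lemma ge0_integral_product1 d (T : measurableType d) (m : {measure set X1 -> \bar R})
    (P : probability T R) (F : X1 * T -> \bar R) :
  (m setT < +oo)%E -> measurable_fun setT F -> (forall z, 0 <= F z)%E ->
  (\int[m \x P]_z F z = \int[m]_x \int[P]_u F (x, u))%E.
Proof.
move=> /finite_measure_pack[m' ->] mF F0.
exact: (fubini_tonelli1 (m1 := m') (m2 := P) F mF F0).
Qed.

Lemma ge0_integral_pushforward_fun d1 d2 (T1 : measurableType d1)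
    (T2 : measurableType d2) (m : {measure set T1 -> \bar R})
    (n : {measure set T2 -> \bar R}) (f : T1 -> T2) (h : T2 -> \bar R) :
  measurable_fun setT f -> (forall A, measurable A -> n A = m (f @^-1` A)) ->
  measurable_fun setT h -> (forall y, 0 <= h y)%E ->
  (\int[n]_y h y = \int[m]_x h (f x))%E.
Proof.
move=> mf nE mh h0; have [n' n'E] := pushforward_pack m mf.
rewrite (@eq_measure_integral _ _ _ _ n' n)//; last first.
  by move=> A mA _; rewrite nE// n'E.
have -> : (\int[n']_y h y = \int[pushforward m f]_y h y)%E by rewrite n'E.
by rewrite (ge0_integral_pushforward mf).
Qed.

(** The code sends X into [0, 2[, where conditional laws have distribution functions. The quantile
    map realises the joint law of [phi] and the code from the image of [w mu] times [P], and the
    almost everywhere inverse of the code leads back to X: [G] is this inverse after the quantile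
    map. *)
Lemma disintegration : standard_measure mu -> standard_measure mu1 ->
  measurable_fun setT phi -> pushforward mu phi `<< mu1 ->
  exists (w : X -> R) (r : X1 -> R) (P : probability R R) (G : X1 * R -> X),
    disintegrates mu mu1 phi w r P G.
Proof.
move=> smu smu1 mphi phimu.
have [sfmu _] := smu; have [sfmu1 _] := smu1.
have [w [mw w01 wfin]] := sigma_finite_weight sfmu.
have w0 x : 0 <= w x by have /andP[/ltW] := w01 x.
have [m mE] := density_measure mu w0 mw.
have mfin : (m setT < +oo)%E by rewrite mE.
have m_mu : m `<< mu.
  apply/null_content_dominatesP => A mA A0; rewrite mE null_set_integral//.
  by apply/measurable_EFinP; exact: measurable_funTS.
have [U [g [mU mg gE]]] := standard_code smu mfin m_mu.
pose e (x : X) : R := ternary U x.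
have me : measurable_fun setT e by exact: measurable_ternary.
have mpe : measurable_fun setT (fun x => (phi x, e x)) by exact/measurable_fun_pairP.
have [q qE] := pushforward_pack m mpe.
have [q1 q1E] := pushforward_pack m mphi.
have q1q B : measurable B -> q1 B = q (B `*` setT).
  move=> mB; rewrite q1E qE /pushforward; congr (m _).
  by apply/seteqP; split => x //= [].
have qfin : (q setT < +oo)%E by rewrite qE.
have q1fin : (q1 setT < +oo)%E by rewrite q1E.
have qsupp : q (~` ([set: X1] `*` `[0, 2[%classic)) = 0%E.
  rewrite qE /pushforward (_ : _ @^-1` _ = set0) ?measure0//.
  apply/seteqP; split => // x; apply; split => //=.
  by rewrite in_itv/= ternary_ge0 ternary_lt2.
have q1mu1 : q1 `<< mu1.
  apply/null_content_dominatesP => A mA A0; rewrite q1E /pushforward.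
  have mphiA : measurable (phi @^-1` A) by rewrite -[X in measurable X]setTI; exact: mphi.
  have /null_content_dominatesP := m_mu; apply => //.
  by have /null_content_dominatesP := phimu; exact.
have [r [r0 mr _ rE]] := finite_density q1fin sfmu1 q1mu1.
have [P PE] := uniform01 R.
have [h [mh hE]] := conditional_quantile qfin q1q qsupp PE.
exists w, r, P, (g \o h); split => //; split; first exact: (measurableT_comp mg mh).
move=> F mF F0.
have mF1 : measurable_fun setT (fun x => F (phi x, x)).
  apply: (measurableT_comp mF); apply/measurable_fun_pairP; split => //.
  exact: measurable_id.
have mFg : measurable_fun setT (fun z : X1 * R => F (z.1, g z.2)).
  apply: measurableT_comp => //; apply/measurable_fun_pairP; split.
    exact: measurable_fst.
  exact: (measurableT_comp mg (@measurable_snd _ _ X1 R)).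
have mFgh : measurable_fun setT (fun z : X1 * R => F (z.1, g (h z))).
  apply: measurableT_comp => //; apply/measurable_fun_pairP; split.
    exact: measurable_fst.
  exact: (measurableT_comp mg mh).
rewrite -(@finite_density_integral _ _ _ m mu w (fun x => F (phi x, x)))//.
rewrite -(@finite_density_integral _ _ _ q1 mu1 r (fun x => \int[P]_u F (x, g (h (x, u))))%E)//; last 2 first.
- by move=> x; apply: integral_ge0.
- exact: (measurable_fun_fubini_tonelli_F (m2 := P) _ mFgh).
rewrite -(ge0_integral_product1 P q1fin mFgh)//.
rewrite -(@ge0_integral_pushforward_fun _ _ _ _ (q1 \x P)%E q (fun z => (z.1, h z)) (fun z => F (z.1, g z.2)))//; last first.
  by apply/measurable_fun_pairP; split => //; exact: measurable_fst.
rewrite (@ge0_integral_pushforward_fun _ _ _ _ m q (fun x => (phi x, e x)) (fun z => F (z.1, g z.2)))//; last first.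
  by move=> A mA; rewrite qE.
apply: ge0_ae_eq_integral => //.
- by apply: (measurableT_comp mFg mpe).
- by apply: filterS gE => x /= ->.
Qed.

End disintegration.

(** * Complex square-integrable functions *)

Section complex_numbers.
Context {R : realType}.
Implicit Types (x y : R[i]) (a : R).
Notation Re := complex.Re.
Notation Im := complex.Im.

Lemma cReM x y : Re (x * y) = Re x * Re y - Im x * Im y.
Proof. by case: x y => [? ?] [? ?]. Qed.
Lemma cImM x y : Im (x * y) = Re x * Im y + Im x * Re y.
Proof. by case: x y => [? ?] [? ?]. Qed.
Lemma cReD x y : Re (x + y) = Re x + Re y.
Proof. by case: x y => [? ?] [? ?]. Qed.
Lemma cImD x y : Im (x + y) = Im x + Im y.
Proof. by case: x y => [? ?] [? ?]. Qed.
Lemma cReZ a x : Re (a%:C * x) = a * Re x.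
Proof. by rewrite cReM/= mul0r subr0. Qed.
Lemma cImZ a x : Im (a%:C * x) = a * Im x.
Proof. by rewrite cImM/= mul0r addr0. Qed.
Lemma complex_eq x y : Re x = Re y -> Im x = Im y -> x = y.
Proof. by case: x y => [? ?] [? ?] /= -> ->. Qed.

Lemma sqr_normcE x : normc x ^+ 2 = Re x ^+ 2 + Im x ^+ 2.
Proof. by case: x => a b; rewrite /normc/= sqr_sqrtr// addr_ge0// sqr_ge0. Qed.

Lemma normc_sqrt x : normc x = Num.sqrt (Re x ^+ 2 + Im x ^+ 2).
Proof. by case: x. Qed.

Lemma normc_ge0 x : 0 <= normc x.
Proof. by rewrite normc_sqrt sqrtr_ge0. Qed.

Lemma normcZ a x : normc (a%:C * x) = `|a| * normc x.
Proof. by rewrite normcM; congr (_ * _); rewrite /= expr0n/= addr0 sqrtr_sqr. Qed.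

Lemma normc_Re x : `|Re x| <= normc x.
Proof.
by rewrite -sqrtr_sqr normc_sqrt ler_wsqrtr// lerDl sqr_ge0.
Qed.

Lemma normc_Im x : `|Im x| <= normc x.
Proof.
by rewrite -sqrtr_sqr normc_sqrt ler_wsqrtr// lerDr sqr_ge0.
Qed.

Lemma normc_le x : normc x <= `|Re x| + `|Im x|.
Proof.
rewrite -[leRHS]ger0_norm ?addr_ge0// -sqrtr_sqr normc_sqrt ler_wsqrtr//.
rewrite sqrrD !real_normK ?num_real// -addrAC lerDl.
by rewrite mulrn_wge0// mulr_ge0.
Qed.

Lemma normc_conj x : normc x^*%C = normc x.
Proof. by case: x => a b; rewrite /= sqrrN. Qed.

Lemma mul_conjc x : x * x^*%C = (normc x ^+ 2)%:C.
Proof.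
apply: complex_eq; rewrite ?sqr_normcE; case: x => a b; rewrite ?cReM ?cImM/=; ring.
Qed.

Lemma normc_sum n (u : nat -> R[i]) :
  normc (\sum_(i < n) u i) <= \sum_(i < n) normc (u i).
Proof.
elim: n => [|n IH]; first by rewrite !big_ord0 normc0.
by rewrite !big_ord_recr/= (le_trans (le_normcD _ _))// lerD2r.
Qed.

Lemma normc_mul_le x y : normc (x * y) <= normc x ^+ 2 + normc y ^+ 2.
Proof.
rewrite normcM; have := sqr_ge0 (normc x - normc y); rewrite sqrrB.
have := sqr_ge0 (normc x); have := sqr_ge0 (normc y).
by rewrite -mulr_natl; lra.
Qed.

Lemma normcB_sym x y : normc (x - y) = normc (y - x).
Proof. by rewrite -normcN opprB. Qed.

Lemma norm_normc x : `|x| = (normc x)%:C.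
Proof. by case: x. Qed.

Lemma ccvgP (u : nat -> R[i]) l :
  ccvg u l <-> (normc (u n - l) @[n --> \oo] --> (0 : R)).
Proof.
rewrite /ccvg; split.
  move=> /cvgrPdist_lt ul; apply/cvgrPdist_lt => e e0.
  have e0' : 0 < e%:C :> R[i] by rewrite ltcR.
  apply: filterS (ul _ e0') => n; rewrite norm_normc ltcR => lun.
  by rewrite sub0r normrN ger0_norm ?normc_ge0// normcB_sym.
move=> /cvgrPdist_lt ul; apply/cvgrPdist_lt => -[e e']; rewrite ltcE/= => /andP[/eqP e'0 e0].
apply: filterS (ul _ e0) => n; rewrite sub0r normrN ger0_norm ?normc_ge0// => lun.
by rewrite norm_normc e'0 -[_ +i* 0]/(e%:C) ltcR normcB_sym.
Qed.

Lemma ccvg0P (u : nat -> R[i]) :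
  ccvg u 0 <-> (normc (u n) @[n --> \oo] --> (0 : R)).
Proof.
have -> : (fun n => normc (u n)) = (fun n => normc (u n - 0)).
  by apply/funext => n; rewrite subr0.
exact: ccvgP.
Qed.

Lemma normc_cvg0_le (u : nat -> R[i]) (v : nat -> R) :
  (forall n, normc (u n) <= v n) -> v n @[n --> \oo] --> (0 : R) -> ccvg u 0.
Proof.
move=> uv v0; apply/ccvg0P; apply: (@squeeze_cvgr _ _ _ _ (cst 0) v) => //.
- by apply: nearW => n; rewrite normc_ge0 uv.
- exact: cvg_cst.
Qed.

Lemma ccvgD (u v : nat -> R[i]) l k :
  ccvg u l -> ccvg v k -> ccvg (fun n => u n + v n) (l + k).
Proof.
move=> /ccvgP ul /ccvgP vk; apply/ccvgP.
apply: (@squeeze_cvgr _ _ _ _ (cst 0) (fun n => normc (u n - l) + normc (v n - k))).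
- apply: nearW => n; rewrite normc_ge0/= opprD addrACA; exact: le_normcD.
- exact: cvg_cst.
- by rewrite -[0]addr0; exact: cvgD.
Qed.

Lemma ccvgM (u : nat -> R[i]) l k : ccvg u l -> ccvg (fun n => k * u n) (k * l).
Proof.
move=> /ccvgP ul; apply/ccvgP.
under eq_fun do rewrite -mulrBr normcM.
by rewrite -(mulr0 (normc k)); apply: cvgM => //; exact: cvg_cst.
Qed.

Lemma ccvg_unique (u : nat -> R[i]) l k : ccvg u l -> ccvg u k -> l = k.
Proof.
move=> ul uk; apply/eqP; rewrite -subr_eq0; apply/eqP; apply: eq0_normc.
have := ccvgD ul (@ccvgM u k (-1) uk).
have -> : (fun n => u n + -1 * u n) = (fun=> 0).
  by apply/funext => n; rewrite mulN1r subrr.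
rewrite mulN1r => /ccvgP; under eq_fun do rewrite sub0r normcN.
by move=> /(cvg_unique _ (cvg_cst _)) ->.
Qed.

Lemma ccvg_cst (l : R[i]) : ccvg (fun=> l) l.
Proof. by apply/ccvgP; under eq_fun do rewrite subrr normc0; exact: cvg_cst. Qed.

(** Absolute convergence, from |ab| <= |a|^2 + |b|^2, applied to real and imaginary parts. *)
Lemma ccvg_sum_sq (a b : nat -> R[i]) (M : R) :
  (forall n, \sum_(i < n) normc (a i) ^+ 2 <= M) ->
  (forall n, \sum_(i < n) normc (b i) ^+ 2 <= M) ->
  exists l, ccvg (fun n => \sum_(i < n) a i * b i) l.
Proof.
move=> aM bM.
have bnd (c : nat -> R) : (forall i, `|c i| <= normc (a i * b i)) ->
    cvgn (fun n => \sum_(i < n) c i).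
  move=> cab.
  have -> : (fun n => \sum_(i < n) c i) = series c.
    by apply/funext => n; rewrite /series/= big_mkord.
  apply: normed_cvg; apply: nondecreasing_is_cvgn.
    apply/nondecreasing_seqP => n; rewrite /series/=.
    by rewrite /series/= !big_mkord big_ord_recr/= lerDl normr_ge0.
  exists (M + M) => _ [n _ <-]; rewrite /=/series/= big_mkord.
  apply: le_trans (lerD (aM n) (bM n)); rewrite -big_split/=.
  by apply: ler_sum => i _; apply: le_trans (cab i) _; exact: normc_mul_le.
have /cvg_ex[/= l1 h1] := bnd _ (fun i => normc_Re (a i * b i)).
have /cvg_ex[/= l2 h2] := bnd _ (fun i => normc_Im (a i * b i)).
exists (Complex l1 l2); apply/ccvgP.
apply: (@squeeze_cvgr _ _ _ _ (cst 0) (fun n =>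
  `|\sum_(i < n) Re (a i * b i) - l1| + `|\sum_(i < n) Im (a i * b i) - l2|)).
- apply: nearW => n; rewrite normc_ge0/=.
  have ReS : Re (\sum_(i < n) a i * b i) = \sum_(i < n) Re (a i * b i).
    by elim: n => [|n IH]; rewrite ?big_ord0// !big_ord_recr/= cReD IH.
  have ImS : Im (\sum_(i < n) a i * b i) = \sum_(i < n) Im (a i * b i).
    by elim: n {ReS} => [|n IH]; rewrite ?big_ord0// !big_ord_recr/= cImD IH.
  apply: le_trans (normc_le _) _.
  have -> : Re (\sum_(i < n) a i * b i - Complex l1 l2) = \sum_(i < n) Re (a i * b i) - l1.
    by rewrite cReD ReS.
  have -> : Im (\sum_(i < n) a i * b i - Complex l1 l2) = \sum_(i < n) Im (a i * b i) - l2.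
    by rewrite cImD ImS.
  by [].
- exact: cvg_cst.
- have h0 (u : nat -> R) m : u n @[n --> \oo] --> m -> `|u n - m| @[n --> \oo] --> (0 : R).
    by move=> um; rewrite -(@normr0 _ R); apply: cvg_norm; apply/subr_cvg0.
  by have := cvgD (h0 _ _ h1) (h0 _ _ h2); rewrite addr0; apply.
Qed.

End complex_numbers.

Section complex_measurable.
Context {R : realType} d (T : measurableType d).
Implicit Types f g : T -> R[i].
Notation Re := complex.Re.
Notation Im := complex.Im.

Lemma measurable_sqrt (f : T -> R) : measurable_fun setT f -> (forall x, 0 <= f x) ->
  measurable_fun setT (fun x => Num.sqrt (f x)).
Proof.
move=> mf f0; under eq_fun do rewrite -powR12_sqrt//.
exact: (measurableT_comp (measurable_powR 2^-1) mf).
Qed.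

Lemma measurable_inv (f : T -> R) : measurable_fun setT f -> (forall x, 0 <= f x) ->
  measurable_fun setT (fun x => (f x)^-1).
Proof.
move=> mf f0; under eq_fun do rewrite -powR_inv1//.
exact: (measurableT_comp (measurable_powR (-1)) mf).
Qed.

Definition cmeasurable f : Prop :=
  measurable_fun [set: T] (fun x => Re (f x)) /\
  measurable_fun [set: T] (fun x => Im (f x)).

Lemma cmeasurable_cst (c : R[i]) : cmeasurable (fun=> c).
Proof. by split; exact: measurable_cst. Qed.

Lemma cmeasurableD f g : cmeasurable f -> cmeasurable g ->
  cmeasurable (fun x => f x + g x).
Proof.
move=> [mf mf'] [mg mg']; split.
  by under eq_fun do rewrite cReD; exact: measurable_funD.
by under eq_fun do rewrite cImD; exact: measurable_funD.
Qed.

Lemma cmeasurableM f g : cmeasurable f -> cmeasurable g ->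
  cmeasurable (fun x => f x * g x).
Proof.
move=> [mf mf'] [mg mg']; split.
  by under eq_fun do rewrite cReM; apply: measurable_funB; exact: measurable_funM.
by under eq_fun do rewrite cImM; apply: measurable_funD; exact: measurable_funM.
Qed.

Lemma cmeasurable_real (h : T -> R) : measurable_fun setT h ->
  cmeasurable (fun x => (h x)%:C).
Proof. by move=> mh; split => //; exact: measurable_cst. Qed.

Lemma cmeasurableZ (h : T -> R) f : measurable_fun setT h -> cmeasurable f ->
  cmeasurable (fun x => (h x)%:C * f x).
Proof. by move=> mh mf; apply: cmeasurableM => //; exact: cmeasurable_real. Qed.

Lemma cmeasurable_conj f : cmeasurable f -> cmeasurable (fun x => (f x)^*%C).
Proof.
move=> [mf mf']; split.
  by rewrite (_ : (fun _ => _) = fun x => Re (f x))//; apply/funext => x; case: (f x).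
rewrite (_ : (fun _ => _) = fun x => - Im (f x)); first exact: measurable_funN.
by apply/funext => x; case: (f x).
Qed.

Lemma measurable_normc f : cmeasurable f -> measurable_fun setT (fun x => normc (f x)).
Proof.
move=> [mf mf']; under eq_fun do rewrite normc_sqrt.
apply: measurable_sqrt; last by move=> x; rewrite addr_ge0// sqr_ge0.
by apply: measurable_funD; exact: measurable_funX.
Qed.

Lemma cmeasurable_sum n (f : nat -> T -> R[i]) : (forall i, cmeasurable (f i)) ->
  cmeasurable (fun x => \sum_(i < n) f i x).
Proof.
move=> mf; elim: n => [|n IH].
  by under eq_fun do rewrite big_ord0; exact: cmeasurable_cst.
by under eq_fun do rewrite big_ord_recr/=; exact: cmeasurableD.
Qed.

Lemma measurable_normc2 f : cmeasurable f ->
  measurable_fun setT (fun x => (normc (f x) ^+ 2)%:E).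
Proof.
by move=> mf; apply/measurable_EFinP; apply: measurable_funX; exact: measurable_normc.
Qed.

End complex_measurable.

Lemma cmeasurable_comp {R : realType} d d' (T : measurableType d)
    (T' : measurableType d') (h : T' -> T) (f : T -> R[i]) :
  measurable_fun setT h -> cmeasurable f -> cmeasurable (fun x => f (h x)).
Proof.
by move=> mh [mf mf']; split; [exact: (measurableT_comp mf)|exact: (measurableT_comp mf')].
Qed.

Section L2.
Context {R : realType} d (T : measurableType d).
Variable mu : {measure set T -> \bar R}.
Implicit Types f g : T -> R[i].
Notation Re := complex.Re.
Notation Im := complex.Im.

Definition sqnorm f : \bar R := (\int[mu]_x (normc (f x) ^+ 2)%:E)%E.

Lemma sqnorm_ge0 f : (0 <= sqnorm f)%E.
Proof. by apply: integral_ge0 => x _; rewrite lee_fin sqr_ge0. Qed.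

Lemma L2norm_ge0 f : (0 <= L2norm mu f)%E.
Proof. exact: Lnorm_ge0. Qed.

Lemma L2norm_sqrt f : L2norm mu f = (sqnorm f `^ 2^-1)%E.
Proof.
rewrite /L2norm unlock/=; congr (_ `^ _)%E; apply: eq_integral => x _.
by rewrite ger0_norm ?normc_ge0// powR_mulrn// normc_ge0.
Qed.

Lemma L2norm_fin f : (sqnorm f < +oo)%E -> 
  L2norm mu f = (Num.sqrt (fine (sqnorm f)))%:E.
Proof.
move=> fin; rewrite L2norm_sqrt.
have fn : sqnorm f \is a fin_num by rewrite ge0_fin_numE// sqnorm_ge0.
by rewrite -[in LHS](fineK fn) poweR_EFin powR12_sqrt// fine_ge0// sqnorm_ge0.
Qed.

Lemma L2norm_infty f : (sqnorm f = +oo)%E -> L2norm mu f = +oo%E.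
Proof. by move=> e; rewrite L2norm_sqrt e poweRE invr_eq0 pnatr_eq0/=. Qed.

Lemma sqr_L2norm f : (L2norm mu f ^+ 2 = sqnorm f)%E.
Proof.
have := sqnorm_ge0 f; rewrite le_eqVlt => /predU1P[e0|_].
  by rewrite L2norm_sqrt -e0 poweR0r ?invr_neq0// expe2 mule0.
have [fin|] := ltP (sqnorm f) +oo%E.
  rewrite L2norm_fin// -EFin_expe sqr_sqrtr ?fine_ge0 ?sqnorm_ge0//.
  by rewrite fineK// ge0_fin_numE// sqnorm_ge0.
by rewrite leye_eq => /eqP e; rewrite L2norm_infty// e.
Qed.

Lemma square_integrableP f :
  square_integrable mu f <-> cmeasurable f /\ (sqnorm f < +oo)%E.
Proof.
rewrite /square_integrable /finite_norm.
have -> : ('N[mu]_2%:E[EFin \o (fun x => normc (f x))] = L2norm mu f)%E by [].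
split => [[mf mf' fin]|[[mf mf'] fin]]; split => //.
  rewrite -sqr_L2norm expe2 lte_mul_pinfty ?L2norm_ge0//.
  by rewrite ge0_fin_numE// L2norm_ge0.
by rewrite L2norm_fin// ltry.
Qed.

End L2.
Arguments sqnorm {R d T} mu f.

Lemma L2norm_le {R : realType} d d' (T : measurableType d) (T' : measurableType d')
    (mu : {measure set T -> \bar R}) (nu : {measure set T' -> \bar R})
    (f : T -> R[i]) (g : T' -> R[i]) :
  (sqnorm mu f <= sqnorm nu g)%E -> (L2norm mu f <= L2norm nu g)%E.
Proof.
move=> fg; rewrite !L2norm_sqrt gt0_ler_poweR ?invr_ge0//.
- by rewrite in_itv/= leey sqnorm_ge0.
- by rewrite in_itv/= leey sqnorm_ge0.
Qed.

Section cintegral.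
Context {R : realType} d (T : measurableType d).
Variable m : {measure set T -> \bar R}.
Implicit Types f g h : T -> R[i].
Notation Re := complex.Re.
Notation Im := complex.Im.

Definition cintegrable h : Prop :=
  cmeasurable h /\ m.-integrable setT (fun x => (normc (h x))%:E).

Lemma cintegrable_Re h : cintegrable h -> m.-integrable setT (EFin \o (fun x => Re (h x))).
Proof.
move=> [[mh mh'] ih]; apply: le_integrable ih => //; first exact/measurable_EFinP.
by move=> x _ /=; rewrite lee_fin [leRHS]ger0_norm ?normc_ge0// normc_Re.
Qed.

Lemma cintegrable_Im h : cintegrable h -> m.-integrable setT (EFin \o (fun x => Im (h x))).
Proof.
move=> [[mh mh'] ih]; apply: le_integrable ih => //; first exact/measurable_EFinP.
by move=> x _ /=; rewrite lee_fin [leRHS]ger0_norm ?normc_ge0// normc_Im.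
Qed.

Lemma le_cintegrable h (b : T -> R) : cmeasurable h ->
  m.-integrable setT (EFin \o b) -> (forall x, normc (h x) <= b x) -> cintegrable h.
Proof.
move=> mh ib hb; split => //; apply: le_integrable ib => //.
  by apply/measurable_EFinP; exact: measurable_normc.
move=> x _ /=; rewrite lee_fin ger0_norm ?normc_ge0//.
by rewrite (le_trans (hb x))// ler_norm.
Qed.

Lemma cintegrableD f g : cintegrable f -> cintegrable g ->
  cintegrable (fun x => f x + g x).
Proof.
move=> [mf if_] [mg ig]; apply: (le_cintegrable (b := fun x => normc (f x) + normc (g x))).
- exact: cmeasurableD.
- by have := integrableD measurableT if_ ig.
- by move=> x; exact: le_normcD.
Qed.

Lemma cintegrableZ (a : R[i]) f : cintegrable f -> cintegrable (fun x => a * f x).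
Proof.
move=> [mf if_]; apply: (le_cintegrable (b := fun x => normc a * normc (f x))).
- by apply: cmeasurableM => //; exact: cmeasurable_cst.
- by have := integrableZl measurableT (normc a) if_.
- by move=> x; rewrite normcM.
Qed.

Lemma cintegrable0 : cintegrable (fun=> 0).
Proof.
split; first exact: cmeasurable_cst.
by under eq_fun do rewrite normc0; exact: integrable0.
Qed.

Lemma cintegralD f g : cintegrable f -> cintegrable g ->
  cintegral m (fun x => f x + g x) = cintegral m f + cintegral m g.
Proof.
move=> if_ ig; rewrite /cintegral.
under eq_Rintegral do rewrite cReD.
under [X in Complex _ X]eq_Rintegral do rewrite cImD.
rewrite !RintegralD//; try exact: cintegrable_Re; exact: cintegrable_Im.
Qed.

Lemma cintegralZ (a : R[i]) f : cintegrable f ->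
  cintegral m (fun x => a * f x) = a * cintegral m f.
Proof.
move=> if_; have iR := cintegrable_Re if_; have iI := cintegrable_Im if_.
have ZR (c : R) : m.-integrable setT (EFin \o (fun x => c * Re (f x))).
  by have := integrableZl measurableT c iR.
have ZI (c : R) : m.-integrable setT (EFin \o (fun x => c * Im (f x))).
  by have := integrableZl measurableT c iI.
rewrite /cintegral.
under eq_Rintegral do rewrite cReM.
under [X in Complex _ X]eq_Rintegral do rewrite cImM.
rewrite RintegralB// RintegralD// !RintegralZl//.
by apply: complex_eq; rewrite ?cReM ?cImM.
Qed.

Lemma cintegral0 : cintegral m (fun=> 0) = 0.
Proof.
rewrite -[RHS](mul0r (cintegral m (fun=> 0))) -cintegralZ; last exact: cintegrable0.
by congr cintegral; apply/funext => x; rewrite mul0r.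
Qed.

Lemma cintegrable_sum n (f : nat -> T -> R[i]) : (forall i, cintegrable (f i)) ->
  cintegrable (fun x => \sum_(i < n) f i x).
Proof.
move=> if_; elim: n => [|n IH].
  by under eq_fun do rewrite big_ord0; exact: cintegrable0.
by under eq_fun do rewrite big_ord_recr/=; exact: cintegrableD.
Qed.

Lemma cintegral_sum n (f : nat -> T -> R[i]) : (forall i, cintegrable (f i)) ->
  cintegral m (fun x => \sum_(i < n) f i x) = \sum_(i < n) cintegral m (f i).
Proof.
move=> if_; elim: n => [|n IH].
  by under eq_fun do rewrite big_ord0; rewrite cintegral0 big_ord0.
under eq_fun do rewrite big_ord_recr/=.
rewrite cintegralD//; last exact: cintegrable_sum.
by rewrite IH big_ord_recr.
Qed.

Lemma ae_eq_cintegral f g : cmeasurable f -> cmeasurable g ->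
  {ae m, forall x, f x = g x} -> cintegral m f = cintegral m g.
Proof.
move=> [mf mf'] [mg mg'] fg; rewrite /cintegral /Rintegral.
by congr (Complex (fine _) (fine _)); apply: ae_eq_integral => //;
  try exact/measurable_EFinP; apply: filterS fg => x /= ->.
Qed.

(** The factor 2 comes from bounding the real and the imaginary part separately by the integral of
    the modulus. *)
Lemma normc_cintegral h : cintegrable h ->
  ((normc (cintegral m h))%:E <= 2%:E * \int[m]_x (normc (h x))%:E)%E.
Proof.
move=> ih; have iR := cintegrable_Re ih; have iI := cintegrable_Im ih.
have [mh inh] := ih.
have [mR mI] := mh.
have le_R (u : T -> R) : m.-integrable setT (EFin \o u) ->
   (forall x, `|u x| <= normc (h x)) ->
   (`|\int[m]_x u x|%:E <= \int[m]_x (normc (h x))%:E)%E.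
  move=> iu uh; apply: (@le_trans _ _ (\int[m]_x `|(u x)%:E|)%E).
    rewrite EFin_normr_Rintegral//; apply: le_abse_integral => //.
    exact: measurable_int iu.
  apply: ge0_le_integral => //.
  - by apply/measurable_EFinP; apply: measurableT_comp => //; exact/measurable_EFinP/(measurable_int _ iu).
  - by apply/measurable_EFinP; exact: measurable_normc.
  - by move=> x _; rewrite lee_fin.
apply: (@le_trans _ _ (`|\int[m]_x Re (h x)|%:E + `|\int[m]_x Im (h x)|%:E)%E).
  by rewrite -EFinD lee_fin; exact: normc_le.
rewrite -[2%:E]/((1 + 1)%:E) EFinD ge0_muleDl// !mul1e.
by apply: leeD; apply: le_R => // x; [exact: normc_Re|exact: normc_Im].
Qed.

Lemma cintegral_cvg0 (h : nat -> T -> R[i]) (b : T -> R) :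
  (forall n, cmeasurable (h n)) -> m.-integrable setT (EFin \o b) ->
  {ae m, forall x, forall n, normc (h n x) <= b x} ->
  {ae m, forall x, ccvg (h ^~ x) 0} ->
  ccvg (fun n => cintegral m (h n)) 0.
Proof.
move=> mh ib hb h0.
have mn n : measurable_fun setT (fun x => (normc (h n x))%:E).
  by apply/measurable_EFinP; exact: measurable_normc.
have ih n : cintegrable (h n).
  split => //; apply/integrableP; split => //.
  have /integrableP[mb ib'] := ib; apply: le_lt_trans ib'.
  apply: ae_ge0_le_integral => //.
  - exact: measurableT_comp.
  - exact: measurableT_comp.
  - apply: filterS hb => x /(_ n) hx _ /=; rewrite lee_fin ger0_norm ?normc_ge0//.
    by rewrite (le_trans hx)// ler_norm.
have cv : {ae m, forall x, setT x -> (normc (h n x))%:E @[n --> \oo] --> (0 : R)%:E}.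
  by apply: filterS h0 => x /ccvg0P hx _; apply: cvg_EFin => //; exact: nearW.
have dm : {ae m, forall x n, setT x -> (`|(normc (h n x))%:E| <= (EFin \o b) x)%E}.
  by apply: filterS hb => x hx n _; rewrite /= lee_fin ger0_norm ?normc_ge0.
have [_ _] := dominated_convergence measurableT mn (@measurable_cst _ _ _ _ _ _) cv ib dm.
rewrite integral0 => /= cI.
have : (2%:E * \int[m]_x (normc (h n x))%:E)%E @[n --> \oo] --> 0%E.
  by rewrite -(mule0 2%:E); apply: cvgeZl.
move=> /fine_cvgP[_ c2]; apply: normc_cvg0_le c2 => n /=.
have fin : (2%:E * \int[m]_x (normc (h n x))%:E)%E \is a fin_num.
  by rewrite fin_numM// integrable_fin_num//; case: (ih n).
by rewrite -lee_fin fineK//; exact: normc_cintegral.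
Qed.

End cintegral.

Section L2_space.
Context {R : realType} d (T : measurableType d).
Variable m : {measure set T -> \bar R}.
Implicit Types f g h : T -> R[i].
Notation Re := complex.Re.
Notation Im := complex.Im.

Lemma sqnorm_integrable f : cmeasurable f -> (sqnorm m f < +oo)%E ->
  m.-integrable setT (fun x => (normc (f x) ^+ 2)%:E).
Proof.
move=> mf fin; apply/integrableP; split; first exact: measurable_normc2.
by under eq_integral do rewrite gee0_abs ?lee_fin ?sqr_ge0//.
Qed.

Lemma square_integrable_cmeasurable f : square_integrable m f -> cmeasurable f.
Proof. by move=> /square_integrableP[]. Qed.

Lemma square_integrable_sqnorm f : square_integrable m f -> (sqnorm m f < +oo)%E.
Proof. by move=> /square_integrableP[]. Qed.

Lemma le_sqnorm f g : cmeasurable f -> cmeasurable g ->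
  {ae m, forall x, normc (f x) <= normc (g x)} -> (sqnorm m f <= sqnorm m g)%E.
Proof.
move=> mf mg fg; apply: ae_ge0_le_integral => //.
- by move=> x _; rewrite lee_fin sqr_ge0.
- exact: measurable_normc2.
- by move=> x _; rewrite lee_fin sqr_ge0.
- exact: measurable_normc2.
- apply: filterS fg => x fg _; rewrite lee_fin.
  by rewrite ler_sqr// nnegrE normc_ge0.
Qed.

Lemma ae_eq_sqnorm f g : cmeasurable f -> cmeasurable g ->
  {ae m, forall x, f x = g x} -> sqnorm m f = sqnorm m g.
Proof.
move=> mf mg fg; apply/eqP; rewrite eq_le; apply/andP; split; apply: le_sqnorm => //;
  by apply: filterS fg => x ->.
Qed.

Lemma sqnorm_eq0 f : cmeasurable f -> sqnorm m f = 0%E -> {ae m, forall x, f x = 0}.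
Proof.
move=> mf f0; have := ae_eq_integral_abs m measurableT (measurable_normc2 mf).
move=> [+ _]; rewrite -f0 => /(_ _)[|N [mN N0 sN]].
  by apply: eq_integral => x _; rewrite gee0_abs// lee_fin sqr_ge0.
exists N; split => //; apply: subset_trans sN => x /= fx h; apply: fx.
have [e] : (normc (f x) ^+ 2)%:E = 0%:E := etrans (h Logic.I) f0.
by apply: eq0_normc; apply/eqP; rewrite -sqrf_eq0; apply/eqP.
Qed.

Lemma sqnorm0 : sqnorm m (fun=> 0) = 0%E.
Proof. by rewrite /sqnorm integral0_eq// => x _; rewrite normc0 expr0n. Qed.

Lemma ae_eq0_sqnorm f : cmeasurable f -> {ae m, forall x, f x = 0} -> sqnorm m f = 0%E.
Proof.
move=> mf f0; rewrite -sqnorm0; apply: ae_eq_sqnorm => //; exact: cmeasurable_cst.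
Qed.

Lemma L2norm_eq0 f : cmeasurable f -> L2norm m f = 0%E -> {ae m, forall x, f x = 0}.
Proof. by move=> mf f0; apply: sqnorm_eq0 => //; rewrite -sqr_L2norm f0 expe2 mule0. Qed.

Lemma le_square_integrable f g : cmeasurable f -> square_integrable m g ->
  {ae m, forall x, normc (f x) <= normc (g x)} -> square_integrable m f.
Proof.
move=> mf /square_integrableP[mg fin] fg; apply/square_integrableP; split => //.
exact: le_lt_trans (le_sqnorm mf mg fg) fin.
Qed.

Lemma square_integrable0 : square_integrable m (fun=> 0).
Proof.
by apply/square_integrableP; split; [exact: cmeasurable_cst|rewrite sqnorm0 ltry].
Qed.

Lemma square_integrableZ (a : R[i]) f : square_integrable m f ->
  square_integrable m (fun x => a * f x).
Proof.
move=> /square_integrableP[mf fin]; apply/square_integrableP; split.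
  by apply: cmeasurableM => //; exact: cmeasurable_cst.
rewrite /sqnorm; under eq_integral do rewrite normcM exprMn EFinM.
rewrite ge0_integralZl ?lee_fin ?sqr_ge0//.
- by rewrite lte_mul_pinfty ?lee_fin ?sqr_ge0.
- exact: measurable_normc2.
- by move=> x _; rewrite lee_fin sqr_ge0.
Qed.

Lemma square_integrableD f g : square_integrable m f -> square_integrable m g ->
  square_integrable m (fun x => f x + g x).
Proof.
move=> /square_integrableP[mf ff] /square_integrableP[mg fg]; apply/square_integrableP.
split; first exact: cmeasurableD.
apply: (@le_lt_trans _ _ (\int[m]_x (2%:E * ((normc (f x) ^+ 2)%:E + (normc (g x) ^+ 2)%:E)))%E).
  have m2 := measurable_normc2 mf; have m3 := measurable_normc2 mg.
  apply: ge0_le_integral => //.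
  - by move=> x _; rewrite lee_fin sqr_ge0.
  - by apply: measurable_normc2; exact: cmeasurableD.
  - by apply: measurable_funeM; exact: emeasurable_funD.
  - move=> x _; rewrite -EFinD -EFinM lee_fin.
    apply: (@le_trans _ _ ((normc (f x) + normc (g x)) ^+ 2)).
      by rewrite ler_sqr ?nnegrE ?normc_ge0 ?addr_ge0 ?normc_ge0// le_normcD.
    by have := sqr_ge0 (normc (f x) - normc (g x)); rewrite sqrrB sqrrD; lra.
rewrite ge0_integralZl//; last 2 first.
- by apply: emeasurable_funD; exact: measurable_normc2.
- by move=> x _; rewrite adde_ge0// lee_fin sqr_ge0.
rewrite ge0_integralD//; try exact: measurable_normc2;
  try by move=> x _; rewrite lee_fin sqr_ge0.
by rewrite lte_mul_pinfty// lte_add_pinfty.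
Qed.

Lemma square_integrable_conj f : square_integrable m f ->
  square_integrable m (fun x => (f x)^*%C).
Proof.
move=> sf; apply: le_square_integrable (sf) _.
  exact: cmeasurable_conj (square_integrable_cmeasurable sf).
by apply: aeW => x; rewrite normc_conj.
Qed.

Lemma square_integrable_mul f g : square_integrable m f -> square_integrable m g ->
  cintegrable m (fun x => f x * g x).
Proof.
move=> /square_integrableP[mf ff] /square_integrableP[mg fg].
apply: (le_cintegrable (b := fun x => normc (f x) ^+ 2 + normc (g x) ^+ 2)).
- exact: cmeasurableM.
- by have := integrableD measurableT (sqnorm_integrable mf ff) (sqnorm_integrable mg fg).
- by move=> x; exact: normc_mul_le.
Qed.

Lemma normc_cintegral_mul f g : square_integrable m f -> square_integrable m g ->
  ((normc (cintegral m (fun x => f x * g x)))%:E <= 2%:E * (L2norm m f * L2norm m g))%E.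
Proof.
move=> sf sg; apply: le_trans (normc_cintegral (square_integrable_mul sf sg)) _.
apply: lee_pmul => //; first by apply: integral_ge0 => x _; rewrite lee_fin normc_ge0.
have h12 : 2^-1 + 2^-1 = 1 :> R by field.
have := @hoelder _ _ _ m (fun x => normc (f x)) (fun x => normc (g x)) 2 2
  (measurable_normc (square_integrable_cmeasurable sf))
  (measurable_normc (square_integrable_cmeasurable sg)) (ltr0n _ 2) (ltr0n _ 2) h12.
apply: le_trans; rewrite Lnorm1 le_eqVlt; apply/orP; left; apply/eqP.
by apply: eq_integral => x _; rewrite /= normcM ger0_norm// mulr_ge0// normc_ge0.
Qed.

End L2_space.

(** * Averages over a probability space *)

Section jensen.
Context {R : realType} d (T : measurableType d) (P : probability T R).
Notation Re := complex.Re.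
Notation Im := complex.Im.

Lemma probability_integral_cst (c : R) : (\int[P]_u c%:E = c%:E)%E.
Proof. by rewrite integral_cst// [X in (_ * X)%E]probability_setT mule1. Qed.

(** This is nonnegativity of the variance; expanding the square uses that [P] has mass 1. *)
Lemma sqr_Rintegral_le (u : T -> R) : P.-integrable setT (EFin \o u) ->
  P.-integrable setT (fun x => (u x ^+ 2)%:E) ->
  (\int[P]_x u x) ^+ 2 <= \int[P]_x (u x ^+ 2).
Proof.
move=> iu iu2; set c := \int[P]_x u x.
have icst (k : R) : P.-integrable setT (EFin \o (fun=> k)).
  exact: finite_measure_integrable_cst.
have iZ : P.-integrable setT (EFin \o (fun x => - (2 * c) * u x)).
  by have := integrableZl measurableT (- (2 * c)) iu.
have iD : P.-integrable setT (EFin \o (fun x => - (2 * c) * u x + c ^+ 2)).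
  by have := integrableD measurableT iZ (icst (c ^+ 2)).
have : 0 <= \int[P]_x ((u x - c) ^+ 2) by apply: Rintegral_ge0 => x _; exact: sqr_ge0.
have -> : \int[P]_x ((u x - c) ^+ 2) = \int[P]_x (u x ^+ 2 + (- (2 * c) * u x + c ^+ 2)).
  by apply: eq_Rintegral => x _; ring.
rewrite RintegralD// RintegralD// RintegralZl// Rintegral_cst//.
have -> : fine (P setT) = 1 by rewrite probability_setT.
by rewrite -/c; lra.
Qed.

Lemma probability_cintegrable (h : T -> R[i]) :
  cmeasurable h -> (sqnorm P h < +oo)%E -> cintegrable P h.
Proof.
move=> mh fin; apply: (le_cintegrable (b := fun x => 1 + normc (h x) ^+ 2)) => //.
  have i1 := finite_measure_integrable_cst P (1 : R) (@measurableT _ T).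
  by have := integrableD measurableT i1 (sqnorm_integrable mh fin).
move=> x; have := sqr_ge0 (normc (h x) - 2^-1); rewrite sqrrB.
by have := sqr_ge0 (normc (h x)); lra.
Qed.

(** Treating real and imaginary parts separately loses no constant here, since squared moduli add
    up. This is why [push] is a contraction. *)
Lemma sqr_cintegral_le (h : T -> R[i]) :
  cmeasurable h -> (sqnorm P h < +oo)%E ->
  ((normc (cintegral P h) ^+ 2)%:E <= sqnorm P h)%E.
Proof.
move=> mh fin; have ih := probability_cintegrable mh fin; have [mR mI] := mh.
have i2 := sqnorm_integrable mh fin.
have iR : P.-integrable setT (fun x => (Re (h x) ^+ 2)%:E).
  apply: le_integrable i2 => //.
    by apply/measurable_EFinP; exact: measurable_funX.
  by move=> x _; rewrite lee_fin !ger0_norm ?sqr_ge0// sqr_normcE lerDl sqr_ge0.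
have iI : P.-integrable setT (fun x => (Im (h x) ^+ 2)%:E).
  apply: le_integrable i2 => //.
    by apply/measurable_EFinP; exact: measurable_funX.
  by move=> x _; rewrite lee_fin !ger0_norm ?sqr_ge0// sqr_normcE lerDr sqr_ge0.
have -> : sqnorm P h = (\int[P]_x (Re (h x) ^+ 2) + \int[P]_x (Im (h x) ^+ 2))%:E.
  rewrite -RintegralD// /Rintegral fineK//; last first.
    by apply: (integrable_fin_num measurableT); exact: (integrableD measurableT iR iI).
  by apply: eq_integral => x _; rewrite sqr_normcE.
rewrite lee_fin sqr_normcE; apply: lerD; apply: sqr_Rintegral_le => //.
- exact: cintegrable_Re.
- exact: cintegrable_Im.
Qed.

End jensen.

Section bilinear_dominated.
Context {R : realType} dS dT (S : measurableType dS) (T : measurableType dT).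
Variables (P : probability S R) (Q : probability T R).

Definition sumsq {A : Type} (f : nat -> A -> R[i]) (x : A) : \bar R :=
  (\sum_(i <oo) (normc (f i x) ^+ 2)%:E)%E.

Lemma sumsq_ge0 {A : Type} (f : nat -> A -> R[i]) x : (0 <= sumsq f x)%E.
Proof. by apply: nneseries_ge0 => i _ _; rewrite lee_fin sqr_ge0. Qed.

Lemma sumsq_partial {A : Type} (f : nat -> A -> R[i]) x n : (sumsq f x < +oo)%E ->
  \sum_(i < n) normc (f i x) ^+ 2 <= fine (sumsq f x).
Proof.
move=> fin; rewrite -lee_fin fineK ?ge0_fin_numE ?sumsq_ge0//.
rewrite -sumEFin; apply: le_trans (nneseries_lim_ge n _); first by rewrite big_mkord.
by move=> i _; rewrite lee_fin sqr_ge0.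
Qed.

Lemma measurable_sumsq d (A : measurableType d) (f : nat -> A -> R[i]) :
  (forall i, cmeasurable (f i)) -> measurable_fun setT (sumsq f).
Proof.
move=> mf; apply: ge0_emeasurable_sum => [i x _ _|i _].
  by rewrite lee_fin sqr_ge0.
exact: measurable_normc2.
Qed.

Lemma integral_sumsq d (A : measurableType d) (m : {measure set A -> \bar R})
    (f : nat -> A -> R[i]) : (forall i, cmeasurable (f i)) ->
  (\int[m]_x sumsq f x = \sum_(i <oo) sqnorm m (f i))%E.
Proof.
move=> mf; rewrite /sumsq integral_nneseries//.
- by move=> n; exact: measurable_normc2.
- by move=> n x _; rewrite lee_fin sqr_ge0.
Qed.

Lemma sumsq_integrable d (A : measurableType d) (m : {measure set A -> \bar R})
    (f : nat -> A -> R[i]) : (forall i, cmeasurable (f i)) ->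
  (\int[m]_x sumsq f x < +oo)%E ->
  {ae m, forall x, (sumsq f x < +oo)%E} /\
  m.-integrable setT (EFin \o (fun x => fine (sumsq f x))).
Proof.
move=> mf fin; have ms := measurable_sumsq mf.
have is_ : m.-integrable setT (sumsq f).
  apply/integrableP; split => //.
  by under eq_integral do rewrite gee0_abs ?sumsq_ge0//.
split.
  have := integrable_ae measurableT is_; apply: filterS => x /(_ Logic.I).
  by rewrite ge0_fin_numE// sumsq_ge0.
apply: le_integrable is_ => //.
  by apply/measurable_EFinP; exact: (measurableT_comp (@fine_measurable R setT measurableT)).
move=> x _ /=; rewrite ger0_norm ?fine_ge0 ?sumsq_ge0// gee0_abs ?sumsq_ge0//.
have [fx|] := ltP (sumsq f x) +oo%E; first by rewrite fineK// ge0_fin_numE// sumsq_ge0.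
by rewrite leye_eq => /eqP ->; rewrite leey.
Qed.

Lemma sqnorm_lty_sumsq d (A : measurableType d) (m : {measure set A -> \bar R})
    (f : nat -> A -> R[i]) i : (forall i, cmeasurable (f i)) ->
  (\int[m]_x sumsq f x < +oo)%E -> (sqnorm m (f i) < +oo)%E.
Proof.
move=> mf; apply: le_lt_trans; apply: ge0_le_integral => //.
- by move=> x _; rewrite lee_fin sqr_ge0.
- exact: measurable_normc2.
- exact: measurable_sumsq.
move=> x _; have := @nneseries_lim_ge R (fun i => (normc (f i x) ^+ 2)%:E) xpredT 0%N i.+1.
rewrite big_nat_recr//= => h; apply: le_trans (h _); last first.
  by move=> k _; rewrite lee_fin sqr_ge0.
by rewrite leeDr// sume_ge0// => k _; rewrite lee_fin sqr_ge0.
Qed.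

(* Fubini for a bilinear series, by dominated convergence in each variable:
   the partial sums are bounded by [sumsq f u + sumsq g v]. *)
Lemma bilinear_cintegral_cvg0 (f : nat -> S -> R[i]) (g : nat -> T -> R[i]) :
  (forall i, cmeasurable (f i)) -> (forall i, cmeasurable (g i)) ->
  (\int[P]_u sumsq f u < +oo)%E -> (\int[Q]_v sumsq g v < +oo)%E ->
  {ae P, forall u, {ae Q, forall v, ccvg (fun n => \sum_(i < n) f i u * g i v) 0}} ->
  ccvg (fun n => \sum_(i < n) cintegral P (f i) * cintegral Q (g i)) 0.
Proof.
move=> mf mg ff fg fg0.
have [aef ifs] := sumsq_integrable mf ff.
have [aeg igs] := sumsq_integrable mg fg.
have if_ i := probability_cintegrable (mf i) (sqnorm_lty_sumsq i mf ff).
have ig i := probability_cintegrable (mg i) (sqnorm_lty_sumsq i mg fg).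
pose c i := cintegral Q (g i).
(* By Jensen the averages [c i] are square summable; this bound dominates the second integration,
   over u. *)
have bc n : \sum_(i < n) normc (c i) ^+ 2 <= fine (\int[Q]_v sumsq g v)%E.
  rewrite -lee_fin fineK; last first.
    by rewrite ge0_fin_numE//; apply: integral_ge0 => v _; exact: sumsq_ge0.
  rewrite integral_sumsq// -sumEFin.
  apply: le_trans (nneseries_lim_ge n _); last by move=> i _ _; exact: sqnorm_ge0.
  rewrite big_mkord; apply: lee_sum => i _; apply: sqr_cintegral_le => //.
  exact: sqnorm_lty_sumsq.
have split_bound n (a b : nat -> R[i]) :
    normc (\sum_(i < n) a i * b i) <= \sum_(i < n) normc (a i) ^+ 2 + \sum_(i < n) normc (b i) ^+ 2.
  rewrite -big_split/=; apply: le_trans (normc_sum _ (fun i => a i * b i)) _.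
  by apply: ler_sum => i _; exact: normc_mul_le.
have inner : {ae P, forall u, ccvg (fun n => \sum_(i < n) f i u * c i) 0}.
  apply: filterS2 aef fg0 => u fu fgu.
  have -> : (fun n => \sum_(i < n) f i u * c i) =
      (fun n => cintegral Q (fun v => \sum_(i < n) f i u * g i v)).
    apply/funext => n.
    rewrite (@cintegral_sum _ _ _ Q n (fun i v => f i u * g i v)); last first.
      by move=> i; exact: cintegrableZ.
    by apply: eq_bigr => i _; rewrite cintegralZ.
  apply: (@cintegral_cvg0 _ _ _ Q _ (fun v => fine (sumsq f u) + fine (sumsq g v))) => //.
  - move=> n; apply: (@cmeasurable_sum _ _ _ n (fun i v => f i u * g i v)) => i.
    by apply: cmeasurableM => //; exact: cmeasurable_cst.
  - have i1 := finite_measure_integrable_cst Q (fine (sumsq f u)) (@measurableT _ T).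
    by have := integrableD measurableT i1 igs.
  - apply: filterS aeg => v gv n; apply: le_trans (split_bound n (f^~ u) (g^~ v)) _.
    by apply: lerD; exact: sumsq_partial.
have -> : (fun n => \sum_(i < n) cintegral P (f i) * cintegral Q (g i)) =
    (fun n => cintegral P (fun u => \sum_(i < n) f i u * c i)).
  apply/funext => n.
  rewrite (@cintegral_sum _ _ _ P n (fun i u => f i u * c i)); last first.
    by move=> i; under eq_fun do rewrite mulrC; exact: cintegrableZ.
  by apply: eq_bigr => i _; under [in RHS]eq_fun do rewrite mulrC; rewrite cintegralZ// mulrC.
apply: (@cintegral_cvg0 _ _ _ P _ (fun u => fine (sumsq f u) + fine (\int[Q]_v sumsq g v)%E)) => //.
- move=> n; apply: (@cmeasurable_sum _ _ _ n (fun i u => f i u * c i)) => i.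
  by apply: cmeasurableM => //; exact: cmeasurable_cst.
- have i1 := finite_measure_integrable_cst P (fine (\int[Q]_v sumsq g v)%E) (@measurableT _ S).
  by have := integrableD measurableT ifs i1.
- apply: filterS aef => u fu n; apply: le_trans (split_bound n (f^~ u) c) _.
  by apply: lerD => //; exact: sumsq_partial.
Qed.

End bilinear_dominated.

(** * Bounded and compact operators *)

Section bounded_operators.
Context {R : realType} dX dY (X : measurableType dX) (Y : measurableType dY).
Variables (mu : {measure set X -> \bar R}) (nu : {measure set Y -> \bar R}).
Implicit Types T : (X -> R[i]) -> (Y -> R[i]).

(** With the constant 1, unit balls go to unit balls, as sequential compactness of composites
    requires, and the projective norm does not grow under pulling back. Linearity is only almost
    everywhere because [push] may fail it on points with a non-integrable fibre. *)
Record L2contraction T : Prop := L2Contraction {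
  L2contraction_L2 : forall f, square_integrable mu f -> square_integrable nu (T f);
  L2contraction_linear : forall (a : R[i]) f g,
    square_integrable mu f -> square_integrable mu g ->
    {ae nu, forall y, T (fun x => a * f x + g x) y = a * T f y + T g y};
  L2contraction_le : forall f, square_integrable mu f -> (L2norm nu (T f) <= L2norm mu f)%E }.

Lemma bounded_operator_le T : bounded_operator mu nu T ->
  exists2 M : R, 0 <= M & forall f, square_integrable mu f ->
    (L2norm nu (T f) <= M%:E * L2norm mu f)%E.
Proof.
move=> [_ _ [M TM]]; exists `|M| => // f sf; apply: le_trans (TM f sf) _.
by rewrite lee_wpmul2r ?L2norm_ge0// lee_fin ler_norm.
Qed.

(** The function -f + g has norm 0, so boundedness makes its image vanish almost everywhere, and
    linearity splits that image. *)
Lemma bounded_operator_ae T f g : bounded_operator mu nu T ->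
  square_integrable mu f -> square_integrable mu g ->
  {ae mu, forall x, f x = g x} -> {ae nu, forall y, T f y = T g y}.
Proof.
move=> bT sf sg fg; have [M M0 TM] := bounded_operator_le bT.
have [T2 Tlin _] := bT.
have sh : square_integrable mu (fun x => -1 * f x + g x).
  by apply: square_integrableD => //; exact: square_integrableZ.
have h0 : L2norm mu (fun x => -1 * f x + g x) = 0%E.
  rewrite L2norm_sqrt ae_eq0_sqnorm ?poweR0r//.
    exact: square_integrable_cmeasurable sh.
  by apply: filterS fg => x ->; rewrite mulN1r addNr.
have Th0 : L2norm nu (T (fun x => -1 * f x + g x)) = 0%E.
  apply/eqP; rewrite eq_le L2norm_ge0 andbT.
  by apply: le_trans (TM _ sh) _; rewrite h0 mule0.
have := L2norm_eq0 (square_integrable_cmeasurable (T2 _ sh)) Th0.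
apply: filterS2 (Tlin (-1) _ _ sf sg) => y -> /eqP.
by rewrite mulN1r addrC subr_eq0 => /eqP.
Qed.

Lemma pairingE T f g : pairing nu T f g = cintegral nu (fun y => T f y * g y).
Proof. by rewrite /pairing /L2inner; under eq_fun do rewrite conjcK. Qed.

Lemma pairing_ae T f f' g g' : bounded_operator mu nu T ->
  square_integrable mu f -> square_integrable mu f' ->
  square_integrable nu g -> square_integrable nu g' ->
  {ae mu, forall x, f x = f' x} -> {ae nu, forall y, g y = g' y} ->
  pairing nu T f g = pairing nu T f' g'.
Proof.
move=> bT sf sf' sg sg' ff' gg'; rewrite !pairingE; have T2 := bounded_operator_L2 bT.
have mm := square_integrable_cmeasurable.
apply: ae_eq_cintegral.
- by apply: cmeasurableM; [exact: (mm _ _ _ _ _ (T2 _ sf))|exact: (mm _ _ _ _ _ sg)].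
- by apply: cmeasurableM; [exact: (mm _ _ _ _ _ (T2 _ sf'))|exact: (mm _ _ _ _ _ sg')].
- by apply: filterS2 (bounded_operator_ae bT sf sf' ff') gg' => y -> ->.
Qed.

Lemma pairing_linearl T (a : R[i]) f f' g : bounded_operator mu nu T ->
  square_integrable mu f -> square_integrable mu f' -> square_integrable nu g ->
  pairing nu T (fun x => a * f x + f' x) g = a * pairing nu T f g + pairing nu T f' g.
Proof.
move=> bT sf sf' sg; rewrite !pairingE; have [T2 Tlin _] := bT.
have i1 := square_integrable_mul (T2 _ sf) sg.
have i2 := square_integrable_mul (T2 _ sf') sg.
have sff : square_integrable mu (fun x => a * f x + f' x).
  by apply: square_integrableD => //; exact: square_integrableZ.
have i3 := square_integrable_mul (T2 _ sff) sg.
rewrite -cintegralZ// -cintegralD//; last exact: cintegrableZ.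
apply: ae_eq_cintegral; first by case: i3.
  by case: (cintegrableD (cintegrableZ a i1) i2).
by apply: filterS (Tlin a _ _ sf sf') => y ->; rewrite mulrDl mulrA.
Qed.

Lemma pairing_linearr T (a : R[i]) f g g' : bounded_operator mu nu T ->
  square_integrable mu f -> square_integrable nu g -> square_integrable nu g' ->
  pairing nu T f (fun y => a * g y + g' y) = a * pairing nu T f g + pairing nu T f g'.
Proof.
move=> bT sf sg sg'; rewrite !pairingE; have T2 := bounded_operator_L2 bT.
have i1 := square_integrable_mul (T2 _ sf) sg.
have i2 := square_integrable_mul (T2 _ sf) sg'.
rewrite -cintegralZ// -cintegralD//; last exact: cintegrableZ.
by congr cintegral; apply/funext => y; rewrite mulrDr mulrCA.
Qed.

Lemma pairing_bound T : bounded_operator mu nu T ->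
  exists2 M : R, 0 <= M & forall f g, square_integrable mu f -> square_integrable nu g ->
    ((normc (pairing nu T f g))%:E <= M%:E * (L2norm mu f * L2norm nu g))%E.
Proof.
move=> bT; have [M M0 TM] := bounded_operator_le bT.
exists (2 * M); first exact: mulr_ge0.
move=> f g sf sg; rewrite pairingE.
apply: le_trans (normc_cintegral_mul (bounded_operator_L2 bT sf) sg) _.
rewrite EFinM -muleA lee_wpmul2l// muleA lee_wpmul2r ?L2norm_ge0//; exact: TM.
Qed.

(** Testing T f against its own conjugate gives the squared norm of T f. *)
Lemma bounded_operator_neq0 T : bounded_operator mu nu T ->
  (forall f g, square_integrable mu f -> square_integrable nu g ->
     pairing nu T f g = 0) ->
  forall f, square_integrable mu f -> {ae nu, forall y, T f y = 0}.
Proof.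
move=> bT T0 f sf; have sT := bounded_operator_L2 bT sf.
have := T0 _ _ sf (square_integrable_conj sT).
rewrite pairingE => /(congr1 (@complex.Re R)) /=.
under eq_Rintegral do rewrite mul_conjc /=.
move=> I0; apply: sqnorm_eq0; first exact: square_integrable_cmeasurable sT.
rewrite /sqnorm -[LHS]fineK; first by rewrite -[X in _ = X%:E]I0.
by rewrite ge0_fin_numE ?square_integrable_sqnorm// sqnorm_ge0.
Qed.

End bounded_operators.

Section composition.
Context {R : realType} {dX dX1 dY dY1 : measure_display}.
Context {X : measurableType dX} {X1 : measurableType dX1}.
Context {Y : measurableType dY} {Y1 : measurableType dY1}.
Variables (mu : {measure set X -> \bar R}) (mu1 : {measure set X1 -> \bar R}).
Variables (nu : {measure set Y -> \bar R}) (nu1 : {measure set Y1 -> \bar R}).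
Variables (T : (X -> R[i]) -> (Y -> R[i])).
Variables (C : (X1 -> R[i]) -> (X -> R[i])) (D : (Y -> R[i]) -> (Y1 -> R[i])).
Hypotheses (bT : bounded_operator mu nu T) (cC : L2contraction mu1 mu C).
Hypothesis cD : L2contraction nu nu1 D.

Let D_bounded : bounded_operator nu nu1 D.
Proof.
case: cD => D2 Dlin Dle; split => //; exists 1 => f sf; rewrite mul1e; exact: Dle.
Qed.

Lemma bounded_operator_comp : bounded_operator mu1 nu1 (fun f => D (T (C f))).
Proof.
have [C2 Clin Cle] := cC; have [D2 Dlin Dle] := cD.
have [T2 Tlin _] := bT; have [M M0 TM] := bounded_operator_le bT.
split.
- by move=> f sf; apply: D2; apply: T2; exact: C2.
- move=> a f g sf sg.
  have sfg : square_integrable mu1 (fun x => a * f x + g x).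
    by apply: square_integrableD => //; exact: square_integrableZ.
  have sCC : square_integrable mu (fun x => a * C f x + C g x).
    by apply: square_integrableD => //; [apply: square_integrableZ|]; exact: C2.
  have e1 := bounded_operator_ae bT (C2 _ sfg) sCC (Clin a _ _ sf sg).
  have sTT : square_integrable nu (fun y => a * T (C f) y + T (C g) y).
    by apply: square_integrableD => //; [apply: square_integrableZ|]; apply: T2; exact: C2.
  have e2 := Tlin a _ _ (C2 _ sf) (C2 _ sg).
  have e3 : {ae nu, forall y, T (C (fun x => a * f x + g x)) y = a * T (C f) y + T (C g) y}.
    by apply: filterS2 e1 e2 => y -> ->.
  have e4 := bounded_operator_ae D_bounded (T2 _ (C2 _ sfg)) sTT e3.
  apply: filterS2 e4 (Dlin a _ _ (T2 _ (C2 _ sf)) (T2 _ (C2 _ sg))) => y -> ->.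
  by [].
- exists M => f sf; apply: le_trans (Dle _ (T2 _ (C2 _ sf))) _.
  apply: le_trans (TM _ (C2 _ sf)) _.
  by rewrite lee_wpmul2l ?lee_fin//; exact: Cle.
Qed.

Lemma compact_operator_comp : compact_operator mu nu T ->
  compact_operator mu1 nu1 (fun f => D (T (C f))).
Proof.
move=> kT f f1; have [C2 Clin Cle] := cC; have [D2 Dlin Dle] := cD.
have [T2 _ _] := bT.
have [n|k [g [hk sg cvg]]] := kT (fun n => C (f n)).
  have [sf fle] := f1 n; split; first exact: C2.
  exact: le_trans (Cle _ sf) fle.
exists k, (D g); split => //; first exact: D2.
have c0 : (cst 0%E : nat -> \bar R) n @[n --> \oo] --> (0%E : \bar R) by exact: cvg_cst.
refine (squeeze_cvge _ c0 cvg).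
apply: nearW => n; rewrite L2norm_ge0 andTb.
have sTC : square_integrable nu (T (C (f (k n)))).
  by apply: T2; apply: C2; case: (f1 (k n)).
have sd : square_integrable nu (fun y => T (C (f (k n))) y - g y).
  under eq_fun do rewrite addrC -mulN1r.
  by apply: square_integrableD => //; exact: square_integrableZ.
apply: le_trans _ (Dle _ sd).
apply: L2norm_le.
rewrite (@ae_eq_sqnorm _ _ _ _ _ (D (fun y => T (C (f (k n))) y - g y)))//.
- under eq_fun do rewrite addrC -mulN1r.
  apply: square_integrable_cmeasurable (nu1) _ _.
  by apply: square_integrableD; [apply: square_integrableZ|]; exact: D2.
- exact: square_integrable_cmeasurable (D2 _ sd).
have := Dlin (-1) _ _ sg sTC; apply: filterS => y.
under [in D _]eq_fun do rewrite mulN1r addrC.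
by move=> ->; rewrite mulN1r addrC.
Qed.

(** [D'] is a transpose for the bilinear pairing, without conjugation. For [push] and [pull] each is
    the transpose of the other, so a composed operator is tested by transporting both factors of a
    tensor. *)
Lemma pairing_comp D' :
  (forall g g1, square_integrable nu g -> square_integrable nu1 g1 ->
    cintegral nu1 (fun y => D g y * g1 y) = cintegral nu (fun y => g y * D' g1 y)) ->
  forall f1 g1, square_integrable mu1 f1 -> square_integrable nu1 g1 ->
  pairing nu1 (fun f => D (T (C f))) f1 g1 = pairing nu T (C f1) (D' g1).
Proof.
move=> adj f1 g1 sf1 sg1; rewrite !pairingE adj//.
by apply: (bounded_operator_L2 bT); exact: (L2contraction_L2 cC).
Qed.

End composition.

(** * Representations of elements of Gamma *)

Section sequences.
Context {R : realType}.
Implicit Types u v : nat -> R[i].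

Lemma ccvg_comp u l (k : nat -> nat) : (forall n, (n <= k n)%N) ->
  ccvg u l -> ccvg (fun n => u (k n)) l.
Proof.
move=> nk /ccvgP ul; apply/ccvgP; apply: cvg_comp ul => A [N _ NA].
exists N => // n /= Nn; apply: NA => /=; exact: leq_trans Nn (nk n).
Qed.

(** Serves both to add series of tensors and to merge two countable families of rectangles, keeping
    nat as the index set. *)
Definition interleave {A : Type} (u v : nat -> A) (i : nat) : A :=
  if odd i then v i./2 else u i./2.

(** The kernel K is left arbitrary because the same identity is needed for values of tensors at a
    point and for pairings with an operator. *)
Lemma interleave_sum (A B : Type) (V : nmodType) (K : A -> B -> V)
    (u u' : nat -> A) (v v' : nat -> B) n :
  \sum_(i < n.*2) K (interleave u u' i) (interleave v v' i) =
  \sum_(i < n) K (u i) (v i) + \sum_(i < n) K (u' i) (v' i).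
Proof.
elim: n => [|n IH]; first by rewrite !big_ord0 addr0.
rewrite doubleS !big_ord_recr /= IH /interleave /= odd_double /= uphalf_double doubleK.
by rewrite -!addrA; congr (_ + _); rewrite addrCA.
Qed.

Lemma interleave_series_lty (a b : nat -> \bar R) :
  (forall i, 0 <= a i)%E -> (forall i, 0 <= b i)%E ->
  (\sum_(i <oo) a i < +oo)%E -> (\sum_(i <oo) b i < +oo)%E ->
  (\sum_(i <oo) interleave a b i < +oo)%E.
Proof.
move=> a0 b0 fa fb; apply: (@le_lt_trans _ _ (\sum_(i <oo) a i + \sum_(i <oo) b i)%E).
  have m0 i : (0 <= interleave a b i)%E by rewrite /interleave; case: ifP.
  apply: lime_le; first by apply: is_cvg_nneseries => i _ _.
  apply: nearW => n; apply: (@le_trans _ _ (\sum_(0 <= i < n.*2) interleave a b i)%E).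
    by apply: lee_sum_nneg_natr => [i _ _|]; rewrite // -addnn leq_addr.
  rewrite big_mkord.
  have := @interleave_sum _ unit (\bar R) (fun x _ => x) a b (fun=> tt) (fun=> tt) n.
  move=> ->; rewrite -!(big_mkord xpredT); apply: leeD.
    by apply: nneseries_lim_ge => i _ _.
  by apply: nneseries_lim_ge => i _ _.
by rewrite lte_add_pinfty.
Qed.

End sequences.

Section marginally_null_sets.
Context {R : realType} dX dY (X : measurableType dX) (Y : measurableType dY).
Variables (mu : {measure set X -> \bar R}) (nu : {measure set Y -> \bar R}).
Notation mnull := (marginally_null mu nu).

Lemma mnull_sub (N N' : set (X * Y)) : N `<=` N' -> mnull N' -> mnull N.
Proof.
by move=> NN' [X0 [Y0 [? ? ? ? s]]]; exists X0, Y0; split => //; exact: subset_trans s.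
Qed.

Lemma mnullU (N N' : set (X * Y)) : mnull N -> mnull N' -> mnull (N `|` N').
Proof.
move=> [X0 [Y0 [mX X00 mY Y00 s]]] [X0' [Y0' [mX' X00' mY' Y00' s']]].
exists (X0 `|` X0'), (Y0 `|` Y0'); split; try exact: measurableU.
- by rewrite measureU0.
- by rewrite measureU0.
move=> p [/s|/s'] [[? _]|[_ ?]]; [left|right|left|right]; split => //; by [left|right].
Qed.

Lemma mnull_ae (P : X -> Prop) (Q : Y -> Prop) :
  {ae mu, forall x, P x} -> {ae nu, forall y, Q y} ->
  mnull [set p | ~ (P p.1 /\ Q p.2)].
Proof.
move=> [X0 [mX X00 s]] [Y0 [mY Y00 s']]; exists X0, Y0; split => // -[x y] /= nPQ.
have [Px|nPx] := pselect (P x); last by left; split => //; exact: s.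
by right; split => //=; apply: s' => /= Qy; exact: nPQ.
Qed.

Lemma mnull0 : mnull set0.
Proof. by exists set0, set0; split. Qed.

End marginally_null_sets.

Section representations.
Context {R : realType} dX dY (X : measurableType dX) (Y : measurableType dY).
Variables (mu : {measure set X -> \bar R}) (nu : {measure set Y -> \bar R}).
Implicit Types T : (X -> R[i]) -> (Y -> R[i]).

Lemma square_summableP d (Z : measurableType d) (m : {measure set Z -> \bar R})
    (f : nat -> Z -> R[i]) :
  square_summable m f <->
  (forall i, square_integrable m (f i)) /\ (\int[m]_x sumsq f x < +oo)%E.
Proof.
split=> -[sf ff]; split => //.
  rewrite integral_sumsq => [|i]; last exact: square_integrable_cmeasurable.
  by under eq_eseriesr do rewrite -sqr_L2norm.
move: ff; rewrite integral_sumsq => [|i]; last exact: square_integrable_cmeasurable.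
by under eq_eseriesr do rewrite -sqr_L2norm.
Qed.

Lemma square_summable_ae d (Z : measurableType d) (m : {measure set Z -> \bar R})
    (f : nat -> Z -> R[i]) : square_summable m f ->
  {ae m, forall x, (sumsq f x < +oo)%E}.
Proof.
move=> /square_summableP[sf ff]; apply: (sumsq_integrable _ ff).1 => i.
exact: square_integrable_cmeasurable.
Qed.

Lemma le_square_summable d (Z : measurableType d) (m : {measure set Z -> \bar R})
    d' (Z' : measurableType d') (m' : {measure set Z' -> \bar R})
    (f : nat -> Z -> R[i]) (f' : nat -> Z' -> R[i]) :
  (forall i, square_integrable m (f i)) ->
  (forall i, (L2norm m (f i) <= L2norm m' (f' i))%E) ->
  square_summable m' f' -> square_summable m f.
Proof.
move=> sf ff' [sf' fin]; split => //; apply: le_lt_trans fin.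
apply: lee_nneseries => i _; first by rewrite expe_ge0 ?L2norm_ge0.
by rewrite !expe2 lee_pmul ?L2norm_ge0.
Qed.

Lemma square_summable_contraction d (Z : measurableType d) (m : {measure set Z -> \bar R})
    d' (Z' : measurableType d') (m' : {measure set Z' -> \bar R}) C
    (f : nat -> Z -> R[i]) : L2contraction m m' C ->
  square_summable m f -> square_summable m' (fun i => C (f i)).
Proof.
move=> [C2 _ Cle] sf; have [sfi _] := sf; apply: le_square_summable (sf) => i.
  exact: C2.
exact: Cle.
Qed.

Lemma interleave_square_summable d (Z : measurableType d) (m : {measure set Z -> \bar R})
    (f g : nat -> Z -> R[i]) :
  square_summable m f -> square_summable m g -> square_summable m (interleave f g).
Proof.
move=> [sf ff] [sg fg]; split; first by move=> i; rewrite /interleave; case: ifP.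
rewrite (_ : (\sum_(i <oo) _)%E =
  \sum_(i <oo) interleave (fun i => L2norm m (f i) ^+ 2) (fun i => L2norm m (g i) ^+ 2) i)%E.
  by apply: interleave_series_lty => // i; rewrite expe_ge0 ?L2norm_ge0.
by apply: eq_eseriesr => i _; rewrite /interleave; case: ifP.
Qed.

Lemma square_summable0 d (Z : measurableType d) (m : {measure set Z -> \bar R}) :
  square_summable m (fun=> fun=> 0).
Proof.
apply/square_summableP; split; first by move=> _; exact: square_integrable0.
rewrite integral0_eq// => x _; apply: eseries0 => i _ _.
by rewrite normc0 expr0n.
Qed.

Lemma L2norm_opp d (Z : measurableType d) (m : {measure set Z -> \bar R}) (f : Z -> R[i]) :
  L2norm m (fun x => - f x) = L2norm m f.
Proof. by rewrite /L2norm; congr Lnorm; apply/funext => x; rewrite normcN. Qed.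

Lemma square_summable_opp d (Z : measurableType d) (m : {measure set Z -> \bar R})
    (f : nat -> Z -> R[i]) : square_summable m f ->
  square_summable m (fun i x => - f i x).
Proof.
move=> sf; apply: le_square_summable (sf) => i; last by rewrite L2norm_opp.
have [sfi _] := sf.
by under eq_fun do rewrite -mulN1r; exact: square_integrableZ.
Qed.

(** The series converges wherever both sums of squares are finite, that is, off a marginally null
    set; elsewhere the value of h may be the default 0. *)
Lemma represents_exists (f : nat -> X -> R[i]) (g : nat -> Y -> R[i]) :
  square_summable mu f -> square_summable nu g -> exists h, represents mu nu f g h.
Proof.
move=> sf sg.
have : forall p : X * Y, exists l, (exists l', ccvg (fun n => \sum_(i < n) f i p.1 * g i p.2) l') ->
    ccvg (fun n => \sum_(i < n) f i p.1 * g i p.2) l.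
  by move=> p; have [[l ul]|nl] := pselect (exists l', ccvg (fun n => \sum_(i < n) f i p.1 * g i p.2) l');
    [exists l | exists 0].
move=> /choice[h hp]; exists h; split => //.
apply: mnull_sub (mnull_ae (square_summable_ae sf) (square_summable_ae sg)).
move=> [x y] /= nh [fx gy]; apply: nh; apply: (hp (x, y)) => /=.
apply: (@ccvg_sum_sq _ (f ^~ x) (g ^~ y) (fine (sumsq f x) + fine (sumsq g y))) => n.
  by apply: le_trans (sumsq_partial n fx) _; rewrite lerDl fine_ge0// sumsq_ge0.
by apply: le_trans (sumsq_partial n gy) _; rewrite lerDr fine_ge0// sumsq_ge0.
Qed.

(** Together with its converse below, this replaces the function h by its partial sums, on which
    transport of f and g can be computed termwise. *)
Lemma represents_vanish f g h (E : set (X * Y)) : represents mu nu f g h ->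
  marginally_null mu nu
    [set p | E p /\ ~ ccvg (fun n => \sum_(i < n) f i p.1 * g i p.2) 0] ->
  vanishes_mae_on mu nu h E.
Proof.
move=> [_ _ n1] n2; apply: mnull_sub (mnullU n1 n2) => p [Ep hp] /=.
have [c|] := pselect (ccvg (fun n => \sum_(i < n) f i p.1 * g i p.2) (h p)); last by left.
right; split => // c0; apply: hp; exact: ccvg_unique c c0.
Qed.

Lemma vanish_represents f g h (E : set (X * Y)) : represents mu nu f g h ->
  vanishes_mae_on mu nu h E ->
  marginally_null mu nu
    [set p | E p /\ ~ ccvg (fun n => \sum_(i < n) f i p.1 * g i p.2) 0].
Proof.
move=> [_ _ n1] n2; apply: mnull_sub (mnullU n1 n2) => p [Ep hp] /=.
have [c|] := pselect (ccvg (fun n => \sum_(i < n) f i p.1 * g i p.2) (h p)); last by left.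
right; split; first exact: Ep.
by move=> h0; apply: hp; move: c; rewrite h0.
Qed.

(** This is the well-definedness of the pairing with T: representations of 0 pair to 0. It is not
    established for arbitrary bounded T but drawn from [kills_nbhd], with the whole space as
    neighbourhood. *)
Definition kills_zero T : Prop := forall f g h, represents mu nu f g h ->
  vanishes_mae_on mu nu h setT ->
  ccvg (fun n => \sum_(i < n) pairing nu T (f i) (g i)) 0.

Lemma pairing0l T g : bounded_operator mu nu T -> square_integrable nu g ->
  pairing nu T (fun=> 0) g = 0.
Proof.
move=> bT sg; have s0 := @square_integrable0 _ _ _ mu.
have := pairing_linearl 1 bT s0 s0 sg; rewrite !mul1r addr0.
by move=> /eqP; rewrite -subr_eq subrr eq_sym => /eqP.
Qed.

Lemma pairing_opp T f g : bounded_operator mu nu T ->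
  square_integrable mu f -> square_integrable nu g ->
  pairing nu T (fun x => - f x) g = - pairing nu T f g.
Proof.
move=> bT sf sg; have s0 := @square_integrable0 _ _ _ mu.
have := pairing_linearl (-1) bT sf s0 sg; rewrite pairing0l// addr0 mulN1r.
by under [X in pairing _ _ X]eq_fun do rewrite mulN1r addr0.
Qed.

(** The zero sequence pads three tensors to four, so that two balanced levels of interleaving
    suffice and every fourth partial sum is explicit. *)
Lemma interleave_sum4 (V : pzRingType) (K : (X -> R[i]) -> (Y -> R[i]) -> V)
    (f f' a : nat -> X -> R[i]) (g g' b : nat -> Y -> R[i]) n :
  K (fun=> 0) (fun=> 0) = 0 ->
  (forall i, K (fun x => - f' i x) (g' i) = - K (f' i) (g' i)) ->
  (forall i, K (fun x => - a i x) (b i) = - K (a i) (b i)) ->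
  \sum_(i < n.*2.*2) K
    (interleave (interleave f (fun=> fun=> 0)) (interleave (fun i x => - f' i x) (fun i x => - a i x)) i)
    (interleave (interleave g (fun=> fun=> 0)) (interleave g' b) i) =
  \sum_(i < n) K (f i) (g i) + -1 * \sum_(i < n) K (f' i) (g' i)
  + -1 * \sum_(i < n) K (a i) (b i).
Proof.
move=> K0 Kf' Ka; rewrite !interleave_sum.
under [X in _ + X + _ = _]eq_bigr do rewrite K0.
under [X in _ + (X + _) = _]eq_bigr do rewrite Kf'.
under [X in _ + (_ + X) = _]eq_bigr do rewrite Ka.
by rewrite !mulN1r -!sumrN big1_eq addr0 addrA.
Qed.

(* The four interleaved sequences f, 0, -f', -a represent the function 0. *)
Lemma represents_sub T f g h f' g' h' a b : bounded_operator mu nu T -> kills_zero T ->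
  represents mu nu f g h -> represents mu nu f' g' h' ->
  represents mu nu a b (fun p => h p - h' p) ->
  ccvg (fun n => \sum_(i < n) pairing nu T (f i) (g i)
     - \sum_(i < n) pairing nu T (f' i) (g' i) - \sum_(i < n) pairing nu T (a i) (b i)) 0.
Proof.
move=> bT kT [sf sg n1] [sf' sg' n2] [sa sb n3].
pose z (Z : Type) : nat -> Z -> R[i] := fun=> fun=> 0.
pose F := interleave (interleave f (z X)) (interleave (fun i x => - f' i x) (fun i x => - a i x)).
pose K := interleave (interleave g (z Y)) (interleave g' b).
have sF : square_summable mu F.
  by apply: interleave_square_summable; apply: interleave_square_summable => //;
    solve [exact: square_summable0 | exact: square_summable_opp].
have sK : square_summable nu K.
  by apply: interleave_square_summable; apply: interleave_square_summable => //;
    exact: square_summable0.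
have [k rk] := represents_exists sF sK.
have dle n : (n <= n.*2.*2)%N.
  by apply: (@leq_trans n.*2); rewrite -[X in (_ <= X)%N]addnn leq_addr.
have k0 : vanishes_mae_on mu nu k setT.
  have [_ _ n4] := rk.
  (* Off the four exceptional sets, the partial sums of [k] along multiples of 4 tend to h - h' - (h
     - h') = 0. *)
  apply: mnull_sub (mnullU (mnullU n1 n2) (mnullU n3 n4)) => -[x y] [_ kp] /=.
  have [c1|] := pselect (ccvg (fun n => \sum_(i < n) f i x * g i y) (h (x, y))); last by left; left.
  have [c2|] := pselect (ccvg (fun n => \sum_(i < n) f' i x * g' i y) (h' (x, y))); last by left; right.
  have [c3|] := pselect (ccvg (fun n => \sum_(i < n) a i x * b i y) (h (x, y) - h' (x, y))); last by right; left.
  have [c4|] := pselect (ccvg (fun n => \sum_(i < n) F i x * K i y) (k (x, y))); last by right; right.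
  exfalso; apply: kp; have c5 := ccvg_comp dle c4.
  have c6 := ccvgD (ccvgD c1 (@ccvgM _ _ _ (-1) c2)) (@ccvgM _ _ _ (-1) c3).
  rewrite (_ : k (x, y) = h (x, y) + -1 * h' (x, y) + -1 * (h (x, y) - h' (x, y))).
    by rewrite !mulN1r subrr.
  apply: (ccvg_unique c5); move: c6; congr ccvg; apply/funext => n.
  rewrite -(@interleave_sum4 _ (fun s t => s x * t y))//.
  - by rewrite mul0r.
  - by move=> i; rewrite mulNr.
  - by move=> i; rewrite mulNr.
have := ccvg_comp dle (kT _ _ _ rk k0); congr ccvg; apply/funext => n.
have [[sf2 _] [sg2 _]] := (sf, sg); have [[sf'2 _] [sg'2 _]] := (sf', sg').
have [[sa2 _] [sb2 _]] := (sa, sb).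
rewrite (@interleave_sum4 _ (pairing nu T)) ?mulN1r//.
- by apply: pairing0l => //; exact: square_integrable0.
- by move=> i; exact: pairing_opp.
- by move=> i; exact: pairing_opp.
Qed.

Lemma pairing_sum_bound T : bounded_operator mu nu T ->
  exists2 M : R, 0 <= M & forall f g n, square_summable mu f -> square_summable nu g ->
    ((normc (\sum_(i < n) pairing nu T (f i) (g i)))%:E <=
      M%:E * \sum_(i <oo) L2norm mu (f i) * L2norm nu (g i))%E.
Proof.
move=> bT; have [M M0 TM] := pairing_bound bT; exists M => // f g n [sf _] [sg _].
apply: (@le_trans _ _ (M%:E * \sum_(i < n) L2norm mu (f i) * L2norm nu (g i))%E).
  rewrite ge0_sume_distrr => [|i _]; last by rewrite mule_ge0// L2norm_ge0.
  apply: (@le_trans _ _ (\sum_(i < n) (normc (pairing nu T (f i) (g i)))%:E)%E).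
    rewrite sumEFin lee_fin.
    exact: (normc_sum n (fun i => pairing nu T (f i) (g i))).
  by apply: lee_sum => i _; exact: TM.
rewrite lee_wpmul2l ?lee_fin// -(big_mkord xpredT (fun i => L2norm mu (f i) * L2norm nu (g i))%E).
by apply: nneseries_lim_ge => i _ _; rewrite mule_ge0// L2norm_ge0.
Qed.

End representations.

(** * Pulling back functions and integrating along fibres *)

(** The algebra of [push_pull_adjoint]: [a] is the square root of [w] here and that of [r] in the
    next identity. *)
Lemma mulr_sqr_split (F : fieldType) (a b f g : F) : a != 0 ->
  f * (a * b * g) = a * a * (a^-1 * f * (b * g)).
Proof. by move=> a0; field. Qed.

Lemma mulr_sqr_split_scale (F : fieldType) (a c g : F) : a != 0 ->
  a * c * g = a * a * (a^-1 * g * c).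
Proof. by move=> a0; field. Qed.

Section fibre_operators.
Context {R : realType} dX dX1 (X : measurableType dX) (X1 : measurableType dX1).
Variables (mu : {measure set X -> \bar R}) (mu1 : {measure set X1 -> \bar R}).
Variable phi : X -> X1.
Variables (w : X -> R) (r : X1 -> R) (P : probability R R) (G : X1 * R -> X).
Notation Re := complex.Re.
Notation Im := complex.Im.

(* [pull f1 x] is the junk value 0 where [r (phi x) = 0], a null set by [density_zero]. *)
Definition pull (f1 : X1 -> R[i]) (x : X) : R[i] :=
  (Num.sqrt (w x) / Num.sqrt (r (phi x)))%:C * f1 (phi x).

(** Dividing by the square root of [w] writes |f|^2 as |fibre f|^2 times [w], the form that
    [disintegrates] integrates. *)
Definition fibre (f : X -> R[i]) (z : X1 * R) : R[i] :=
  ((Num.sqrt (w (G z)))^-1)%:C * f (G z).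

(** The square root of [r] makes this the transpose of [pull], and also makes it vanish at points
    whose fibre carries no mass. *)
Definition push (f : X -> R[i]) (x1 : X1) : R[i] :=
  (Num.sqrt (r x1))%:C * cintegral P (fun u => fibre f (x1, u)).

Hypothesis mphi : measurable_fun setT phi.
Hypothesis H : disintegrates mu mu1 phi w r P G.

Let mw : measurable_fun setT w. Proof. by case: H. Qed.
Let w0 x : 0 < w x. Proof. by case: H => _ /(_ x)/andP[]. Qed.
Let mr : measurable_fun setT r. Proof. by case: H. Qed.
Let r0 x : 0 <= r x. Proof. by case: H. Qed.
Let mG : measurable_fun setT G. Proof. by case: H => _ _ _ _ []. Qed.
Let Hdis (F : X1 * X -> \bar R) : measurable_fun setT F -> (forall z, 0 <= F z)%E ->
  (\int[mu]_x (F (phi x, x) * (w x)%:E) =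
   \int[mu1]_x (\int[P]_u F (x, G (x, u)) * (r x)%:E))%E.
Proof. by case: H => _ _ _ _ [_]; exact. Qed.

Let msw : measurable_fun setT (fun x => Num.sqrt (w x)).
Proof. by apply: measurable_sqrt => // x; rewrite ltW. Qed.

Let msr : measurable_fun setT (fun x => Num.sqrt (r x)).
Proof. exact: measurable_sqrt. Qed.

Let misr : measurable_fun setT (fun x => (Num.sqrt (r x))^-1).
Proof. by apply: measurable_inv => // x; exact: sqrtr_ge0. Qed.

Let misw : measurable_fun setT (fun x => (Num.sqrt (w x))^-1).
Proof. by apply: measurable_inv => // x; exact: sqrtr_ge0. Qed.

Lemma cmeasurable_pull f1 : cmeasurable f1 -> cmeasurable (pull f1).
Proof.
move=> mf1; apply: cmeasurableZ; last exact: cmeasurable_comp.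
by apply: measurable_funM => //; exact: (measurableT_comp misr).
Qed.

Lemma pull_linear (a : R[i]) f1 g1 x :
  pull (fun x => a * f1 x + g1 x) x = a * pull f1 x + pull g1 x.
Proof. by rewrite /pull mulrDr mulrCA. Qed.

Lemma disintegration_base (h : X1 -> \bar R) : measurable_fun setT h ->
  (forall x, 0 <= h x)%E ->
  (\int[mu]_x (h (phi x) * (w x)%:E) = \int[mu1]_x (h x * (r x)%:E))%E.
Proof.
move=> mh h0; pose F (z : X1 * X) := h z.1.
have mF : measurable_fun setT F by exact: (measurableT_comp mh (@measurable_fst _ _ X1 X)).
rewrite (Hdis mF) => [|z]; last exact: h0.
apply: eq_integral => x _; congr (_ * _)%E; rewrite /F/= integral_cst//.
by rewrite [X in (_ * X)%E](probability_setT P) mule1.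
Qed.

(** Only an inequality, because the part of [f1] living where [r] vanishes is lost. *)
Lemma sqnorm_pull_le f1 : cmeasurable f1 -> (sqnorm mu (pull f1) <= sqnorm mu1 f1)%E.
Proof.
move=> mf1.
pose h x : \bar R := (normc (f1 x) ^+ 2 * (r x)^-1)%:E.
have mh : measurable_fun setT h.
  apply/measurable_EFinP; apply: measurable_funM; last exact: measurable_inv.
  by apply: measurable_funX; exact: measurable_normc.
have h0 x : (0 <= h x)%E by rewrite lee_fin mulr_ge0 ?sqr_ge0// invr_ge0.
have -> : sqnorm mu (pull f1) = (\int[mu1]_x (h x * (r x)%:E))%E.
  apply: etrans (disintegration_base mh h0).
  apply: eq_integral => x _; rewrite /h/= -EFinM; congr EFin.
  rewrite /pull normcZ exprMn real_normK ?num_real//.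
  rewrite expr_div_n !sqr_sqrtr ?(ltW (w0 _)) ?r0//.
  by rewrite mulrC mulrA [RHS]mulrAC.
rewrite /sqnorm; apply: ge0_le_integral => //.
- by move=> x _; apply: mule_ge0; rewrite ?h0// lee_fin.
- by apply: emeasurable_funM => //; exact/measurable_EFinP.
- exact: measurable_normc2.
- move=> x _; rewrite /h/= -EFinM lee_fin.
  have [->|rn0] := eqVneq (r x) 0; first by rewrite mulr0 sqr_ge0.
  by rewrite -mulrA mulVf// mulr1.
Qed.

Lemma square_integrable_pull f1 : square_integrable mu1 f1 -> square_integrable mu (pull f1).
Proof.
move=> /square_integrableP[mf ff]; apply/square_integrableP; split.
  exact: cmeasurable_pull.
exact: le_lt_trans (sqnorm_pull_le mf) ff.
Qed.

Lemma cmeasurable_fibre f : cmeasurable f -> cmeasurable (fibre f).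
Proof.
move=> mf; apply: cmeasurableZ; last exact: cmeasurable_comp.
exact: (measurableT_comp misw).
Qed.

Lemma cmeasurable_fibre1 f x1 : cmeasurable f -> cmeasurable (fun u => fibre f (x1, u)).
Proof.
move=> mf; apply: (@cmeasurable_comp _ _ _ _ _ (pair x1) (fibre f)).
  exact: measurable_pair1.
exact: cmeasurable_fibre.
Qed.

Lemma sqnorm_fibre f : cmeasurable f ->
  (sqnorm mu f = \int[mu1]_x1 (sqnorm P (fun u => fibre f (x1, u)) * (r x1)%:E))%E.
Proof.
move=> mf.
pose F (z : X1 * X) : \bar R := (normc (f z.2) ^+ 2 * (w z.2)^-1)%:E.
have mF : measurable_fun setT F.
  have mk : measurable_fun setT (fun x => normc (f x) ^+ 2 * (w x)^-1).
    apply: measurable_funM; last by apply: measurable_inv => // x; rewrite ltW.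
    by apply: measurable_funX; exact: measurable_normc.
  by apply/measurable_EFinP; exact: (measurableT_comp mk (@measurable_snd _ _ X1 X)).
have F0 z : (0 <= F z)%E by rewrite lee_fin mulr_ge0 ?sqr_ge0// invr_ge0 ltW.
transitivity (\int[mu]_x (F (phi x, x) * (w x)%:E))%E.
  by apply: eq_integral => x _; rewrite /F/= -EFinM -mulrA mulVf ?mulr1// gt_eqF.
apply: etrans (Hdis mF F0) _; apply: eq_integral => x1 _; congr (_ * _)%E.
apply: eq_integral => u _; rewrite /F /fibre/= normcZ exprMn real_normK ?num_real//.
by rewrite exprVn sqr_sqrtr ?ltW// mulrC.
Qed.

Lemma fibre_sqnorm_measurable f : cmeasurable f ->
  measurable_fun setT (fun x1 => sqnorm P (fun u => fibre f (x1, u))).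
Proof.
move=> mf; apply: (measurable_fun_fubini_tonelli_F (m2 := P)
  (fun z : X1 * R => (normc (fibre f z) ^+ 2)%:E)) => //.
  by apply: measurable_normc2; exact: cmeasurable_fibre.
by move=> z; rewrite lee_fin sqr_ge0.
Qed.

(* The fibre over [x1] carries no mass where [r] vanishes, so every fibrewise
   statement excludes those points. *)
Lemma ae_fibre_finite (F : X1 -> \bar R) : measurable_fun setT F -> (forall x, 0 <= F x)%E ->
  (\int[mu1]_x (F x * (r x)%:E) < +oo)%E ->
  {ae mu1, forall x, r x = 0 \/ (F x < +oo)%E}.
Proof.
move=> mF F0 fin.
have : {ae mu1, forall x, setT x -> (F x * (r x)%:E)%E \is a fin_num}.
  apply: integrable_ae => //; apply/integrableP; split.
    by apply: emeasurable_funM => //; exact/measurable_EFinP.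
  by under eq_integral do rewrite gee0_abs ?mule_ge0 ?lee_fin//.
apply: filterS => x /(_ Logic.I) fx; have [|rn0] := eqVneq (r x) 0; first by left.
right; rewrite ltey; apply: contraTneq fx => ->.
by rewrite gt0_mulye// lte_fin lt_def rn0/=.
Qed.

Lemma ae_fibre_L2 f : square_integrable mu f ->
  {ae mu1, forall x1, r x1 = 0 \/ (sqnorm P (fun u => fibre f (x1, u)) < +oo)%E}.
Proof.
move=> /square_integrableP[mf ff]; apply: ae_fibre_finite.
- exact: fibre_sqnorm_measurable.
- by move=> x; exact: sqnorm_ge0.
- by rewrite -sqnorm_fibre.
Qed.

Lemma measurable_fibre_Rintegral (k : X1 * R -> R) : measurable_fun setT k ->
  measurable_fun setT (fun x1 => \int[P]_u k (x1, u)).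
Proof.
move=> mk; apply/measurable_EFinP.
have mk1 x1 : measurable_fun setT (fun u => (k (x1, u))%:E).
  by apply/measurable_EFinP; apply: (measurableT_comp mk); exact: measurable_pair1.
rewrite (_ : _ \o _ = EFin \o (fun x1 => fine (\int[P]_u ((EFin \o k)^\+ (x1, u)) - \int[P]_u ((EFin \o k)^\- (x1, u)))%E)); last first.
  apply/funext => x1; rewrite /= /Rintegral; congr (fine _)%:E.
  apply: etrans (integralE _ _ _) _.
  by congr (_ - _)%E; apply: eq_integral => u _; rewrite ?funeposE ?funenegE.
apply/measurable_EFinP; apply: (measurableT_comp (@fine_measurable R setT measurableT)).
have mk' : measurable_fun setT (EFin \o k) by exact/measurable_EFinP.
apply: emeasurable_funB.
  apply: (measurable_fun_fubini_tonelli_F (m2 := P) ((EFin \o k)^\+)%E) => //.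
  exact: measurable_funepos.
apply: (measurable_fun_fubini_tonelli_F (m2 := P) ((EFin \o k)^\-)%E) => //.
exact: measurable_funeneg.
Qed.

Lemma cmeasurable_push f : cmeasurable f -> cmeasurable (push f).
Proof.
move=> mf; have [m1 m2] := cmeasurable_fibre mf.
apply: cmeasurableZ => //; split.
  exact: (@measurable_fibre_Rintegral (fun z => Re (fibre f z))).
exact: (@measurable_fibre_Rintegral (fun z => Im (fibre f z))).
Qed.

Lemma sqnorm_push_le f : square_integrable mu f ->
  (sqnorm mu1 (push f) <= sqnorm mu f)%E.
Proof.
move=> sf; have /square_integrableP[mf ff] := sf.
rewrite sqnorm_fibre//; apply: ae_ge0_le_integral => //.
- by move=> x _; rewrite lee_fin sqr_ge0.
- by apply: measurable_normc2; exact: cmeasurable_push.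
- by move=> x _; rewrite mule_ge0 ?lee_fin// sqnorm_ge0.
- apply: emeasurable_funM; last exact/measurable_EFinP.
  exact: fibre_sqnorm_measurable.
apply: filterS (ae_fibre_L2 sf) => x1 good _.
rewrite /push normcZ exprMn real_normK ?num_real// sqr_sqrtr// EFinM muleC.
case: good => [->|fin]; first by rewrite !mule0.
rewrite lee_wpmul2r ?lee_fin//; apply: sqr_cintegral_le => //.
exact: cmeasurable_fibre1.
Qed.

Lemma square_integrable_push f : square_integrable mu f -> square_integrable mu1 (push f).
Proof.
move=> sf; have /square_integrableP[mf ff] := sf; apply/square_integrableP; split.
  exact: cmeasurable_push.
exact: le_lt_trans (sqnorm_push_le sf) ff.
Qed.

Lemma push_linear (a : R[i]) f g : square_integrable mu f -> square_integrable mu g ->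
  {ae mu1, forall x1, push (fun x => a * f x + g x) x1 = a * push f x1 + push g x1}.
Proof.
move=> sf sg; have gf := ae_fibre_L2 sf; have gg := ae_fibre_L2 sg.
have mf := square_integrable_cmeasurable sf.
have mg := square_integrable_cmeasurable sg.
apply: filterS2 gf gg => x1 [r10 _|ff]; first by rewrite /push r10 sqrtr0 !mul0r mulr0 addr0.
move=> [r10|fg]; first by rewrite /push r10 sqrtr0 !mul0r mulr0 addr0.
have i1 := probability_cintegrable (cmeasurable_fibre1 x1 mf) ff.
have i2 := probability_cintegrable (cmeasurable_fibre1 x1 mg) fg.
rewrite /push mulrCA -mulrDr; congr (_ * _).
rewrite -cintegralZ// -cintegralD//; last exact: cintegrableZ.
by congr cintegral; apply/funext => u; rewrite /fibre mulrDr mulrCA.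
Qed.

Let mpx : measurable_fun setT (fun x => (phi x, x)).
Proof. by apply/measurable_fun_pairP; split => //; exact: measurable_id. Qed.

Let mxG : measurable_fun setT (fun z : X1 * R => (z.1, G z)).
Proof. by apply/measurable_fun_pairP; split => //; exact: measurable_fst. Qed.

Let measurable_fibre_integral (F : X1 * X -> \bar R) : measurable_fun setT F ->
  (forall z, 0 <= F z)%E ->
  measurable_fun setT (fun x => \int[P]_u F (x, G (x, u)))%E.
Proof.
move=> mF F0.
apply: (measurable_fun_fubini_tonelli_F (m2 := P) (fun z : X1 * R => F (z.1, G z))) => //.
exact: (measurableT_comp mF mxG).
Qed.

(** Positive and negative parts disintegrate separately. Their fibre integrals can be subtracted at
    almost every point with nonzero density, since there both are finite; at the other points the
    factor [r] kills both sides. *)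
Lemma disintegration_Rintegral (F : X1 * X -> R) : measurable_fun setT F ->
  mu.-integrable setT (EFin \o (fun x => F (phi x, x) * w x)) ->
  \int[mu]_x (F (phi x, x) * w x) = \int[mu1]_x (\int[P]_u F (x, G (x, u)) * r x).
Proof.
move=> mF iF.
pose Fw := EFin \o (fun x => F (phi x, x) * w x).
pose Fp := ((EFin \o F)^\+)%E; pose Fn := ((EFin \o F)^\-)%E.
have mF' : measurable_fun setT (EFin \o F) by exact/measurable_EFinP.
have mFp : measurable_fun setT Fp by exact: measurable_funepos.
have mFn : measurable_fun setT Fn by exact: measurable_funeneg.
have Fp0 z : (0 <= Fp z)%E by exact: funepos_ge0.
have Fn0 z : (0 <= Fn z)%E by exact: funeneg_ge0.
have wE0 x : (0 <= (w x)%:E)%E by rewrite lee_fin ltW.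
have pE x : (Fw^\+ x = Fp (phi x, x) * (w x)%:E)%E.
  by rewrite /Fp !funeposE maxe_pMl ?lee_fin ?ltW// mul0e.
have nE x : (Fw^\- x = Fn (phi x, x) * (w x)%:E)%E.
  by rewrite /Fn !funenegE maxe_pMl ?lee_fin ?ltW// mul0e mulNe.
pose ap x := (\int[P]_u Fp (x, G (x, u)) * (r x)%:E)%E.
pose an x := (\int[P]_u Fn (x, G (x, u)) * (r x)%:E)%E.
have ap0 x : (0 <= ap x)%E by rewrite mule_ge0 ?lee_fin//; exact: integral_ge0.
have an0 x : (0 <= an x)%E by rewrite mule_ge0 ?lee_fin//; exact: integral_ge0.
have map : measurable_fun setT ap.
  by apply: emeasurable_funM; [exact: measurable_fibre_integral|exact/measurable_EFinP].
have man : measurable_fun setT an.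
  by apply: emeasurable_funM; [exact: measurable_fibre_integral|exact/measurable_EFinP].
have IP : (\int[mu]_x Fw^\+ x = \int[mu1]_x ap x)%E.
  by rewrite /ap -(Hdis mFp Fp0); apply: eq_integral => x _; exact: pE.
have IN : (\int[mu]_x Fw^\- x = \int[mu1]_x an x)%E.
  by rewrite /an -(Hdis mFn Fn0); apply: eq_integral => x _; exact: nE.
have fp : (\int[mu1]_x ap x < +oo)%E by rewrite -IP integral_funepos_lt_pinfty.
have fn : (\int[mu1]_x an x < +oo)%E by rewrite -IN integral_funeneg_lt_pinfty.
have iap : mu1.-integrable setT ap.
  by apply/integrableP; split => //; under eq_integral do rewrite gee0_abs//.
have ian : mu1.-integrable setT an.
  by apply/integrableP; split => //; under eq_integral do rewrite gee0_abs//.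
have gp := ae_fibre_finite (measurable_fibre_integral mFp Fp0)
  (fun x => integral_ge0 _ (fun u _ => Fp0 (x, G (x, u)))) fp.
have gn := ae_fibre_finite (measurable_fibre_integral mFn Fn0)
  (fun x => integral_ge0 _ (fun u _ => Fn0 (x, G (x, u)))) fn.
rewrite /Rintegral; congr fine; rewrite integralE IP IN -integralB//.
apply: ae_eq_integral => //.
- exact: emeasurable_funB.
- apply/measurable_EFinP; apply: measurable_funM => //.
  apply: (@measurable_fibre_Rintegral (fun z => F (z.1, G z))).
  exact: (measurableT_comp mF mxG).
apply: filterS2 gp gn => x gpx gnx _.
have [rx0|rn0] := eqVneq (r x) 0; first by rewrite /ap /an rx0 !mule0 sube0 mulr0.
case: gpx => [/eqP|gpx]; first by rewrite (negbTE rn0).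
case: gnx => [/eqP|gnx]; first by rewrite (negbTE rn0).
rewrite EFinM /ap /an -muleBl//; last first.
  by rewrite fin_num_adde_defr// ge0_fin_numE//; exact: integral_ge0.
have pnE : (\int[P]_u (F (x, G (x, u)))%:E =
    \int[P]_u Fp (x, G (x, u)) - \int[P]_u Fn (x, G (x, u)))%E.
  rewrite integralE; congr (_ - _)%E; apply: eq_integral => u _;
  by rewrite /Fp /Fn ?funeposE ?funenegE.
congr (_ * _)%E; rewrite /Rintegral pnE fineK//.
rewrite fin_numB !ge0_fin_numE ?gpx//; exact: integral_ge0.
Qed.

Lemma push_pull_adjoint f g1 : square_integrable mu f -> square_integrable mu1 g1 ->
  cintegral mu1 (fun x1 => push f x1 * g1 x1) = cintegral mu (fun x => f x * pull g1 x).
Proof.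
move=> sf sg.
have mf := square_integrable_cmeasurable sf; have mg := square_integrable_cmeasurable sg.
have sp := square_integrable_pull sg.
have spu := square_integrable_push sf.
(* A common integrand: both sides of the identity are integrals of [w K] over X, the left one after
   disintegration. *)
pose K (z : X1 * X) : R[i] := (((Num.sqrt (w z.2))^-1)%:C * f z.2) *
  (((Num.sqrt (r z.1))^-1)%:C * g1 z.1).
have mK : cmeasurable K.
  apply: cmeasurableM.
    apply: (cmeasurable_comp (@measurable_snd _ _ X1 X)
      (f := fun x => ((Num.sqrt (w x))^-1)%:C * f x)).
    exact: cmeasurableZ.
  apply: (cmeasurable_comp (@measurable_fst _ _ X1 X)
    (f := fun x => ((Num.sqrt (r x))^-1)%:C * g1 x)).
  exact: cmeasurableZ.
have KE x : f x * pull g1 x = (w x)%:C * K (phi x, x).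
  rewrite /K /pull /=.
  have -> : (w x)%:C = (Num.sqrt (w x))%:C * (Num.sqrt (w x))%:C :> R[i].
    by rewrite -rmorphM -expr2 sqr_sqrtr// ltW.
  have sn0 : (Num.sqrt (w x))%:C != 0 :> R[i].
    by rewrite (inj_eq (@complexI R)) gt_eqF// sqrtr_gt0.
  rewrite rmorphM /=; set b := ((Num.sqrt (r (phi x)))^-1)%:C.
  have -> : ((Num.sqrt (w x))^-1)%:C = ((Num.sqrt (w x))%:C)^-1 :> R[i] by rewrite fmorphV.
  exact: mulr_sqr_split.
have fibreE x1 : r x1 = 0 \/ (sqnorm P (fun u => fibre f (x1, u)) < +oo)%E ->
    push f x1 * g1 x1 = (r x1)%:C * cintegral P (fun u => K (x1, G (x1, u))).
  have [r10 _|rn0] := eqVneq (r x1) 0.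
    by rewrite /push r10 sqrtr0 !mul0r.
  case=> [/eqP|fin]; first by rewrite (negbTE rn0).
  have ifi := probability_cintegrable (cmeasurable_fibre1 x1 mf) fin.
  have -> : (fun u => K (x1, G (x1, u))) =
      (fun u => (((Num.sqrt (r x1))^-1)%:C * g1 x1) * fibre f (x1, u)).
    by apply/funext => u; rewrite /K /fibre mulrC.
  rewrite cintegralZ// /push.
  have -> : (r x1)%:C = (Num.sqrt (r x1))%:C * (Num.sqrt (r x1))%:C :> R[i].
    by rewrite -rmorphM -expr2 sqr_sqrtr.
  have sn0 : (Num.sqrt (r x1))%:C != 0 :> R[i].
    by rewrite (inj_eq (@complexI R)) gt_eqF// sqrtr_gt0 lt_def rn0 r0.
  have -> : ((Num.sqrt (r x1))^-1)%:C = ((Num.sqrt (r x1))%:C)^-1 :> R[i] by rewrite fmorphV.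
  exact: mulr_sqr_split_scale.
have aeE := ae_fibre_L2 sf.
have [iR iI] : mu.-integrable setT (EFin \o (fun x => Re (K (phi x, x)) * w x)) /\
    mu.-integrable setT (EFin \o (fun x => Im (K (phi x, x)) * w x)).
  have im := square_integrable_mul sf sp.
  split.
    have := cintegrable_Re im; congr (is_true (integrable _ _ _)).
    by apply/funext => x /=; rewrite KE cReZ mulrC.
  have := cintegrable_Im im; congr (is_true (integrable _ _ _)).
  by apply/funext => x /=; rewrite KE cImZ mulrC.
have [mKR mKI] := mK.
have mKG : cmeasurable (fun z : X1 * R => K (z.1, G z)) by exact: (cmeasurable_comp mxG mK).
have [mKGR mKGI] := mKG.
have ER := disintegration_Rintegral mKR iR.
have EI := disintegration_Rintegral mKI iI.
transitivity (cintegral mu1 (fun x1 => (r x1)%:C * cintegral P (fun u => K (x1, G (x1, u))))).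
  apply: ae_eq_cintegral.
  - by apply: cmeasurableM => //; exact: square_integrable_cmeasurable spu.
  - apply: cmeasurableZ => //; split.
      exact: (@measurable_fibre_Rintegral (fun z => Re (K (z.1, G z)))).
    exact: (@measurable_fibre_Rintegral (fun z => Im (K (z.1, G z)))).
  - by apply: filterS aeE => x1; exact: fibreE.
apply: complex_eq.
  transitivity (\int[mu1]_x1 (\int[P]_u Re (K (x1, G (x1, u))) * r x1)).
    by apply: eq_Rintegral => x1 _; rewrite cReZ mulrC.
  by rewrite -ER; apply: eq_Rintegral => x _; rewrite KE cReZ mulrC.
transitivity (\int[mu1]_x1 (\int[P]_u Im (K (x1, G (x1, u))) * r x1)).
  by apply: eq_Rintegral => x1 _; rewrite cImZ mulrC.
by rewrite -EI; apply: eq_Rintegral => x _; rewrite KE cImZ mulrC.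
Qed.

(** Disintegrate the indicator of Q: a nonnegative function with integral 0 vanishes almost
    everywhere, first over X1 and then on the fibre. *)
Lemma ae_fibre (Q : set (X1 * X)) : measurable Q ->
  {ae mu, forall x, ~ Q (phi x, x)} ->
  {ae mu1, forall x1, r x1 = 0 \/ {ae P, forall u, ~ Q (x1, G (x1, u))}}.
Proof.
move=> mQ aeQ.
pose F z : \bar R := (\1_Q z)%:E.
have mF : measurable_fun setT F by apply/measurable_EFinP; exact: measurable_indic.
have F0 z : (0 <= F z)%E by rewrite lee_fin.
have I0 : (\int[mu1]_x (\int[P]_u F (x, G (x, u)) * (r x)%:E) = 0)%E.
  apply: etrans (esym (Hdis mF F0)) _.
  rewrite -(@integral0 _ _ _ mu setT); apply: ge0_ae_eq_integral => //.
  - apply: emeasurable_funM; last exact/measurable_EFinP.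
    exact: (measurableT_comp mF mpx).
  - by move=> x _; rewrite mule_ge0// lee_fin ltW.
  - apply: filterS aeQ => x nQ _; rewrite /F indicE memNset ?mul0e//.
have mI := measurable_fibre_integral mF F0.
have I0' x : (0 <= \int[P]_u F (x, G (x, u)))%E by exact: integral_ge0.
have : ae_eq mu1 setT (fun x => \int[P]_u F (x, G (x, u)) * (r x)%:E)%E (cst 0%E).
  apply/ae_eq_integral_abs => //.
    by apply: emeasurable_funM => //; exact/measurable_EFinP.
  rewrite -I0; apply: eq_integral => x _.
  by rewrite gee0_abs// mule_ge0// lee_fin.
apply: filterS => x /(_ Logic.I) /eqP; rewrite mule_eq0 => /orP[/eqP i0|]; last first.
  by rewrite eqe => /eqP; left.
right; have mFx : measurable_fun setT (fun u => F (x, G (x, u))).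
  have mFG : measurable_fun setT (fun z : X1 * R => F (z.1, G z)) := measurableT_comp mF mxG.
  exact: (measurableT_comp mFG (measurable_pair1 x)).
have : ae_eq P setT (fun u => F (x, G (x, u))) (cst 0%E).
  apply/ae_eq_integral_abs => //; rewrite -i0; apply: eq_integral => u _.
  by rewrite gee0_abs.
apply: filterS => u /(_ Logic.I) Fu Qu; move: Fu.
by rewrite /F indicE mem_set// => /eqP; rewrite eqe oner_eq0.
Qed.

Lemma measurable_density_zero : measurable [set x1 | r x1 = 0].
Proof.
rewrite -[X in measurable X]setTI.
exact: (mr measurableT (measurable_set1 (0 : R))).
Qed.

(** The set where [r] vanishes has no mass for the image of [w mu], and [w] is positive, so its
    preimage is null for [mu] itself. *)
Lemma density_zero : mu (phi @^-1` [set x1 | r x1 = 0]) = 0%E.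
Proof.
have mZ := measurable_density_zero.
pose h x1 : \bar R := (\1_[set x1 | r x1 = 0] x1)%:E.
have mh : measurable_fun setT h by apply/measurable_EFinP; exact: measurable_indic.
have h0 x : (0 <= h x)%E by rewrite lee_fin.
have := disintegration_base mh h0; rewrite [X in _ = X](_ : _ = 0%E) => [I0|]; last first.
  apply: integral0_eq => x1 _; have [r10|rn0] := eqVneq (r x1) 0; first by rewrite r10 mule0.
  by rewrite /h indicE memNset ?mul0e//= => /eqP; rewrite (negbTE rn0).
have mhw : measurable_fun setT (fun x => h (phi x) * (w x)%:E)%E.
  apply: emeasurable_funM; last exact/measurable_EFinP.
  exact: (measurableT_comp mh mphi).
have hw0 x : (0 <= h (phi x) * (w x)%:E)%E.
  by rewrite mule_ge0// lee_fin ltW.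
have [N [mN N0 sN]] : ae_eq mu setT (fun x => h (phi x) * (w x)%:E)%E (cst 0%E).
  apply/ae_eq_integral_abs => //; rewrite -I0; apply: eq_integral => x _.
  by rewrite gee0_abs.
apply: (subset_measure0 (B := N)) => //.
  by rewrite -[_ @^-1` _]setTI; exact: mphi.
move=> x rx; apply: sN => /= /(_ Logic.I).
rewrite /h indicE mem_set// mul1e => /eqP; rewrite eqe => /eqP wx.
by have := w0 x; rewrite wx ltxx.
Qed.

(** That [G] maps into the fibres is not part of [disintegrates]; it follows by applying [ae_fibre]
    to the set of (x1, x) with phi x <> x1. This set is measurable because an injective real code on
    X1 exhibits its complement as the zero set of a measurable function. *)
Lemma ae_fibre_section : standard_measure mu1 ->
  {ae mu1, forall x1, r x1 = 0 \/ {ae P, forall u, phi (G (x1, u)) = x1}}.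
Proof.
move=> /standard_separating[U [mU sepU]].
pose t z : R := ternary U (phi z.2) - ternary U z.1.
pose Q : set (X1 * X) := ~` (t @^-1` [set 0]).
have mt : measurable_fun setT t.
  apply: measurable_funB.
    apply: (measurableT_comp (measurable_ternary mU)).
    by apply: (measurableT_comp mphi); exact: measurable_snd.
  by apply: (measurableT_comp (measurable_ternary mU)); exact: measurable_fst.
have mQ : measurable Q.
  by apply: measurableC; rewrite -[_ @^-1` _]setTI; exact: mt.
have : {ae mu, forall x, ~ Q (phi x, x)}.
  by apply: aeW => x nQ; apply: nQ; rewrite /t/= subrr.
move=> /(ae_fibre mQ); apply: filterS => x1 [|ae1]; [by left|right].
apply: filterS ae1 => u /contrapT /eqP; rewrite subr_eq0 => /eqP tE.
by apply: sepU => n; exact: (ternary_inj tE n).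
Qed.

Lemma ae_fibre_null (N : set X) : measurable N -> mu N = 0%E ->
  {ae mu1, forall x1, r x1 = 0 \/ {ae P, forall u, ~ N (G (x1, u))}}.
Proof.
move=> mN N0.
have mQ : measurable (@snd X1 X @^-1` N).
  by rewrite -[_ @^-1` _]setTI; exact: measurable_snd.
apply: (ae_fibre mQ); exists N; split => // x /=.
by move=> /contrapT.
Qed.

Lemma cintegral_probability_cst (c : R[i]) : cintegral P (fun=> c) = c.
Proof.
by apply: complex_eq; rewrite /= /Rintegral probability_integral_cst.
Qed.

(** On the fibre over x1 the weighted pull is constant, equal to f1 x1 divided by the square root of
    r x1; averaging keeps it and [push] restores the root. *)
Lemma push_pull f1 : standard_measure mu1 -> cmeasurable f1 ->
  {ae mu1, forall x1, r x1 = 0 \/ push (pull f1) x1 = f1 x1}.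
Proof.
move=> smu1 mf1; apply: filterS (ae_fibre_section smu1) => x1.
have [->|rn0] := eqVneq (r x1) 0; first by left.
move=> [/eqP|sec]; first by rewrite (negbTE rn0).
right; have sr0 : Num.sqrt (r x1) != 0 by rewrite gt_eqF// sqrtr_gt0 lt_def rn0 r0.
rewrite /push (@ae_eq_cintegral _ _ _ _ _ (fun=> ((Num.sqrt (r x1))^-1)%:C * f1 x1)).
- by rewrite cintegral_probability_cst mulrA -rmorphM/= mulfV// mul1r.
- apply: cmeasurable_fibre1; exact: cmeasurable_pull.
- exact: cmeasurable_cst.
apply: filterS sec => u sec.
rewrite /fibre /pull sec mulrA -rmorphM/=; congr (_%:C * _).
by rewrite mulrA mulVf ?mul1r// gt_eqF// sqrtr_gt0.
Qed.

Lemma pull_contraction : L2contraction mu1 mu pull.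
Proof.
split.
- exact: square_integrable_pull.
- by move=> a f g _ _; apply: aeW => x; exact: pull_linear.
- move=> f sf; have mf := square_integrable_cmeasurable sf.
  by apply: L2norm_le; exact: (sqnorm_pull_le mf).
Qed.

Lemma push_contraction : L2contraction mu mu1 push.
Proof.
split.
- exact: square_integrable_push.
- exact: push_linear.
- by move=> f sf; apply: L2norm_le; exact: sqnorm_push_le.
Qed.

Lemma ae_fibre_sumsq (f : nat -> X -> R[i]) : square_summable mu f ->
  {ae mu1, forall x1, r x1 = 0 \/
    (\int[P]_u sumsq (fun i u => fibre (f i) (x1, u)) u < +oo)%E}.
Proof.
move=> /square_summableP[sf ff].
have mf i := square_integrable_cmeasurable (sf i).
have mff i x1 := cmeasurable_fibre1 x1 (mf i).
have intE x1 : (\int[P]_u sumsq (fun i u => fibre (f i) (x1, u)) u =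
    \sum_(i <oo) sqnorm P (fun u => fibre (f i) (x1, u)))%E.
  by apply: integral_sumsq => i; exact: mff.
have mi i := fibre_sqnorm_measurable (mf i).
have s0 i x1 : (0 <= sqnorm P (fun u => fibre (f i) (x1, u)))%E by exact: sqnorm_ge0.
apply: ae_fibre_finite.
- rewrite (_ : (fun x1 => _) = fun x1 => (\sum_(i <oo) sqnorm P (fun u => fibre (f i) (x1, u)))%E).
    by apply: ge0_emeasurable_sum => // i x _ _; exact: s0.
  by apply/funext => x1; rewrite intE.
- by move=> x1; apply: integral_ge0 => u _; exact: sumsq_ge0.
apply: le_lt_trans ff; rewrite integral_sumsq// le_eqVlt; apply/orP; left; apply/eqP.
transitivity (\int[mu1]_x1 \sum_(i <oo) (sqnorm P (fun u => fibre (f i) (x1, u)) * (r x1)%:E))%E.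
  apply: eq_integral => x1 _; rewrite intE muleC -nneseriesZl//.
  by apply: eq_eseriesr => i _; rewrite muleC.
rewrite integral_nneseries//.
- by apply: eq_eseriesr => i _; rewrite sqnorm_fibre.
- by move=> i; apply: emeasurable_funM => //; exact/measurable_EFinP.
- by move=> i x _; rewrite mule_ge0// lee_fin.
Qed.

End fibre_operators.

(** * Annihilating functions that vanish near a set *)

Section approximation.
Context {R : realType}.

Lemma ccvg0_approx (u : nat -> R[i]) :
  (forall e : R, 0 < e -> exists2 v, ccvg v 0 & forall n, normc (u n - v n) <= e) ->
  ccvg u 0.
Proof.
move=> uv; apply/ccvg0P/cvgr0Pnorm_lt => e e0.
have [v /ccvg0P/cvgr0Pnorm_lt v0 uve] := uv _ (divr_gt0 e0 (ltr0Sn R 1)).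
have := v0 _ (divr_gt0 e0 (ltr0Sn R 1)); apply: filterS => n.
rewrite !ger0_norm ?normc_ge0// => vn.
have -> : u n = (u n - v n) + v n by rewrite subrK.
apply: le_lt_trans (le_normcD _ _) _.
by rewrite [ltRHS]splitr; apply: ler_ltD.
Qed.

(** Weighted inequality between arithmetic and geometric means. The free parameter lets a small
    factor be traded against one that is merely bounded. *)
Lemma L2norm_series_le dX dY (X : measurableType dX) (Y : measurableType dY)
    (mu : {measure set X -> \bar R}) (nu : {measure set Y -> \bar R}) f g (t : R) : 0 < t ->
  square_summable mu f -> square_summable nu g ->
  (\sum_(i <oo) L2norm mu (f i) * L2norm nu (g i) <=
   t^-1%:E * \int[mu]_x sumsq f x + t%:E * \int[nu]_y sumsq g y)%E.
Proof.
move=> t0 [sf _] [sg _].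
have mf i := square_integrable_cmeasurable (sf i).
have mg i := square_integrable_cmeasurable (sg i).
rewrite !integral_sumsq// -!nneseriesZl; last 2 first.
- by move=> i _; exact: sqnorm_ge0.
- by move=> i _; exact: sqnorm_ge0.
rewrite -nneseriesD; last 2 first.
- by move=> i _; rewrite mule_ge0 ?sqnorm_ge0// lee_fin invr_ge0 ltW.
- by move=> i _; rewrite mule_ge0 ?sqnorm_ge0// lee_fin ltW.
apply: lee_nneseries => i _; first by rewrite mule_ge0 ?L2norm_ge0.
rewrite -!sqr_L2norm.
have := L2norm_fin (square_integrable_sqnorm (sf i)).
have := L2norm_fin (square_integrable_sqnorm (sg i)).
have := L2norm_ge0 mu (f i); have := L2norm_ge0 nu (g i).
case: (L2norm mu (f i)) => [a| |]//; case: (L2norm nu (g i)) => [b| |]//.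
rewrite !lee_fin => b0 a0 _ _.
have t1 : t != 0 by rewrite gt_eqF.
rewrite -subr_ge0 (_ : _ - _ = t^-1 * ((a - t * b) ^+ 2 + t * (a * b))); last by field.
by rewrite mulr_ge0 ?invr_ge0 ?(ltW t0)// addr_ge0 ?sqr_ge0// mulr_ge0 ?(ltW t0)// mulr_ge0.
Qed.

End approximation.

Section restrictions.
Context {R : realType} d (X : measurableType d) (mu : {measure set X -> \bar R}).

Definition restr (A : set X) (f : X -> R[i]) : X -> R[i] := fun x => (\1_A x)%:C * f x.

Lemma normc_restr A f x : normc (restr A f x) <= normc (f x).
Proof.
rewrite normcZ ler_piMl ?normc_ge0// indicE.
by case: (x \in A); rewrite ?normr1 ?normr0.
Qed.

Lemma restr_split A (f : X -> R[i]) : f = (fun x => 1 * restr A f x + restr (~` A) f x).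
Proof.
apply/funext => x; rewrite /restr mul1r !indicE in_setC.
by case: (x \in A); rewrite ?mul1r ?mul0r ?addr0 ?add0r.
Qed.

Lemma cmeasurable_restr A f : measurable A -> cmeasurable f -> cmeasurable (restr A f).
Proof. by move=> mA mf; apply: cmeasurableZ => //; exact: measurable_indic. Qed.

Lemma square_integrable_restr A f : measurable A -> square_integrable mu f ->
  square_integrable mu (restr A f).
Proof.
move=> mA sf; apply: le_square_integrable (sf) _.
  by apply: cmeasurable_restr => //; exact: square_integrable_cmeasurable sf.
by apply: aeW => x; exact: normc_restr.
Qed.

Lemma square_summable_restr A f : measurable A -> square_summable mu f ->
  square_summable mu (fun i => restr A (f i)).
Proof.
move=> mA sf; have [sfi _] := sf; apply: le_square_summable (sf) => i.
  exact: square_integrable_restr.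
apply: L2norm_le; have mf := square_integrable_cmeasurable (sfi i).
by apply: le_sqnorm => //; [exact: cmeasurable_restr|apply: aeW => x; exact: normc_restr].
Qed.

Lemma sumsq_restr A (f : nat -> X -> R[i]) x :
  sumsq (fun i => restr A (f i)) x = (sumsq f \_ A) x.
Proof.
rewrite /patch; case: ifPn => xA.
  by apply: eq_eseriesr => i _; rewrite /restr indicE xA mul1r.
by apply: eseries0 => i _ _; rewrite /restr indicE (negbTE xA) mul0r normc0 expr0n.
Qed.

(** Truncation errors become masses of removed sets for a finite measure dominated by [mu], the kind
    of measure to which Lusin's theorem was fitted. *)
Lemma sumsq_measure (f : nat -> X -> R[i]) : square_summable mu f ->
  exists m : {measure set X -> \bar R}, [/\ (m setT < +oo)%E, m `<< mu &
    forall A, measurable A -> (\int[mu]_x sumsq (fun i => restr A (f i)) x = m A)%E].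
Proof.
move=> sf; have /square_summableP[sfi ff] := sf.
have mf i := square_integrable_cmeasurable (sfi i).
have ms := measurable_sumsq mf.
have mfs : measurable_fun setT (fun x => fine (sumsq f x)).
  exact: (measurableT_comp (@fine_measurable R setT measurableT)).
have f0 x : 0 <= fine (sumsq f x) by rewrite fine_ge0// sumsq_ge0.
have [m mE] := density_measure mu f0 mfs.
have mA A : measurable A -> (m A = \int[mu]_(x in A) sumsq f x)%E.
  move=> mA; rewrite mE; apply: ge0_ae_eq_integral => //.
  - by apply/measurable_EFinP; exact: measurable_funTS.
  - exact: measurable_funTS.
  - by move=> x _; rewrite lee_fin.
  - by move=> x _; exact: sumsq_ge0.
  apply: filterS (square_summable_ae sf) => x fx _.
  by rewrite fineK// ge0_fin_numE// sumsq_ge0.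
exists m; split; first by rewrite mA.
- apply/null_content_dominatesP => A mA' A0; rewrite mA// null_set_integral//.
  exact: measurable_funTS.
- move=> A mA'; rewrite mA// [RHS]integral_mkcond; apply: eq_integral => x _.
  exact: sumsq_restr.
Qed.

End restrictions.

Section kills.
Context {R : realType} dX dY (X : measurableType dX) (Y : measurableType dY).
Variables (mu : {measure set X -> \bar R}) (nu : {measure set Y -> \bar R}).
Implicit Types T : (X -> R[i]) -> (Y -> R[i]).

(** A common consequence of [Mmin] and [Mmax] without the norm closure. The transfer of M-sets works
    with it, and [Psi_Mmax] restores the closure at the end. *)
Definition kills_nbhd (kappa : set (X * Y)) T : Prop :=
  forall f g h, represents mu nu f g h ->
  (exists E, [/\ omega_open mu nu E, kappa `<=` E & vanishes_mae_on mu nu h E]) ->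
  ccvg (fun n => \sum_(i < n) pairing nu T (f i) (g i)) 0.

Lemma omega_openT : omega_open mu nu setT.
Proof.
exists (fun=> setT), (fun=> setT); split => //.
rewrite (_ : _ `+` _ = set0); first exact: mnull0.
apply/seteqP; split => // p [[_ []]|[_ []]]//.
by exists 0%N.
Qed.

Lemma kills_nbhd_zero kappa T : kills_nbhd kappa T -> kills_zero mu nu T.
Proof.
move=> kT f g h fgh h0; apply: kT fgh _; exists setT; split => //.
exact: omega_openT.
Qed.

Lemma Mmin_kills kappa T : Mmin mu nu kappa T -> kills_nbhd kappa T.
Proof.
move=> [_ kT] f g h fgh [E [_ kE hE]]; apply: (kT h) => //; split; first by exists f, g.
by apply: mnull_sub hE => p [/kE].
Qed.

Lemma Gamma_norm0 : (Gamma_norm mu nu (fun=> 0%R) <= 0)%E.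
Proof.
apply: ereal_inf_lbound; exists (fun=> fun=> 0), (fun=> fun=> 0); split.
  split; try exact: square_summable0.
  apply: mnull_sub (mnull0 mu nu) => p /=; apply.
  rewrite (_ : (fun n => _) = fun=> 0); first exact: ccvg_cst.
  by apply/funext => n; rewrite big1// => i _; rewrite mulr0.
rewrite eseries0// => i _ _.
by rewrite [X in (X * _)%E]L2norm_sqrt sqnorm0 poweR0r// mul0e.
Qed.

Lemma Mmax_kills kappa T : Mmax mu nu kappa T -> kills_nbhd kappa T.
Proof.
move=> [_ kT] f g h fgh nE; apply: (kT h) => //; split; first by exists f, g.
move=> e e0; exists h; split; [by exists f, g| exact: nE|].
apply: (@le_lt_trans _ _ 0%E); last by rewrite lte_fin.
under [X in Gamma_norm _ _ X]eq_fun do rewrite subrr.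
exact: Gamma_norm0.
Qed.

(** Continuity in the projective norm: h - k has a representation of small cost, unrelated to the
    given ones of h and k, and [represents_sub] reconciles the three. *)
Lemma Psi_Mmax kappa T : bounded_operator mu nu T -> kills_zero mu nu T ->
  kills_nbhd kappa T -> Mmax mu nu kappa T.
Proof.
move=> bT k0 kT; split => // h f g [_ hk] fgh.
have [M M0 TM] := pairing_sum_bound bT.
apply: ccvg0_approx => e e0.
(* Adding 1 avoids dividing by 0 when the bound [M] is 0. *)
have M1 : 0 < M + 1 by rewrite ltr_wpDl.
have [k [[f' [g' rk]] nk]] := hk _ (divr_gt0 e0 M1).
rewrite /Gamma_norm => /ereal_inf_lt[_ [a [b [rab ->]]] ab].
have c := represents_sub bT k0 fgh rk rab; have c' := kT _ _ _ rk nk.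
exists (fun n => \sum_(i < n) pairing nu T (f i) (g i) - \sum_(i < n) pairing nu T (a i) (b i)).
  have := ccvgD c c'; rewrite addr0; congr ccvg; apply/funext => n.
  by rewrite addrAC subrK.
move=> n; rewrite opprB addrC subrK -lee_fin.
have [sa sb _] := rab; apply: le_trans (TM _ _ n sa sb) _.
apply: (@le_trans _ _ (M%:E * (e / (M + 1))%:E)%E).
  by rewrite lee_wpmul2l ?lee_fin// ltW.
rewrite -EFinM lee_fin mulrCA ler_piMr ?(ltW e0)//.
by rewrite ler_pdivrMr// mul1r lerDl.
Qed.

Lemma pairing_sum_small T : bounded_operator mu nu T ->
  exists2 M : R, 0 <= M & forall f g n (t a b : R), 0 < t ->
    square_summable mu f -> square_summable nu g ->
    (\int[mu]_x sumsq f x <= a%:E)%E -> (\int[nu]_y sumsq g y <= b%:E)%E ->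
    normc (\sum_(i < n) pairing nu T (f i) (g i)) <= M * (t^-1 * a + t * b).
Proof.
move=> bT; have [M M0 TM] := pairing_sum_bound bT; exists M => // f g n t a b t0 sf sg fa gb.
rewrite -lee_fin; apply: le_trans (TM _ _ n sf sg) _.
rewrite EFinM lee_wpmul2l ?lee_fin//; apply: le_trans (L2norm_series_le t0 sf sg) _.
rewrite EFinD !EFinM; apply: leeD; rewrite lee_wpmul2l// lee_fin ?invr_ge0 ltW//.
Qed.

End kills.

Lemma interleave_even {A : Type} (u v : nat -> A) k : interleave u v k.*2 = u k.
Proof. by rewrite /interleave odd_double doubleK. Qed.

Lemma interleave_odd {A : Type} (u v : nat -> A) k : interleave u v k.*2.+1 = v k.
Proof. by rewrite /interleave /= odd_double /= uphalf_double. Qed.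

Lemma interleave_all {A : Type} (Q : A -> Prop) (u v : nat -> A) :
  (forall i, Q (u i)) -> (forall i, Q (v i)) -> forall i, Q (interleave u v i).
Proof. by move=> Qu Qv i; rewrite /interleave; case: ifP. Qed.

(** The complement of one rectangle is a union of two rectangles, and intersecting with the family
    already obtained yields two families, which are interleaved. Finiteness of the union is what
    makes this induction possible. *)
Lemma rectangles_compl dX dY (X : measurableType dX) (Y : measurableType dY)
    (A : nat -> set X) (B : nat -> set Y) N :
  (forall n, measurable (A n)) -> (forall n, measurable (B n)) ->
  exists (A' : nat -> set X) (B' : nat -> set Y),
    [/\ forall n, measurable (A' n), forall n, measurable (B' n) &
        ~` [set p | exists2 i, (i < N)%N & A i p.1 /\ B i p.2] =
        \bigcup_n (A' n `*` B' n)].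
Proof.
move=> mA mB; elim: N => [|N [A' [B' [mA' mB' E]]]].
  exists (fun=> setT), (fun=> setT); split => //.
  apply/seteqP; split => [p _|p _ [j]]; last by rewrite ltn0.
  by exists 0%N.
exists (interleave (fun n => A' n `&` ~` A N) A'), (interleave B' (fun n => B' n `&` ~` B N)); split.
- by apply: interleave_all => // n; apply: measurableI => //; exact: measurableC.
- by apply: interleave_all => // n; apply: measurableI => //; exact: measurableC.
apply/seteqP; split => [[x y] /= np|[x y] [n _]].
  have : (~` [set p | exists2 i, (i < N)%N & A i p.1 /\ B i p.2]) (x, y).
    by move=> [i iN Ap]; apply: np; exists i => //; exact: ltn_trans iN (ltnSn N).
  rewrite E => -[n _ [/= A'x B'y]].
  have [Ax|nAx] := pselect (A N x).
    exists n.*2.+1 => //; rewrite !interleave_odd; split => //; split => // By.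
    by apply: np; exists N.
  by exists n.*2 => //; rewrite !interleave_even; split.
have key : A' n./2 x /\ B' n./2 y -> forall i, (i < N)%N -> ~ (A i x /\ B i y).
  move=> [A'x B'y] i iN Ap.
  have : (\bigcup_n (A' n `*` B' n)) (x, y) by exists n./2.
  by rewrite -E; apply; exists i.
rewrite /interleave; case: ifP => _ [/= h1 h2] [j]; rewrite ltnS leq_eqVlt => /orP[/eqP ->|iN].
- by move=> [_ By]; case: h2 => _; exact.
- by apply: key => //; split => //; case: h2.
- by move=> [Ax _]; case: h1 => _; exact.
- by apply: key => //; split => //; case: h1.
Qed.

(** * Marginally null and omega-open sets under phi x psi *)

Section preimages.
Context {R : realType} {dX dX1 dY dY1 : measure_display}.
Context {X : measurableType dX} {X1 : measurableType dX1}.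
Context {Y : measurableType dY} {Y1 : measurableType dY1}.
Variables (mu : {measure set X -> \bar R}) (mu1 : {measure set X1 -> \bar R}).
Variables (nu : {measure set Y -> \bar R}) (nu1 : {measure set Y1 -> \bar R}).
Variables (phi : X -> X1) (psi : Y -> Y1).
Hypotheses (mphi : measurable_fun setT phi) (mpsi : measurable_fun setT psi).
Hypotheses (phimu : pushforward mu phi `<< mu1) (psinu : pushforward nu psi `<< nu1).

Lemma measurable_preimage d d1 (Z : measurableType d) (Z1 : measurableType d1)
  (t : Z -> Z1) B : measurable_fun setT t -> measurable B -> measurable (t @^-1` B).
Proof. by move=> mt mB; rewrite -[X in measurable X]setTI; exact: mt. Qed.

Lemma preimage_null d d1 (Z : measurableType d) (Z1 : measurableType d1)
    (m : {measure set Z -> \bar R}) (m1 : {measure set Z1 -> \bar R}) (t : Z -> Z1) N :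
  pushforward m t `<< m1 -> measurable N -> m1 N = 0%E -> m (t @^-1` N) = 0%E.
Proof.
move=> tm mN N0; apply: (tm N) => //.
exact/measure0_null_setP.
Qed.

Definition pmap_pair (p : X * Y) : X1 * Y1 := (phi p.1, psi p.2).

Lemma mnull_preimage N : marginally_null mu1 nu1 N ->
  marginally_null mu nu (pmap_pair @^-1` N).
Proof.
move=> [X0 [Y0 [mX0 X00 mY0 Y00 sN]]].
exists (phi @^-1` X0), (psi @^-1` Y0); split.
- exact: measurable_preimage.
- exact: preimage_null phimu mX0 X00.
- exact: measurable_preimage.
- exact: preimage_null psinu mY0 Y00.
- by move=> [x y] /= /sN[[/= h _]|[_ /= h]]; [left|right].
Qed.

Lemma omega_open_preimage E : omega_open mu1 nu1 E -> omega_open mu nu (pmap_pair @^-1` E).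
Proof.
move=> [A [B [mA mB nE]]].
exists (fun n => phi @^-1` A n), (fun n => psi @^-1` B n); split.
- by move=> n; exact: measurable_preimage.
- by move=> n; exact: measurable_preimage.
apply: mnull_sub (mnull_preimage nE) => -[x y] [[Exy nU]|[[n _ [Ax By]] nE']].
  by left; split => // -[n _ [Ax By]]; apply: nU; exists n.
by right; split => //; exists n.
Qed.

End preimages.

Section elementary_tensors.
Context {R : realType} dX dY (X : measurableType dX) (Y : measurableType dY).
Variables (mu : {measure set X -> \bar R}) (nu : {measure set Y -> \bar R}).
Implicit Types T : (X -> R[i]) -> (Y -> R[i]).

Definition single {A : Type} (f : A -> R[i]) (i : nat) : A -> R[i] :=
  if i is 0%N then f else fun=> 0.

Lemma square_summable_single d (Z : measurableType d) (m : {measure set Z -> \bar R}) f :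
  square_integrable m f -> square_summable m (single f).
Proof.
move=> sf; split; first by case=> [|i] //=; exact: square_integrable0.
apply: (@le_lt_trans _ _ (L2norm m f ^+ 2)%E); last first.
  by rewrite sqr_L2norm square_integrable_sqnorm.
apply: lime_le.
  by apply: is_cvg_nneseries => i _ _; rewrite expe_ge0 ?L2norm_ge0.
apply: nearW => -[|n]; first by rewrite big_geq// expe_ge0 ?L2norm_ge0.
rewrite big_nat_recl// big1 ?adde0// => i _.
by rewrite sqr_L2norm /= sqnorm0.
Qed.

Lemma single_sum (V : pzRingType) (K : (X -> R[i]) -> (Y -> R[i]) -> V) f g n :
  K (fun=> 0) (fun=> 0) = 0 -> \sum_(i < n.+1) K (single f i) (single g i) = K f g.
Proof. by move=> K0; rewrite big_ord_recl/= big1 ?addr0. Qed.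

Lemma represents_tensor f g : square_integrable mu f -> square_integrable nu g ->
  represents mu nu (single f) (single g) (fun p => f p.1 * g p.2).
Proof.
move=> sf sg; split; try exact: square_summable_single.
apply: mnull_sub (mnull0 mu nu) => p /=; apply; apply/ccvgP.
apply: cvg_near_cst; exists 1%N => // -[|n]// _.
by rewrite (single_sum (V := R[i]) (K := fun s t => s p.1 * t p.2)) ?mulr0// subrr normc0.
Qed.

Lemma kills_tensor kappa T f g : bounded_operator mu nu T -> kills_nbhd mu nu kappa T ->
  square_integrable mu f -> square_integrable nu g ->
  (exists E, [/\ omega_open mu nu E, kappa `<=` E &
     vanishes_mae_on mu nu (fun p => f p.1 * g p.2) E]) ->
  pairing nu T f g = 0.
Proof.
move=> bT kT sf sg nE.
have c := ccvg_comp leqnSn (kT _ _ _ (represents_tensor sf sg) nE).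
apply: ccvg_unique c; rewrite (_ : (fun n => _) = fun=> pairing nu T f g).
  exact: ccvg_cst.
apply/funext => n; apply: (single_sum (V := R[i]) (K := pairing nu T)).
exact: (pairing0l bT (square_integrable0 nu)).
Qed.

(* [A `*` B `|` kappa] is an omega-open neighbourhood of [kappa] on which the
   tensor vanishes marginally almost everywhere. *)
Lemma kills_rectangle kappa T A B f g : bounded_operator mu nu T ->
  kills_nbhd mu nu kappa T -> measurable A -> measurable B ->
  marginally_null mu nu (kappa `\` A `*` B) ->
  square_integrable mu f -> square_integrable nu g ->
  (forall x y, A x -> B y -> f x * g y = 0) -> pairing nu T f g = 0.
Proof.
move=> bT kT mA mB nk sf sg fg0; apply: (kills_tensor bT kT) => //.
exists ((A `*` B) `|` kappa); split; last 2 first.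
- by move=> p; right.
- apply: mnull_sub nk => -[x y] [+ /= h] => -[[/= Ax By]|kp].
    by exfalso; apply: h; exact: fg0.
  by split => // -[/= Ax By]; apply: h; exact: fg0.
exists (fun=> A), (fun=> B); split => //.
rewrite bigcup_const//; apply: mnull_sub nk => p [[[//|kp] nAB]|[AB nE]] //.
by exfalso; apply: nE; left.
Qed.

Lemma pairing_nonzero T f g : bounded_operator mu nu T ->
  square_integrable mu f -> square_integrable nu g -> pairing nu T f g <> 0 ->
  nonzero_operator mu nu T.
Proof.
move=> bT sf sg Tfg; exists f => // T0; apply: Tfg.
have sT := bounded_operator_L2 bT sf.
rewrite pairingE -(cintegral0 nu); apply: ae_eq_cintegral.
- by apply: cmeasurableM; exact: square_integrable_cmeasurable (sT) || exact: square_integrable_cmeasurable (sg).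
- exact: cmeasurable_cst.
- by apply: filterS T0 => y ->; rewrite mul0r.
Qed.

Lemma nonzero_pairing T : bounded_operator mu nu T -> nonzero_operator mu nu T ->
  exists f g, [/\ square_integrable mu f, square_integrable nu g & pairing nu T f g <> 0].
Proof.
move=> bT [f sf Tf]; apply: contrapT => n; apply: Tf.
apply: (bounded_operator_neq0 bT) => // f' g sf' sg.
by apply: contrapT => ne; apply: n; exists f', g.
Qed.

End elementary_tensors.

(** * A Borel left inverse of phi, and surjectivity of [pull] *)

Section measurable_left_inverse.
Context {R : realType} dX dX1 (X : measurableType dX) (X1 : measurableType dX1).
Variables (mu : {measure set X -> \bar R}) (mu1 : {measure set X1 -> \bar R}).
Variable phi : X -> X1.
Hypothesis mphi : measurable_fun setT phi.
Hypotheses (smu : standard_measure mu) (smu1 : standard_measure mu1).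
Hypothesis phimu : pushforward mu phi `<< mu1.

(** Images of Borel sets are measurable only for the completion of [mu1], so each image of [U n] is
    replaced by a Borel set [B n]; the difference has a [mu]-null preimage. Almost every x then has
    the same digits as phi x has for [B], and decoding them recovers x. *)
Lemma ae_left_inverse : ae_injective_measurable_inverse mu mu1 phi ->
  exists rho : X1 -> X, measurable_fun setT rho /\ {ae mu, forall x, rho (phi x) = x}.
Proof.
move=> [L [nL injL _ mL]].
have [w0 [mw0 w01 w0fin]] := sigma_finite_weight smu.1.
have w00 x : 0 <= w0 x by have /andP[/ltW] := w01 x.
have [m mE] := density_measure mu w00 mw0.
have mfin : (m setT < +oo)%E by rewrite mE.
have m_mu : m `<< mu.
  apply/null_content_dominatesP => A mA A0; rewrite mE null_set_integral//.
  by apply/measurable_EFinP; exact: measurable_funTS.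
(* Positivity of the weight turns the [m]-almost everywhere decoding into a [mu]-almost everywhere
   one. *)
have mu_m : mu `<< m.
  apply/null_content_dominatesP => A mA A0.
  have {}A0 : (\int[mu]_(x in A) (w0 x)%:E = 0)%E by rewrite -mE.
  have : ae_eq mu A (EFin \o w0) (cst 0%E).
    apply/ae_eq_integral_abs => //.
      by apply/measurable_EFinP; exact: measurable_funTS.
    rewrite -A0; apply: eq_integral => x _ /=.
    by rewrite ger0_norm.
  move=> [N [mN N0 sN]]; apply: (subset_measure0 (B := N)) => // x Ax.
  apply: sN => /= /(_ Ax) /= [] wx; have := w01 x; by rewrite wx ltxx.
have [U [g [mU mg gE]]] := standard_code smu mfin m_mu.
have /choice[B BE] : forall n, exists B, measurable B /\
    {ae mu, forall x, U n x <-> B (phi x)}.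
  move=> n; have [B mB [N nN BNE]] := mL _ (mU n); exists B; split => //.
  have aeN : {ae mu, forall x, ~ N (phi x)}.
    have [N' [mN' N'0 NN']] := nN.
    exists (phi @^-1` N'); split; first exact: measurable_preimage.
      exact: preimage_null phimu mN' N'0.
    by move=> x /= /contrapT; exact: NN'.
  have aeL : {ae mu, forall x, ~ L x}.
    by apply: negligibleS nL => x /= /contrapT.
  apply: filterS2 aeN aeL => x nNx nLx; split => [Ux|Bx].
    have : (phi @` (U n `&` ~` L)) (phi x) by exists x.
    by rewrite -BNE => -[].
  have : (B `|` N) (phi x) by left.
  rewrite BNE => -[x' [Ux' nLx'] xx'].
  by rewrite -(injL x' x) ?inE.
have mB n : measurable (B n) by case: (BE n).
exists (g \o ternary B); split.
  by apply: (measurableT_comp mg); exact: measurable_ternary.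
have gE' : {ae mu, forall x, g (ternary U x) = x}.
  have [N [mN N0 sN]] := gE; exists N; split => //.
  exact: (measure0_null_setP mu mN).1 (mu_m _ ((measure0_null_setP m mN).2 N0)).
have aeB : {ae mu, forall x, forall n, U n x <-> B n (phi x)}.
  by apply: ae_foralln => n; case: (BE n).
apply: filterS2 gE' aeB => x gx Bx; rewrite /= -[RHS]gx; congr g.
rewrite /ternary; congr (limn (series _)); apply/funext => n; congr ((nat_of_bool _)%:R * _).
by apply/idP/idP; rewrite !inE => /Bx.
Qed.

Variables (w : X -> R) (r : X1 -> R) (P : probability R R) (G : X1 * R -> X).
Hypothesis H : disintegrates mu mu1 phi w r P G.

Lemma pull_onto (f : X -> R[i]) : ae_injective_measurable_inverse mu mu1 phi ->
  square_integrable mu f ->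
  exists2 f1, square_integrable mu1 f1 & {ae mu, forall x, pull phi w r f1 x = f x}.
Proof.
move=> /ae_left_inverse[rho [mrho rhoE]] sf.
have [mw w01 mr r0 _] := H.
have w0 x : 0 < w x by have /andP[] := w01 x.
have mf := square_integrable_cmeasurable sf.
have ff := square_integrable_sqnorm sf.
pose f1 x1 := (Num.sqrt (r x1) / Num.sqrt (w (rho x1)))%:C * f (rho x1).
have msr : measurable_fun setT (fun x => Num.sqrt (r x)) by exact: measurable_sqrt.
have mwr : measurable_fun setT (fun x => w (rho x)) by exact: (measurableT_comp mw mrho).
have mk : measurable_fun setT (fun x1 => Num.sqrt (r x1) / Num.sqrt (w (rho x1))).
  apply: measurable_funM => //; apply: measurable_inv; last by move=> x; exact: sqrtr_ge0.
  by apply: measurable_sqrt => // x; exact: ltW.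
have mf1 : cmeasurable f1.
  by apply: cmeasurableZ => //; exact: cmeasurable_comp mrho mf.
have rn0 : {ae mu, forall x, r (phi x) <> 0}.
  exists (phi @^-1` [set x1 | r x1 = 0]); split.
  - exact: (measurable_preimage mphi (measurable_density_zero H)).
  - exact: density_zero mphi H.
  - by move=> x /= /contrapT.
exists f1; last first.
  apply: filterS2 rhoE rn0 => x rx /eqP rn.
  rewrite /pull /f1 rx mulrA -rmorphM /=.
  rewrite [X in X%:C](_ : _ = 1) ?mul1r//.
  have a0 : Num.sqrt (w x) != 0 by rewrite gt_eqF// sqrtr_gt0.
  have b0 : Num.sqrt (r (phi x)) != 0 by rewrite gt_eqF// sqrtr_gt0 lt_def rn r0.
  by field; rewrite a0 b0.
apply/square_integrableP; split => //.
pose h x : \bar R := (normc (f (rho x)) ^+ 2 * (w (rho x))^-1)%:E.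
have mh : measurable_fun setT h.
  apply/measurable_EFinP; apply: measurable_funM.
    apply: measurable_funX; apply: (measurable_normc (f := fun x => f (rho x))).
    exact: cmeasurable_comp mrho mf.
  by apply: measurable_inv => // x; exact: ltW.
have h0 x : (0 <= h x)%E by rewrite lee_fin mulr_ge0 ?sqr_ge0// invr_ge0 ltW.
have I1 : sqnorm mu1 f1 = (\int[mu1]_x (h x * (r x)%:E))%E.
  apply: eq_integral => x _; rewrite -EFinM; congr EFin; rewrite /f1 normcZ exprMn real_normK ?num_real//.
  rewrite expr_div_n !sqr_sqrtr ?(ltW (w0 _)) ?r0//.
  by rewrite mulrC mulrA [RHS]mulrAC.
have I2 : sqnorm mu f = (\int[mu]_x (h (phi x) * (w x)%:E))%E.
  apply: ge0_ae_eq_integral => //.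
  - exact: measurable_normc2.
  - apply: emeasurable_funM; last exact/measurable_EFinP.
    exact: (measurableT_comp mh mphi).
  - by move=> x _; rewrite lee_fin sqr_ge0.
  - by move=> x _; rewrite mule_ge0// lee_fin ltW.
  apply: filterS rhoE => x rx _; rewrite /h rx -EFinM -mulrA mulVf ?mulr1//.
  by rewrite gt_eqF.
by rewrite I1 -(disintegration_base H mh h0) -I2.
Qed.

End measurable_left_inverse.

(** * Transfer of operators *)

Lemma push_pull_restr {R : realType} d d1 (Z : measurableType d) (Z1 : measurableType d1)
    (m : {measure set Z -> \bar R}) (m1 : {measure set Z1 -> \bar R}) t v q (Q : probability R R) K g :
  measurable_fun setT t -> disintegrates m m1 t v q Q K -> standard_measure m1 ->
  square_integrable m1 g ->
  {ae m1, forall x, push v q Q K (pull t v q g) x = restr (~` [set x | q x = 0]) g x}.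
Proof.
move=> mt Hd sm1 sg.
apply: filterS (push_pull mt Hd sm1 (square_integrable_cmeasurable sg)) => x.
have [q0 _|qn0] := eqVneq (q x) 0.
  by rewrite /push /restr indicE memNset ?q0 ?sqrtr0 ?mul0r//; exact.
move=> [/eqP|->]; first by rewrite (negbTE qn0).
by rewrite /restr indicE mem_set ?mul1r//=; exact/eqP.
Qed.

Section transfer.
Context {R : realType} {dX dX1 dY dY1 : measure_display}.
Context {X : measurableType dX} {X1 : measurableType dX1}.
Context {Y : measurableType dY} {Y1 : measurableType dY1}.
Variables (mu : {measure set X -> \bar R}) (mu1 : {measure set X1 -> \bar R}).
Variables (nu : {measure set Y -> \bar R}) (nu1 : {measure set Y1 -> \bar R}).
Variables (phi : X -> X1) (psi : Y -> Y1).
Variables (w : X -> R) (r : X1 -> R) (P : probability R R) (G : X1 * R -> X).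
Variables (w' : Y -> R) (r' : Y1 -> R) (P' : probability R R) (G' : Y1 * R -> Y).
Hypotheses (mphi : measurable_fun setT phi) (mpsi : measurable_fun setT psi).
Hypotheses (H : disintegrates mu mu1 phi w r P G) (H' : disintegrates nu nu1 psi w' r' P' G').
Hypotheses (smu : standard_measure mu) (snu : standard_measure nu).
Hypotheses (smu1 : standard_measure mu1) (snu1 : standard_measure nu1).
Hypotheses (phimu : pushforward mu phi `<< mu1) (psinu : pushforward nu psi `<< nu1).
Variable kappa1 : set (X1 * Y1).

Notation pmap_pair := (pmap_pair phi psi).
Notation pullX := (pull phi w r).
Notation pullY := (pull psi w' r').
Notation pushX := (push w r P G).
Notation pushY := (push w' r' P' G').

(** At almost all pairs with nonzero densities, almost all fibre points lie over the pair, avoid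
    [X0] and [Y0], and have square summable fibre sequences. There the series vanishes pointwise on
    the product of the fibres and can be integrated by [bilinear_cintegral_cvg0]. *)
Lemma push_tensor_cvg0 (E1 : set (X1 * Y1)) f g :
  square_summable mu f -> square_summable nu g ->
  marginally_null mu nu [set p | E1 (phi p.1, psi p.2) /\
    ~ ccvg (fun n => \sum_(i < n) f i p.1 * g i p.2) 0] ->
  marginally_null mu1 nu1 [set p | E1 p /\
    ~ ccvg (fun n => \sum_(i < n) pushX (f i) p.1 * pushY (g i) p.2) 0].
Proof.
move=> sf sg [X0 [Y0 [mX0 X00 mY0 Y00 sN]]].
pose good d d1 (Z : measurableType d) (Z1 : measurableType d1) (t : Z -> Z1) (v : Z -> R)
  (Q : probability R R) (K : Z1 * R -> Z) (N : set Z) (k : nat -> Z -> R[i]) z :=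
  {ae Q, forall u, t (K (z, u)) = z /\ ~ N (K (z, u))} /\
  (\int[Q]_u sumsq (fun i u => fibre v K (k i) (z, u)) u < +oo)%E.
have gX : {ae mu1, forall x1, r x1 = 0 \/ good _ _ _ _ phi w P G X0 f x1}.
  have a1 := ae_fibre_section mphi H smu1.
  have a2 := ae_fibre_null mphi H mX0 X00.
  have a3 := ae_fibre_sumsq H sf.
  apply: filterS3 a1 a2 a3 => x1.
  move=> [|b1]; first by left.
  move=> [|b2]; first by left.
  move=> [|b3]; first by left.
  by right; split => //; apply: filterS2 b1 b2 => u.
have gY : {ae nu1, forall y1, r' y1 = 0 \/ good _ _ _ _ psi w' P' G' Y0 g y1}.
  have a1 := ae_fibre_section mpsi H' snu1.
  have a2 := ae_fibre_null mpsi H' mY0 Y00.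
  have a3 := ae_fibre_sumsq H' sg.
  apply: filterS3 a1 a2 a3 => x1.
  move=> [|b1]; first by left.
  move=> [|b2]; first by left.
  move=> [|b3]; first by left.
  by right; split => //; apply: filterS2 b1 b2 => u.
apply: mnull_sub (mnull_ae gX gY) => -[x1 y1] /= [E1xy nc] [gx gy]; apply: nc.
case: gx => [rx|[sx fx]].
  rewrite (_ : (fun n => _) = fun=> 0); first exact: ccvg_cst.
  by apply/funext => n; rewrite big1// => i _; rewrite /push rx sqrtr0 !mul0r.
case: gy => [ry|[sy fy]].
  rewrite (_ : (fun n => _) = fun=> 0); first exact: ccvg_cst.
  by apply/funext => n; rewrite big1// => i _; rewrite /push ry sqrtr0 !mul0r mulr0.
have [sf2 _] := sf; have [sg2 _] := sg.
have mf i := cmeasurable_fibre1 H x1 (square_integrable_cmeasurable (sf2 i)).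
have mg i := cmeasurable_fibre1 H' y1 (square_integrable_cmeasurable (sg2 i)).
have c := bilinear_cintegral_cvg0 mf mg fx fy.
rewrite (_ : (fun n => _) = fun n => ((Num.sqrt (r x1))%:C * (Num.sqrt (r' y1))%:C) *
  \sum_(i < n) cintegral P (fun u => fibre w G (f i) (x1, u)) *
               cintegral P' (fun u => fibre w' G' (g i) (y1, u))); last first.
  by apply/funext => n; rewrite big_distrr/=; apply: eq_bigr => i _; rewrite /push mulrACA.
rewrite -[X in ccvg _ X](mulr0 ((Num.sqrt (r x1))%:C * (Num.sqrt (r' y1))%:C)).
apply: ccvgM; apply: c; apply: filterS sx => u [Gu nX]; apply: filterS sy => v [Gv nY].
rewrite (_ : (fun n => _) = fun n =>
  (((Num.sqrt (w (G (x1, u))))^-1)%:C * ((Num.sqrt (w' (G' (y1, v))))^-1)%:C) *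
  \sum_(i < n) f i (G (x1, u)) * g i (G' (y1, v))); last first.
  by apply/funext => n; rewrite big_distrr/=; apply: eq_bigr => i _; rewrite /fibre mulrACA.
rewrite -[X in ccvg _ X](mulr0 (((Num.sqrt (w (G (x1, u))))^-1)%:C * ((Num.sqrt (w' (G' (y1, v))))^-1)%:C)).
apply: ccvgM; apply: contrapT => nc.
have : (X0 `*` setT `|` setT `*` Y0) (G (x1, u), G' (y1, v)).
  by apply: sN; split => //=; rewrite Gu Gv.
by move=> [[/= ? _]|[_ /= ?]].
Qed.

Section pull_push.
Variables (T1 : (X1 -> R[i]) -> (Y1 -> R[i])) (bT1 : bounded_operator mu1 nu1 T1).
Notation T := (fun f => pullY (T1 (pushX f))).

Lemma pull_push_bounded : bounded_operator mu nu T.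
Proof.
apply: (bounded_operator_comp bT1); first exact: (push_contraction H).
exact: (pull_contraction mpsi H').
Qed.

Lemma pairing_pull_push f g : square_integrable mu f -> square_integrable nu g ->
  pairing nu T f g = pairing nu1 T1 (pushX f) (pushY g).
Proof.
move=> sf sg; apply: (pairing_comp bT1 (push_contraction H)) => // g1 g' sg1 sg'.
under eq_fun do rewrite mulrC; rewrite -(push_pull_adjoint mpsi H')//.
by under eq_fun do rewrite mulrC.
Qed.

(** [W] may miss a marginally null part of kappa1, whereas [kills_nbhd] asks for honest inclusion;
    joining kappa1 to [W] repairs this without spoiling the vanishing. *)
Lemma push_kills W f g : omega_open mu1 nu1 (W `|` kappa1) ->
  marginally_null mu1 nu1 (kappa1 `\` W) ->
  kills_nbhd mu1 nu1 kappa1 T1 ->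
  square_summable mu f -> square_summable nu g ->
  marginally_null mu nu [set p | W (pmap_pair p) /\
    ~ ccvg (fun n => \sum_(i < n) f i p.1 * g i p.2) 0] ->
  ccvg (fun n => \sum_(i < n) pairing nu T (f i) (g i)) 0.
Proof.
move=> oW nW kT1 sf sg fg.
have sf1 := square_summable_contraction (push_contraction H) sf.
have sg1 := square_summable_contraction (push_contraction H') sg.
have [h1 rh1] := represents_exists sf1 sg1.
have h1W : vanishes_mae_on mu1 nu1 h1 W.
  by apply: (represents_vanish rh1); exact: push_tensor_cvg0.
have [[sfi _] [sgi _]] := (sf, sg).
rewrite (_ : (fun n => _) = fun n => \sum_(i < n)
   pairing nu1 T1 (pushX (f i)) (pushY (g i))); last first.
  by apply/funext => n; apply: eq_bigr => i _; rewrite pairing_pull_push.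
apply: kT1 rh1 _; exists (W `|` kappa1); split; [exact: oW|by move=> p; right|].
apply: mnull_sub (mnullU h1W nW) => p [[Wp|kp] hp]; first by left.
by have [Wp|nWp] := pselect (W p); [left|right].
Qed.

Lemma kills_nbhd_transfer : omega_closed mu1 nu1 kappa1 ->
  kills_nbhd mu1 nu1 kappa1 T1 -> kills_nbhd mu nu (pmap_pair @^-1` kappa1) T.
Proof.
move=> [A [B [mA mB nk]]] kT1 f g h rh [E [[C [D [mC mD nE]]] kE hE]].
have [sf sg _] := rh; have [[sfi _] [sgi _]] := (sf, sg).
have nv := vanish_represents rh hE.
have [X0 [Y0 [mX0 X00 mY0 Y00 sN]]] :=
  mnullU (mnullU (mnull_preimage mphi mpsi phimu psinu nk) nE) nv.
(* Four families: rectangles covering E, preimages of rectangles off kappa1, and the two strips over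
   [X0] and [Y0], which make the covering hold at every point. *)
pose CC := interleave (interleave C (fun n => phi @^-1` A n)) (interleave (fun=> X0) (fun=> setT)).
pose DD := interleave (interleave D (fun n => psi @^-1` B n)) (interleave (fun=> setT) (fun=> Y0)).
have mCC i : measurable (CC i).
  apply: interleave_all; apply: interleave_all => // n; exact: measurable_preimage.
have mDD i : measurable (DD i).
  apply: interleave_all; apply: interleave_all => // n; exact: measurable_preimage.
have cover x y : exists i, CC i x /\ DD i y.
  have [X0x|nX0] := pselect (X0 x).
    by exists (0.*2.*2.+1)%N; rewrite /CC /DD !interleave_odd.
  have [Y0y|nY0] := pselect (Y0 y).
    by exists (0.*2.+1.*2.+1)%N; rewrite /CC /DD !interleave_odd.
  have nN : ~ (X0 `*` [set: Y] `|` [set: X] `*` Y0) (x, y) by move=> [[]|[]].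
  have [kxy|nkxy] := pselect (kappa1 (phi x, psi y)).
    have Exy : E (x, y) by exact: kE.
    have [[n _ [Cx Dy]]|nC] := pselect ((\bigcup_n (C n `*` D n)) (x, y)).
      by exists n.*2.*2; rewrite /CC /DD !interleave_even.
    by exfalso; apply: nN; apply: sN; left; right; left.
  have [[n _ [Ax By]]|nC] := pselect ((\bigcup_n (A n `*` B n)) (phi x, psi y)).
    by exists n.*2.+1.*2; rewrite /CC /DD !interleave_even !interleave_odd.
  by exfalso; apply: nN; apply: sN; left; left; left.
have [m [mfin m_mu mE]] := sumsq_measure sf.
have [n [nfin n_nu nE']] := sumsq_measure sg.
have [_ ff] := (square_summableP mu f).1 sf.
have [_ fg] := (square_summableP nu g).1 sg.
have [M M0 TM] := pairing_sum_small pull_push_bounded.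
pose Sf := fine (\int[mu]_x sumsq f x)%E.
pose Sg := fine (\int[nu]_y sumsq g y)%E.
have SfE : (\int[mu]_x sumsq f x)%E = Sf%:E.
  by rewrite fineK// ge0_fin_numE// integral_ge0// => x _; exact: sumsq_ge0.
have SgE : (\int[nu]_x sumsq g x)%E = Sg%:E.
  by rewrite fineK// ge0_fin_numE// integral_ge0// => x _; exact: sumsq_ge0.
have Sf0 : 0 <= Sf by rewrite fine_ge0// integral_ge0// => x _; exact: sumsq_ge0.
have Sg0 : 0 <= Sg by rewrite fine_ge0// integral_ge0// => x _; exact: sumsq_ge0.
apply: ccvg0_approx => e e0.
(* The removed sets will have mass below t^2. With parameter t the term with f cut off costs at most
   M t (1 + Sg); with parameter 1/t the one with g cut off costs at most M t (1 + Sf). Their sum t c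
   is at most e, and c + 1 is never 0. *)
pose c := M * (1 + Sg) + M * (1 + Sf).
have c0 : 0 <= c by rewrite addr_ge0// mulr_ge0// addr_ge0.
pose t := e / (c + 1).
have t0 : 0 < t by rewrite divr_gt0// ltr_wpDl.
have [X' [Y' [N [[mX' mY'] mX'e nY'e XY']]]] :=
  omega_compactness smu mfin m_mu snu nfin n_nu mCC mDD cover (mulr_gt0 t0 t0).
(* Its rectangles come from the omega-open complement of kappa1, so [W] meets kappa1 in a marginally
   null set; being a finite union, it has an omega-open complement. *)
pose W := [set p : X1 * Y1 | exists2 i, (i < N)%N & A i p.1 /\ B i p.2].
have sfX := square_summable_restr mX' sf; have sgY := square_summable_restr mY' sg.
have sfXc := square_summable_restr (measurableC mX') sf.
have sgYc := square_summable_restr (measurableC mY') sg.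
exists (fun n => \sum_(i < n) pairing nu T (restr X' (f i)) (restr Y' (g i))).
  have nW : marginally_null mu1 nu1 (kappa1 `&` W).
    apply: mnull_sub nk => p [kp [i _ [Ap Bp]]].
    by right; split; [exists i|exact].
  apply: (@push_kills (~` W) (fun i => restr X' (f i)) (fun i => restr Y' (g i))) => //.
  - have [A' [B' [mA' mB' WE]]] := rectangles_compl N mA mB.
    exists A', B'; split => //; rewrite -WE; apply: mnull_sub nW => p.
    move=> [[[//|kp] nnW]|[nWp nU]]; last by exfalso; apply: nU; left.
    by split => //; exact: contrapT.
  - by apply: mnull_sub nW => p [kp nnW]; split => //; exact: contrapT.
  exists X0, Y0; split => // -[x y] /= [nWp ncv]; apply: contrapT => nN; apply: ncv.
  have [X'x|nX'x] := pselect (X' x); last first.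
    rewrite (_ : (fun n => _) = fun=> 0); first exact: ccvg_cst.
    apply/funext => k; rewrite big1// => i _.
    by rewrite /restr indicE memNset// !mul0r.
  have [Y'y|nY'y] := pselect (Y' y); last first.
    rewrite (_ : (fun n => _) = fun=> 0); first exact: ccvg_cst.
    apply/funext => k; rewrite big1// => i _.
    by rewrite /restr [X in _ * (X%:C * _)]indicE memNset// mul0r mulr0.
  rewrite (_ : (fun n => _) = fun n => \sum_(i < n) f i x * g i y); last first.
    apply/funext => k; apply: eq_bigr => i _.
    by rewrite /restr !indicE !mem_set// !mul1r.
  (* The rectangle around (x, y) has index below N, and the two levels of interleaving divide the
     index by 4. Outside [W], [X0] and [Y0] it must be some C x D, so the point is in E up to the
     null set, and there the series tends to 0. *)
  have [i [iN]] := XY' x y X'x Y'y.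
  have iN2 : (i./2./2 < N)%N.
    by rewrite (leq_ltn_trans _ iN)// -!divn2 -divnMA leq_div.
  rewrite /CC /DD /interleave; case: ifP => _; case: ifP => _ hx hy.
  - by exfalso; apply: nN; right.
  - by exfalso; apply: nN; left.
  - by exfalso; apply: nWp; exists i./2./2.
  apply: contrapT => ncv; apply: nN; apply: (sN (x, y)).
  have [Exy|nExy] := pselect (E (x, y)); first by right.
  by left; right; right; split => //; exists i./2./2.
move=> k.
(* Cutting one factor at a time leaves two error terms, each with one truncated factor: f off [X']
   against g, and f on [X'] against g off [Y']. *)
have pE i : pairing nu T (f i) (g i) = pairing nu T (restr X' (f i)) (restr Y' (g i)) +
    (pairing nu T (restr (~` X') (f i)) (g i) + pairing nu T (restr X' (f i)) (restr (~` Y') (g i))).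
  have [[a _] [b _]] := (sfX, sfXc); have [[a' _] [b' _]] := (sgY, sgYc).
  rewrite [in LHS](restr_split X' (f i)) (pairing_linearl 1 pull_push_bounded (a i) (b i) (sgi i)).
  rewrite [in X in 1 * X](restr_split Y' (g i)) (pairing_linearr 1 pull_push_bounded (a i) (a' i) (b' i)).
  by rewrite !mul1r -addrA; congr (_ + _); rewrite addrC.
under eq_bigr do rewrite pE.
rewrite big_split/= addrAC subrr add0r big_split/=.
apply: le_trans (le_normcD _ _) _.
have t1 : t != 0 by rewrite gt_eqF.
have ti0 : 0 < t^-1 by rewrite invr_gt0.
rewrite (_ : e = e / (c + 1) * (c + 1)); last by rewrite divfK// gt_eqF// ltr_wpDl.
apply: (@le_trans _ _ (M * (t^-1 * (t * t) + t * Sg) + M * (t^-1^-1 * Sf + t^-1 * (t * t)))).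
  apply: lerD.
    apply: (TM (fun i => restr (~` X') (f i)) g) => //; last by rewrite SgE.
    by rewrite mE ?(ltW mX'e)//; exact: measurableC.
  apply: (TM (fun i => restr X' (f i)) (fun i => restr (~` Y') (g i))) => //; last first.
    by rewrite nE' ?(ltW nY'e)//; exact: measurableC.
  rewrite mE// -SfE; rewrite (_ : (\int[mu]_x _)%E = m setT).
    by apply: le_measure; rewrite ?inE.
  rewrite -mE//; apply: eq_integral => x _; rewrite sumsq_restr patchT//.
  by rewrite inE.
rewrite mulKf// invrK (_ : _ + _ = t * c); last by rewrite /c; ring.
by rewrite -/t ler_wpM2l ?(ltW t0)// lerDl.
Qed.

Lemma pull_push_compact : compact_operator mu1 nu1 T1 -> compact_operator mu nu T.
Proof.
apply: (compact_operator_comp bT1); first exact: (push_contraction H).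
exact: (pull_contraction mpsi H').
Qed.

Lemma pull_push_Mmin : Mmin mu1 nu1 kappa1 T1 -> Mmin mu nu (pmap_pair @^-1` kappa1) T.
Proof.
move=> [_ kT1]; split; first exact: pull_push_bounded.
move=> h f g [_ hk] fgh; have [sf sg _] := fgh.
have sf1 := square_summable_contraction (push_contraction H) sf.
have sg1 := square_summable_contraction (push_contraction H') sg.
have [h1 rh1] := represents_exists sf1 sg1.
have h1W : vanishes_mae_on mu1 nu1 h1 kappa1.
  apply: (represents_vanish rh1).
  apply: (push_tensor_cvg0 sf sg).
  exact: vanish_represents fgh hk.
have [[sfi _] [sgi _]] := (sf, sg).
rewrite (_ : (fun n => _) = fun n => \sum_(i < n)
   pairing nu1 T1 (pushX (f i)) (pushY (g i))); last first.
  apply/funext => n; apply: eq_bigr => i _.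
  exact: (pairing_pull_push (sfi i) (sgi i)).
apply: (kT1 h1 (fun i => pushX (f i)) (fun i => pushY (g i))) => //.
by split => //; exists (fun i => pushX (f i)), (fun i => pushY (g i)).
Qed.

(** Since kappa1 avoids the zeros of the densities up to a marginally null set, the parts of f and g
    living on those zeros do not contribute to the pairing with [T1]. The remaining parts are push
    (pull f) and push (pull g), whose pairing with [T1] is that of [T] with the pulled functions. *)
Lemma pull_push_nonzero : kills_nbhd mu1 nu1 kappa1 T1 ->
  marginally_null mu1 nu1 (kappa1 `&` [set p | r p.1 = 0 \/ r' p.2 = 0]) ->
  nonzero_operator mu1 nu1 T1 -> nonzero_operator mu nu T.
Proof.
move=> kT1 nk /(nonzero_pairing bT1)[f [g [sf sg fg]]].
have spf := square_integrable_pull mphi H sf.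
have spg := square_integrable_pull mpsi H' sg.
have mZ := measurable_density_zero H; have mZ' := measurable_density_zero H'.
apply: (pairing_nonzero pull_push_bounded spf spg).
rewrite (pairing_pull_push spf spg) => pp0; apply: fg.
have sfZ := square_integrable_restr mZ sf.
have sfZc := square_integrable_restr (measurableC mZ) sf.
have sgZ := square_integrable_restr mZ' sg.
have sgZc := square_integrable_restr (measurableC mZ') sg.
rewrite [in LHS](restr_split [set x | r x = 0] f) (pairing_linearl 1 bT1 sfZ sfZc sg).
rewrite (kills_rectangle bT1 kT1 (measurableC mZ) (@measurableT _ Y1) _ sfZ sg); first last.
- by move=> x y nZ _; rewrite /restr indicE memNset// !mul0r.
- apply: mnull_sub nk => p [kp nZ]; split => //; left.
  by apply: contrapT => rp; apply: nZ.
rewrite [in LHS](restr_split [set x | r' x = 0] g) (pairing_linearr 1 bT1 sfZc sgZ sgZc).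
rewrite (kills_rectangle bT1 kT1 (@measurableT _ X1) (measurableC mZ') _ sfZc sgZ); first last.
- by move=> x y _ nZ; rewrite /restr [X in _ * (X%:C * _)]indicE memNset// mul0r mulr0.
- apply: mnull_sub nk => p [kp nZ]; split => //; right.
  by apply: contrapT => rp; apply: nZ.
rewrite !mulr0 !add0r -pp0; apply: (pairing_ae (mu := mu1)) => //.
- exact: (square_integrable_push H).
- exact: (square_integrable_push H').
- by apply: filterS (push_pull_restr mphi H smu1 sf) => x ->.
- by apply: filterS (push_pull_restr mpsi H' snu1 sg) => x ->.
Qed.

End pull_push.

Section push_pull.
Variables (T : (X -> R[i]) -> (Y -> R[i])) (bT : bounded_operator mu nu T).
Notation T1 := (fun f => pushY (T (pullX f))).

Lemma push_pull_bounded : bounded_operator mu1 nu1 T1.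
Proof.
apply: (bounded_operator_comp bT); first exact: (pull_contraction mphi H).
exact: (push_contraction H').
Qed.

Lemma push_pull_compact : compact_operator mu nu T -> compact_operator mu1 nu1 T1.
Proof.
apply: (compact_operator_comp bT); first exact: (pull_contraction mphi H).
exact: (push_contraction H').
Qed.

Lemma pairing_push_pull f g : square_integrable mu1 f -> square_integrable nu1 g ->
  pairing nu1 T1 f g = pairing nu T (pullX f) (pullY g).
Proof.
move=> sf sg; apply: (pairing_comp bT (pull_contraction mphi H)) => // g' g1 sg' sg1.
exact: (push_pull_adjoint mpsi H').
Qed.

Definition pull2 (h : X1 * Y1 -> R[i]) (p : X * Y) : R[i] :=
  ((Num.sqrt (w p.1) / Num.sqrt (r (phi p.1)))%:C *
   (Num.sqrt (w' p.2) / Num.sqrt (r' (psi p.2)))%:C) * h (pmap_pair p).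

Lemma represents_pull2 f g h : represents mu1 nu1 f g h ->
  represents mu nu (fun i => pullX (f i)) (fun i => pullY (g i)) (pull2 h).
Proof.
move=> [sf sg nh]; split.
- exact: square_summable_contraction (pull_contraction mphi H) sf.
- exact: square_summable_contraction (pull_contraction mpsi H') sg.
apply: mnull_sub (mnull_preimage mphi mpsi phimu psinu nh) => -[x y] /= nc c.
apply: nc; have := @ccvgM _ _ _ ((Num.sqrt (w x) / Num.sqrt (r (phi x)))%:C *
   (Num.sqrt (w' y) / Num.sqrt (r' (psi y)))%:C) c.
congr ccvg; apply/funext => n; rewrite big_distrr/=; apply: eq_bigr => i _.
by rewrite /pull mulrACA.
Qed.

Lemma vanish_pull2 h E : vanishes_mae_on mu1 nu1 h E ->
  vanishes_mae_on mu nu (pull2 h) (pmap_pair @^-1` E).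
Proof.
move=> hE; apply: mnull_sub (mnull_preimage mphi mpsi phimu psinu hE) => p /= [Ep hp].
by split => // h0; apply: hp; rewrite /pull2 h0 mulr0.
Qed.

Lemma Gamma_pull2 h : Gamma mu1 nu1 h -> Gamma mu nu (pull2 h).
Proof.
by move=> [f [g /represents_pull2 ?]]; exists (fun i => pullX (f i)), (fun i => pullY (g i)).
Qed.

Lemma Gamma_norm_pull2 h : (Gamma_norm mu nu (pull2 h) <= Gamma_norm mu1 nu1 h)%E.
Proof.
apply: le_ereal_inf_tmp => _ [f [g [fgh ->]]].
apply: (@le_trans _ _ (\sum_(i <oo) L2norm mu (pullX (f i)) * L2norm nu (pullY (g i)))%E).
  apply: ereal_inf_lbound; exists (fun i => pullX (f i)), (fun i => pullY (g i)).
  by split; first exact: represents_pull2.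
have [[sf _] [sg _] _] := fgh.
apply: lee_nneseries => i _; first by rewrite mule_ge0 ?L2norm_ge0.
apply: lee_pmul; rewrite ?L2norm_ge0//.
  exact: (L2contraction_le (pull_contraction mphi H)).
exact: (L2contraction_le (pull_contraction mpsi H')).
Qed.

(** Kept general in the two sets of tensors, so that the M and M_1 cases differ only in why [pull2]
    maps one set into the other. *)
Lemma push_pull_annihilator (S : set (X * Y -> R[i])) (S1 : set (X1 * Y1 -> R[i])) :
  (forall h, S1 h -> S (pull2 h)) ->
  annihilator mu nu S T -> annihilator mu1 nu1 S1 T1.
Proof.
move=> SS [_ kT]; split; first exact: push_pull_bounded.
move=> h f g S1h fgh; have [[sf _] [sg _] _] := fgh.
have := kT _ _ _ (SS _ S1h) (represents_pull2 fgh).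
congr ccvg; apply/funext => n; apply: eq_bigr => i _.
by rewrite pairing_push_pull.
Qed.

Lemma push_pull_Mmin : Mmin mu nu (pmap_pair @^-1` kappa1) T -> Mmin mu1 nu1 kappa1 T1.
Proof.
apply: push_pull_annihilator => h [Gh hk]; split; first exact: Gamma_pull2.
exact: vanish_pull2.
Qed.

Lemma push_pull_Mmax : Mmax mu nu (pmap_pair @^-1` kappa1) T -> Mmax mu1 nu1 kappa1 T1.
Proof.
apply: push_pull_annihilator => h [Gh hk]; split; first exact: Gamma_pull2.
move=> e e0; have [k [Gk [E [oE kE vE]] ke]] := hk e e0.
exists (pull2 k); split; first exact: Gamma_pull2.
- exists (pmap_pair @^-1` E); split.
  + exact: (omega_open_preimage mphi mpsi phimu psinu).
  + by move=> p; exact: kE.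
  + exact: vanish_pull2.
rewrite (_ : (fun p => _) = pull2 (fun p => h p - k p)).
  exact: le_lt_trans (Gamma_norm_pull2 _) ke.
by apply/funext => p; rewrite /pull2 mulrBr.
Qed.

Lemma push_pull_nonzero : ae_injective_measurable_inverse mu mu1 phi ->
  ae_injective_measurable_inverse nu nu1 psi ->
  nonzero_operator mu nu T -> nonzero_operator mu1 nu1 T1.
Proof.
move=> iphi ipsi /(nonzero_pairing bT)[f [g [sf sg fg]]].
have [f1 sf1 f1E] := pull_onto mphi smu phimu H iphi sf.
have [g1 sg1 g1E] := pull_onto mpsi snu psinu H' ipsi sg.
apply: (pairing_nonzero push_pull_bounded sf1 sg1).
rewrite pairing_push_pull// => p0; apply: fg; rewrite -p0; symmetry.
apply: (pairing_ae bT) => //.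
- exact: (square_integrable_pull mphi H).
- exact: (square_integrable_pull mpsi H').
Qed.

End push_pull.

End transfer.

(** * The two implications between M-sets, and zeros of the densities *)

Section M_sets.
Context {R : realType} {dX dX1 dY dY1 : measure_display}.
Context {X : measurableType dX} {X1 : measurableType dX1}.
Context {Y : measurableType dY} {Y1 : measurableType dY1}.
Variables (mu : {measure set X -> \bar R}) (mu1 : {measure set X1 -> \bar R}).
Variables (nu : {measure set Y -> \bar R}) (nu1 : {measure set Y1 -> \bar R}).
Variables (phi : X -> X1) (psi : Y -> Y1).
Hypotheses (mphi : measurable_fun setT phi) (mpsi : measurable_fun setT psi).
Hypotheses (smu : standard_measure mu) (snu : standard_measure nu).
Hypotheses (smu1 : standard_measure mu1) (snu1 : standard_measure nu1).
Hypotheses (phimu : pushforward mu phi `<< mu1) (psinu : pushforward nu psi `<< nu1).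
Variable kappa1 : set (X1 * Y1).

Notation kappa := (pmap_pair phi psi @^-1` kappa1).

Lemma M_sets_forward :
  ae_injective_measurable_inverse mu mu1 phi -> ae_injective_measurable_inverse nu nu1 psi ->
  (operator_M_set mu nu kappa -> operator_M_set mu1 nu1 kappa1) /\
  (operator_M1_set mu nu kappa -> operator_M1_set mu1 nu1 kappa1).
Proof.
move=> iphi ipsi.
have [w [r [P [G H]]]] := disintegration smu smu1 mphi phimu.
have [w' [r' [P' [G' H']]]] := disintegration snu snu1 mpsi psinu.
split=> -[T [mT kT nT]]; have [bT _] := mT;
    exists (fun f => push w' r' P' G' (T (pull phi w r f))); split.
- exact: (push_pull_Mmax mphi mpsi H H' phimu psinu bT).
- exact: (push_pull_compact mphi H H' bT).
- exact: (push_pull_nonzero mphi mpsi H H' smu snu phimu psinu bT).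
- exact: (push_pull_Mmin mphi mpsi H H' phimu psinu bT).
- exact: (push_pull_compact mphi H H' bT).
- exact: (push_pull_nonzero mphi mpsi H H' smu snu phimu psinu bT).
Qed.

(** The disintegrations are chosen inside the proof, so the smallness of kappa1 on the zeros of the
    densities is asked of all of them. *)
Lemma M_sets_backward :
  omega_closed mu1 nu1 kappa1 ->
  (forall w r P G w' r' P' G', disintegrates mu mu1 phi w r P G ->
     disintegrates nu nu1 psi w' r' P' G' ->
     marginally_null mu1 nu1 (kappa1 `&` [set p | r p.1 = 0 \/ r' p.2 = 0])) ->
  (operator_M_set mu1 nu1 kappa1 -> operator_M_set mu nu kappa) /\
  (operator_M1_set mu1 nu1 kappa1 -> operator_M1_set mu nu kappa).
Proof.
move=> ck nk.
have [w [r [P [G H]]]] := disintegration smu smu1 mphi phimu.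
have [w' [r' [P' [G' H']]]] := disintegration snu snu1 mpsi psinu.
have {}nk := nk _ _ _ _ _ _ _ _ H H'.
split=> -[T1 [mT kT nT]]; have [bT _] := mT;
    exists (fun f => pull psi w' r' (T1 (push w r P G f))).
  have kk := Mmax_kills mT.
  have kk' := kills_nbhd_transfer mphi mpsi H H' smu snu smu1 snu1 phimu psinu bT ck kk.
  split.
  - apply: Psi_Mmax (kk'); first exact: (pull_push_bounded mpsi H H' bT).
    exact: kills_nbhd_zero kk'.
  - exact: (pull_push_compact mpsi H H' bT).
  - exact: (pull_push_nonzero mphi mpsi H H' smu1 snu1 bT kk nk).
have kk := Mmin_kills mT.
split.
- exact: (pull_push_Mmin mphi mpsi H H' smu1 snu1 bT).
- exact: (pull_push_compact mpsi H H' bT).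
- exact: (pull_push_nonzero mphi mpsi H H' smu1 snu1 bT kk nk).
Qed.

End M_sets.

Section density_zero_set.
Context {R : realType} {dX dX1 : measure_display}.
Context {X : measurableType dX} {X1 : measurableType dX1}.
Variables (mu : {measure set X -> \bar R}) (mu1 : {measure set X1 -> \bar R}).
Variables (phi : X -> X1) (w : X -> R) (q : X1 -> R) (P : probability R R) (G : X1 * R -> X).
Hypothesis mphi : measurable_fun setT phi.
Hypothesis H : disintegrates mu mu1 phi w q P G.

(** The preimage of the zero set is always [mu]-null; domination of [mu1] by the image measure makes
    the zero set itself null. *)
Lemma density_zero_equivalent : mu1 `<< pushforward mu phi ->
  exists N, [/\ measurable N, mu1 N = 0%E & [set x | q x = 0] `<=` N].
Proof.
move=> e; have mZ := measurable_density_zero H.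
exists [set x | q x = 0]; split => //.
apply: (e [set x | q x = 0]) => // A mA AZ.
apply: (subset_measure0 _ _ _ (density_zero mphi H)) => //.
- exact: measurable_preimage.
- exact: measurable_preimage.
- by move=> x; exact: AZ.
Qed.

(** Here q is the density of the image of [w mu] and r that of the image of [mu]. The latter image
    gives no mass to the zeros of q, so r integrates to 0 over them. *)
Lemma density_zero_Radon_Nikodym (r : X1 -> R) :
  Radon_Nikodym_derivative_of mu1 (pushforward mu phi) r ->
  exists N, [/\ measurable N, mu1 N = 0%E &
    [set x | q x = 0] `&` [set x | r x <> 0] `<=` N].
Proof.
move=> [r0 mr rE]; have mZ := measurable_density_zero H.
have I0 : (\int[mu1]_(x in [set x | q x = 0%R]) (r x)%:E = 0)%E.
  by rewrite -rE//; exact: (density_zero mphi H).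
have : ae_eq mu1 [set x | q x = 0] (EFin \o r) (cst 0%E).
  apply/ae_eq_integral_abs => //.
    by apply/measurable_EFinP; exact: measurable_funTS.
  by rewrite -I0; apply: eq_integral => x _ /=; rewrite ger0_norm.
move=> [N [mN N0 sN]]; exists N; split => // x [qx rx]; apply: sN => /= /(_ qx)[].
exact: rx.
Qed.

End density_zero_set.

Theorem theorem4p6 (R : realType) (dX dX1 dY dY1 : measure_display)
    (X : measurableType dX) (X1 : measurableType dX1)
    (Y : measurableType dY) (Y1 : measurableType dY1)
    (mu : {measure set X -> \bar R}) (mu1 : {measure set X1 -> \bar R})
    (nu : {measure set Y -> \bar R}) (nu1 : {measure set Y1 -> \bar R})
    (phi : X -> X1) (psi : Y -> Y1) (r : X1 -> R) (s : Y1 -> R)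
    (kappa1 : set (X1 * Y1)) :
  standard_measure mu -> standard_measure mu1 ->
  standard_measure nu -> standard_measure nu1 ->
  measurable_fun [set: X] phi -> measurable_fun [set: Y] psi ->
  mu_measurable mu1 (range phi) -> mu_measurable nu1 (range psi) ->
  pushforward mu phi `<< mu1 -> pushforward nu psi `<< nu1 ->
  Radon_Nikodym_derivative_of mu1 (pushforward mu phi) r ->
  Radon_Nikodym_derivative_of nu1 (pushforward nu psi) s ->
  omega_closed mu1 nu1 kappa1 ->
  let ZX := [set x1 | r x1 = 0] in
  let ZY := [set y1 | s y1 = 0] in
  let kappa := [set p : X * Y | kappa1 (phi p.1, psi p.2)] in
  [/\ (* (i) *)
      ae_injective_measurable_inverse mu mu1 phi ->
      ae_injective_measurable_inverse nu nu1 psi ->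
      (operator_U_set mu1 nu1 kappa1 -> operator_U_set mu nu kappa) /\
      (operator_U1_set mu1 nu1 kappa1 -> operator_U1_set mu nu kappa),
      (* (ii) *)
      kappa1 `<=` (~` ZX) `*` (~` ZY) ->
      (operator_M_set mu1 nu1 kappa1 -> operator_M_set mu nu kappa) /\
      (operator_M1_set mu1 nu1 kappa1 -> operator_M1_set mu nu kappa) &
      (* (iii) *)
      mu1 `<< pushforward mu phi -> pushforward mu phi `<< mu1 ->
      nu1 `<< pushforward nu psi -> pushforward nu psi `<< nu1 ->
      ae_injective_measurable_inverse mu mu1 phi ->
      ae_injective_measurable_inverse nu nu1 psi ->
      (operator_M_set mu1 nu1 kappa1 <-> operator_M_set mu nu kappa) /\
      (operator_M1_set mu1 nu1 kappa1 <-> operator_M1_set mu nu kappa)].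
Proof.
move=> smu smu1 snu snu1 mphi mpsi _ _ phimu psinu rE sE ck ZX ZY kappa.
have fwd := M_sets_forward mphi mpsi smu snu smu1 snu1 phimu psinu kappa1.
have bwd := M_sets_backward mphi mpsi smu snu smu1 snu1 phimu psinu ck.
split.
- move=> iphi ipsi; have [fM fM1] := fwd iphi ipsi.
  by split => U M; apply: U; [exact: fM|exact: fM1].
- move=> kZ; apply: bwd => w q P G w' q' P' G' H H'.
  have [N [mN N0 sN]] := density_zero_Radon_Nikodym mphi H rE.
  have [N' [mN' N'0 sN']] := density_zero_Radon_Nikodym mpsi H' sE.
  exists N, N'; split => // -[x y] [/kZ[/= rx sy] [/= qx|/= qy]].
    by left; split => //; exact: sN.
  by right; split => //; exact: sN'.
move=> e1 _ e2 _ iphi ipsi; have [fM fM1] := fwd iphi ipsi.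
have [bM bM1] : (operator_M_set mu1 nu1 kappa1 -> operator_M_set mu nu kappa) /\
    (operator_M1_set mu1 nu1 kappa1 -> operator_M1_set mu nu kappa).
  apply: bwd => w q P G w' q' P' G' H H'.
  have [N [mN N0 sN]] := density_zero_equivalent mphi H e1.
  have [N' [mN' N'0 sN']] := density_zero_equivalent mpsi H' e2.
  exists N, N'; split => // -[x y] [_ [/= qx|/= qy]].
    by left; split => //; exact: sN.
  by right; split => //; exact: sN'.
by split; split.
Qed.
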